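(* The set $\mathscr{M} = \{D \in \mathscr{A}(\mathbb{C}_0) : \sigma_a(D) = \frac12\}$ is maximal spaceable in $\mathscr{A}(\mathbb{C}_0)$ (with the supremum norm). More precisely, there is an isometric copy of $\ell_1$ in $\mathscr{A}(\mathbb{C}_0)$ (i.e. the image of a linear isometry $\ell_1 \to \mathscr{A}(\mathbb{C}_0)$) which is contained in $\mathscr{M} \cup \{0\}$.
   Context: $\mathbb{C}_0 = \{s \in \mathbb{C} : \mathrm{Re}\, s > 0\}$. A Dirichlet series is a series $D = \sum_{n=1}^\infty a_n n^{-s}$ with $a_n \in \mathbb{C}$; its abscissa of absolute convergence $\sigma_a(D) \in [-\infty,\infty]$ is the infimum of the $\sigma \in \mathbb{R}$ such that $D$ converges absolutely on $\{\mathrm{Re}\, s > \sigma\}$. A Dirichlet polynomial is a finite sum $\sum_{n=1}^N a_n n^{-s}$. $\mathscr{H}_\infty$ is the Banach algebra, with the supremum norm on $\mathbb{C}_0$, of all bounded holomorphic functions $f:\mathbb{C}_0 \to \mathbb{C}$ which can be represented as a Dirichlet series in some half-plane; $f$ is identified with its Dirichlet series. $\mathscr{A}(\mathbb{C}_0)$ is the closed subalgebra of $\mathscr{H}_\infty$ of all functions which are uniform limits on $\mathbb{C}_0$ of a sequence of Dirichlet polynomials. Let $E$ be a topological vector space. For a cardinal $\kappa$, a subset $Z \subset E$ is $\kappa$-spaceable if $Z \cup \{0\}$ contains a closed vector subspace of $E$ of dimension $\kappa$. A subset $Z \subset E$ is maximal spaceable if it is $\dim(E)$-spaceable. $\ell_1$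 is the space of absolutely summable complex sequences with its usual norm. *)

(* Defs.v *)
From HB Require Import structures.
From mathcomp Require Import all_boot all_order all_algebra.
From mathcomp Require Import all_classical all_reals all_analysis.
From mathcomp Require Import complex.

Set Implicit Arguments.
Unset Strict Implicit.
Unset Printing Implicit Defensive.

Import Order.TTheory GRing.Theory Num.Theory.
Import numFieldNormedType.Exports.
Import Normc.

Local Open Scope classical_set_scope.
Local Open Scope ring_scope.
Local Open Scope complex_scope.
Local Open Scope card_scope.

(* R[i] with the topology of its modulus, as a normed module over itself. *)
HB.instance Definition _ (R : realType) := NormedModule.copy R[i] R[i]^o.

Section Spaceability.
Context {K : numFieldType} {E : topologicalLmodType K}.
Implicit Types (B V Z : set E).

Definition vector_subspace V : Prop :=
  V 0 /\ forall (a : K) (u v : E), V u -> V v -> V (a *: u + v).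

Definition lin_independent B : Prop :=
  forall (s : seq E) (c : E -> K), uniq s -> [set` s] `<=` B ->
    \sum_(x <- s) c x *: x = 0 -> forall x, x \in s -> c x = 0.

Definition lin_span B : set E :=
  [set v | exists (s : seq E) (c : E -> K),
     [set` s] `<=` B /\ v = \sum_(x <- s) c x *: x].

Definition hamel_basis V B : Prop :=
  [/\ B `<=` V, lin_independent B & V `<=` lin_span B].

(* A cardinal is given by any set [kappa] of that cardinality; the dimension is
   the algebraic one. *)
Definition has_dim (T : Type) V (kappa : set T) : Prop :=
  exists2 B : set E, hamel_basis V B & B #= kappa.

Definition spaceable (T : Type) (kappa : set T) Z : Prop :=
  exists V : set E, [/\ vector_subspace V, closed V, has_dim V kappa
                      & V `<=` Z `|` [set 0]].

Definition maximal_spaceable Z : Prop :=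
  exists2 kappa : set E, has_dim [set: E] kappa & spaceable kappa Z.

End Spaceability.

Section DirichletSeries.
Context (R : realType).
Local Notation C := R[i].

Definition halfplane (sigma : R) : set C := [set s | sigma < complex.Re s].

Definition cexp (z : C) : C :=
  (expR (complex.Re z))%:C * (cos (complex.Im z) +i* sin (complex.Im z)).

Definition abs_summable (u : nat -> C) : Prop :=
  cvgn (series (fun n => normc (u n))).

(* n^{-s} for n >= 1 *)
Definition dpow (n : nat) (s : C) : C := cexp (- (s * (ln n%:R)%:C)).

(* Coefficients are indexed from 0: [a n] is the coefficient of (n+1)^{-s}. *)
Definition dterm (a : nat -> C) (s : C) : nat -> C :=
  fun n => a n * dpow n.+1 s.

Definition abs_cvg_abscissa (a : nat -> C) : \bar R :=
  ereal_inf [set sigma%:E | sigma in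
    [set sigma : R | forall s, halfplane sigma s ->
       abs_summable (dterm a s)]].

Definition dirichlet_polynomial (P : C -> C) : Prop :=
  exists (a : nat -> C) (N : nat), forall s, P s = \sum_(n < N) dterm a s n.

(* f has the Dirichlet series with coefficients a in some half-plane; f is only
   meaningful on Re s > 0, hence sigma >= 0. *)
Definition represented_by (f : C -> C) (a : nat -> C) : Prop :=
  exists2 sigma : R, 0 <= sigma &
    forall s, halfplane sigma s -> series (dterm a s) @ \oo --> f s.

(* A function on the half-plane Re s > 0 is encoded by its extension by 0 to C,
   so that distinct elements are distinct functions on the half-plane. *)
Definition Hinfty (f : C -> C) : Prop :=
  [/\ forall s, ~ halfplane 0 s -> f s = 0,
      forall s, halfplane 0 s -> derivable f s 1,
      exists M : R, forall s, halfplane 0 s -> normc (f s) <= M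
    & exists a : nat -> C, represented_by f a].

Definition unif_limit_dirichlet_polynomials (f : C -> C) : Prop :=
  exists2 P : nat -> C -> C, forall k, dirichlet_polynomial (P k) &
    {uniform halfplane 0, P @ \oo --> f}.

Definition AC0_pred : {pred C -> C} :=
  fun f => `[< Hinfty f /\ unif_limit_dirichlet_polynomials f >].

Lemma normc_ge0 (z : C) : 0 <= normc z.
Proof. by case: z => x y /=; rewrite sqrtr_ge0. Qed.

Lemma normr_normc (z : C) : `|z| = (normc z)%:C.
Proof. by rewrite normc_def; case: z. Qed.

Lemma dirichlet_polynomial_lin (k : C) (P Q : C -> C) :
  dirichlet_polynomial P -> dirichlet_polynomial Q ->
  dirichlet_polynomial (k *: P + Q).
Proof.
move=> [a [N aP]] [b [M bQ]].
pose a' n := if (n < N)%N then a n else 0.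
pose b' n := if (n < M)%N then b n else 0.
have ext (c : nat -> C) L L' s : (L <= L')%N ->
    \sum_(n < L) dterm c s n =
    \sum_(n < L') dterm (fun n => if (n < L)%N then c n else 0) s n.
  move=> LL'; rewrite (big_ord_widen L' (fun n => dterm c s n) LL') big_mkcond.
  by apply: eq_bigr => i _; rewrite /dterm; case: ifP => // _; rewrite mul0r.
exists (fun n => k * a' n + b' n), (maxn N M) => s.
rewrite [LHS](_ : _ = k * P s + Q s)//.
rewrite aP bQ (ext a N (maxn N M)) ?leq_maxl// (ext b M (maxn N M)) ?leq_maxr//.
rewrite mulr_sumr -big_split/=; apply: eq_bigr => i _.
by rewrite /dterm mulrDl mulrA.
Qed.

Lemma represented_by_lin (k : C) (f g : C -> C) a b :
  represented_by f a -> represented_by g b ->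
  represented_by (k *: f + g) (k *: a + b).
Proof.
move=> [s1 s10 fa] [s2 s20 gb]; exists (Num.max s1 s2).
  by rewrite le_max s10.
move=> s; rewrite /halfplane/= gt_max => /andP[s1s s2s].
have -> : series (dterm (k *: a + b) s) =
    (fun n => k *: series (dterm a s) n + series (dterm b s) n).
  apply/funext => n; rewrite /series/= scaler_sumr -big_split/=.
  apply: eq_bigr => i _; rewrite /dterm.
  rewrite [(k *: a + b) i](_ : _ = k * a i + b i)// mulrDl.
  by rewrite -mulrA.
apply: cvgD; last exact: gb.
by apply: cvgZl_tmp; exact: fa.
Qed.

Lemma unif_halfplaneP (P : nat -> C -> C) (f : C -> C) :
  {uniform halfplane 0, P @ \oo --> f} <->
  forall e : R, 0 < e -> \forall n \near \oo,
    forall s, halfplane 0 s -> normc (f s - P n s) < e.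
Proof.
split=> [Pf e e0|Pf Q /uniform_nbhs[E [entE EQ]]].
  suff : nbhs (f : {uniform` halfplane 0 -> C})
      [set g | forall s, halfplane 0 s -> normc (f s - g s) < e] by move/Pf.
  apply/uniform_nbhs; exists [set xy : C * C | ball xy.1 e%:C xy.2]; split.
    have eC0 : 0 < e%:C by rewrite ltcR.
    exact: (entourage_ball _ (PosNum eC0)).
  by move=> h hf s /hf /=; rewrite /ball/= normr_normc ltcR.
move: entE; rewrite -entourage_ballE => -[e e0 eE].
have eRe : e = (complex.Re e)%:C.
  by rewrite (RRe_real (gtr0_real e0)).
move: e0; rewrite /= eRe ltcR => e0.
apply: filterS (Pf _ e0) => n nP; apply: EQ => s s0; apply: eE => /=.
by rewrite /ball/= eRe normr_normc ltcR; exact: nP.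
Qed.

Lemma AC0_submod_closed : GRing.submod_closed AC0_pred.
Proof.
split=> [|k f g].
  apply/asboolP; split; first split.
  - by [].
  - by move=> s _; exact: (@derivable_cst _ C C 0).
  - by exists 0 => s _; rewrite [X in normc X](_ : _ = 0)// normc0.
  - exists 0, 0 => // s _.
    rewrite (_ : series _ = cst 0); first exact: cvg_cst.
    apply/funext => n; rewrite /series/= big1// => i _.
    by rewrite /dterm [X in X * _](_ : _ = 0)// mul0r.
  - exists (fun _ _ => 0).
      by move=> k; exists 0, 0%N => s; rewrite big_ord0.
    apply/unif_halfplaneP => e e0; near=> n => s s0.
    by rewrite [X in normc X](_ : _ = 0) ?normc0// subr0.
move=> /asboolP[[f0 fd [Mf fM] [a fa]] [P Pd Pf]].
move=> /asboolP[[g0 gd [Mg gM] [b gb]] [Q Qd Qg]].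
apply/asboolP; split; first split.
- move=> s s0; rewrite [LHS](_ : _ = k * f s + g s)//.
  by rewrite f0// g0// mulr0 addr0.
- move=> s s0; apply: derivableD; last exact: gd.
  by apply: derivableZ; exact: fd.
- exists (normc k * Mf + Mg) => s s0.
  rewrite [X in normc X](_ : _ = k * f s + g s)//.
  apply: (le_trans (le_normcD _ _)); rewrite normcM.
  by apply: lerD; [rewrite ler_wpM2l ?normc_ge0// fM|exact: gM].
- by exists (k *: a + b); exact: represented_by_lin.
- exists (fun n => k *: P n + Q n).
    by move=> n; exact: dirichlet_polynomial_lin.
  apply/unif_halfplaneP => e e0.
  pose d := e / 2 / (normc k + 1).
  have k1 : 0 < normc k + 1 by rewrite ltr_wpDl ?normc_ge0.
  have d0 : 0 < d by rewrite !divr_gt0.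
  have e20 : 0 < e / 2 by rewrite divr_gt0.
  move/unif_halfplaneP/(_ _ d0): Pf => Pf.
  move/unif_halfplaneP/(_ _ e20): Qg => Qg.
  apply: filterS2 Pf Qg => n Pf Qg s s0.
  rewrite [X in normc X](_ : _ = k * (f s - P n s) + (g s - Q n s)); last first.
    by rewrite mulrBr addrACA -opprD.
  apply: (le_lt_trans (le_normcD _ _)); rewrite normcM (splitr e).
  apply: ler_ltD; last exact: Qg.
  apply: (@le_trans _ _ (normc k * d)).
    by rewrite ler_wpM2l ?normc_ge0// ltW// Pf.
  by rewrite /d mulrA ler_pdivrMr// [leLHS]mulrC ler_wpM2l ?lerDl// ltW.
Unshelve. all: by end_near. Qed.

HB.instance Definition _ :=
  GRing.isSubmodClosed.Build C (C -> C) AC0_pred AC0_submod_closed.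

Record AC0 := MkAC0 { AC0_val :> C -> C; _ : AC0_val \in AC0_pred }.

HB.instance Definition _ := [isSub for AC0_val].
HB.instance Definition _ := [Choice of AC0 by <:].
HB.instance Definition _ := [SubChoice_isSubLmodule of AC0 by <:].

(* The supremum norm, as a (real) element of the scalar field R[i]. *)
Definition sup_norm (f : C -> C) : R :=
  sup [set normc (f s) | s in halfplane 0].

Definition AC0_norm (f : AC0) : C := (sup_norm f)%:C.

Lemma AC0_HinftyP (f : AC0) : Hinfty f.
Proof. by case: f => f /= /asboolP[]. Qed.

Lemma halfplane01 : halfplane 0 1.
Proof. by rewrite /halfplane/=. Qed.

Lemma le_sup_norm (f : AC0) s : halfplane 0 s -> normc (f s) <= sup_norm f.
Proof.
have [_ _ [M fM] _] := AC0_HinftyP f.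
move=> s0; apply: ub_le_sup; last by exists s.
by exists M => _ [t t0 <-]; exact: fM.
Qed.

Lemma ge_sup_norm (f : C -> C) (M : R) :
  (forall s, halfplane 0 s -> normc (f s) <= M) -> sup_norm f <= M.
Proof.
move=> fM; apply: ge_sup; last by move=> _ [t t0 <-]; exact: fM.
by exists (normc (f 1)); exists 1 => //; exact: halfplane01.
Qed.

Lemma AC0_normD (f g : AC0) : AC0_norm (f + g) <= AC0_norm f + AC0_norm g.
Proof.
rewrite /AC0_norm -rmorphD/= lecR; apply: ge_sup_norm => s s0.
rewrite [X in normc X](_ : _ = f s + g s)//.
by apply: (le_trans (le_normcD _ _)); rewrite lerD ?le_sup_norm.
Qed.

Lemma AC0_normZ (k : C) (f : AC0) : AC0_norm (k *: f) = `|k| * AC0_norm f.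
Proof.
rewrite /AC0_norm normr_normc -rmorphM/=; congr (_%:C).
have le_k (l : C) (g : AC0) : sup_norm (l *: g : AC0) <= normc l * sup_norm g.
  apply: ge_sup_norm => s s0; rewrite [X in normc X](_ : _ = l * g s)//.
  by rewrite normcM ler_wpM2l ?normc_ge0// le_sup_norm.
apply/eqP; rewrite eq_le le_k/=; have [->|k0] := eqVneq k 0.
  rewrite normc0 mul0r.
  exact: le_trans (normc_ge0 _) (le_sup_norm (0 *: f) halfplane01).
have nk0 : 0 < normc k.
  by rewrite lt_neqAle normc_ge0 eq_sym andbT; apply: contra_neq k0 => /eq0_normc.
rewrite -ler_pdivlMl// -normcV -{1}(scalerK k0 f).
exact: le_k.
Qed.

Lemma AC0_norm_eq0 (f : AC0) : AC0_norm f = 0 -> f = 0.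
Proof.
move=> [nf0]; apply/val_inj/funext => s.
have [f0 _ _ _] := AC0_HinftyP f.
have [s0|/f0//] := pselect (halfplane 0 s).
apply: eq0_normc; apply/eqP; rewrite eq_le normc_ge0 andbT -nf0.
exact: le_sup_norm.
Qed.

HB.instance Definition _ :=
  Lmodule_isNormed.Build C AC0 AC0_normD AC0_normZ AC0_norm_eq0.

Definition scriptM : set AC0 :=
  [set f : AC0 | exists2 a, represented_by f a & abs_cvg_abscissa a = (2^-1)%:E].

Definition ell1_pred : {pred nat -> C} := fun u => `[< abs_summable u >].

Lemma abs_summable_lin (k : C) (u v : nat -> C) :
  abs_summable u -> abs_summable v -> abs_summable (k *: u + v).
Proof.
move=> su sv; rewrite /abs_summable.
pose w n := normc k * normc (u n) + normc (v n).
have wE : w = normc k *: (fun n => normc (u n)) + (fun n => normc (v n)) by [].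
have cw : cvgn (series w).
  by rewrite wE; apply: is_cvg_seriesD => //; exact: is_cvg_seriesZ.
apply: series_le_cvg cw => n; first exact: normc_ge0.
  by rewrite addr_ge0 ?mulr_ge0 ?normc_ge0.
rewrite [X in normc X](_ : _ = k * u n + v n)// /w -normcM.
exact: le_normcD.
Qed.

Lemma ell1_submod_closed : GRing.submod_closed ell1_pred.
Proof.
split=> [|k u v /asboolP su /asboolP sv].
  apply/asboolP; rewrite /abs_summable (_ : series _ = cst 0).
    exact: is_cvg_cst.
  apply/funext => n; rewrite /series/= big1// => i _.
  exact: normc0.
by apply/asboolP; exact: abs_summable_lin.
Qed.

HB.instance Definition _ :=
  GRing.isSubmodClosed.Build C (nat -> C) ell1_pred ell1_submod_closed.

Record ell1 := MkEll1 { ell1_val :> nat -> C; _ : ell1_val \in ell1_pred }.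

HB.instance Definition _ := [isSub for ell1_val].
HB.instance Definition _ := [Choice of ell1 by <:].
HB.instance Definition _ := [SubChoice_isSubLmodule of ell1 by <:].

Definition ell1_norm (u : ell1) : C :=
  (limn (series (fun n => normc (u n))))%:C.

Lemma ell1_summable (u : ell1) : abs_summable u.
Proof. by case: u => u /= /asboolP. Qed.
Arguments ell1_summable u : clear implicits.

Lemma ell1_normD (u v : ell1) : ell1_norm (u + v) <= ell1_norm u + ell1_norm v.
Proof.
pose w (x : ell1) : nat -> R := fun n => normc (x n).
have cw x : cvgn (series (w x)) by exact: ell1_summable x.
rewrite /ell1_norm -rmorphD/= lecR -/(w u) -/(w v).
rewrite -(lim_seriesD (cw u) (cw v)).
apply: (@lim_series_le _ (w (u + v)) (w u + w v)); first exact: cw.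
  by apply: is_cvg_seriesD; exact: cw.
by move=> n; exact: le_normcD.
Qed.

Lemma ell1_normZ (k : C) (u : ell1) : ell1_norm (k *: u) = `|k| * ell1_norm u.
Proof.
rewrite /ell1_norm normr_normc -rmorphM/=; congr (_%:C).
rewrite -[RHS](lim_seriesZ (normc k) (ell1_summable u)).
congr (limn (series _)); apply/funext => n.
rewrite [RHS](_ : _ = normc k * normc (u n))// -normcM.
by congr normc.
Qed.

Lemma ell1_norm_eq0 (u : ell1) : ell1_norm u = 0 -> u = 0.
Proof.
move=> [nu0]; apply/val_inj/funext => n.
apply: eq0_normc; apply/eqP; rewrite eq_le normc_ge0 andbT -nu0.
have nd : nondecreasing_seq (series (fun n => normc (u n))).
  by apply: nondecreasing_series => i _ _; exact: normc_ge0.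
apply: le_trans (nondecreasing_cvgn_le nd (ell1_summable u) n.+1).
by rewrite seriesSr lerDr sumr_ge0// => i _; exact: normc_ge0.
Qed.

HB.instance Definition _ :=
  Lmodule_isNormed.Build C ell1 ell1_normD ell1_normZ ell1_norm_eq0.

End DirichletSeries.

(* Main.v *)
Require Import Defs.
From HB Require Import structures.
From mathcomp Require Import all_boot all_order all_algebra.
From mathcomp Require Import all_classical all_reals all_analysis.
From mathcomp Require Import complex.
From mathcomp Require Import zify ring lra.

(** The isometry sends [x] to the product of [\sum_k x_k q_k ^ - s], for reserved
primes [q_k], with one fixed peak function [u] whose Dirichlet series has abscissa
of absolute convergence 1/2.

The function [u] is [(1 + z) / 2 + (1 - z)^2 w / 8] with [z = 2 ^ - s]. If
[|w| <= 1] then [|u| <= 1], because [|1 + z| / 2 + |1 - z|^2 / 8 <= 1] on the unit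
disc ([multiplier_weight_le]), and [u] is near 1 where [z] is near 1, whatever [w]
is.

The core function [w] ([core_function]) is a sum of blocks. A block is a
multilinear form in the variables [p ^ - s], one slot of primes [p] for each
argument, whose coefficients are products of entries of a Hadamard matrix. By
orthogonality such a form with [2 rho] slots of [n] primes has modulus at most
about [n ^ (rho + 1/2)] on the half-plane, although it has [n ^ (2 rho)] unimodular
coefficients, at distinct integers by unique factorization ([block_jet],
[hadamard_block]). A Chebyshev bound ([prime_count_lb]) keeps these integers below
[n ^ (2 rho)] up to logarithmic factors, so that a normalized block still has
absolute sum at least 1 to the left of [1/2 - 1/rho]. As [rho] grows along the
blocks, absolute convergence fails to the left of 1/2. To the right of 1/2 it
holds by the Cauchy-Schwarz inequality, the coefficients being square summable.
Derivatives and quadratic remainders of the blocks are estimated along with their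
values, which makes [w] holomorphic ([cdiff_csum]).

The blocks avoid 2 and the reserved primes. Hence the coefficient of the product at
[q_k M], for [M] in the support of the core series, is a nonzero multiple of [x_k],
and the abscissa is 1/2 as soon as [x] is not zero ([embed_abscissa]). The norm of the image
is [\sum_k |x_k|] because near the imaginary axis [z] can be brought close to 1
while all terms [x_k q_k ^ - s] align ([prime_phases_align], a form of Kronecker's
theorem proved by averaging against a Fejer-type kernel).

For spaceability, the range of the isometry is closed as the space of summable
sequences is complete ([range_closed]). It contains a linearly independent family
indexed by the subsets of the integers ([almost_disjoint_free]), and the ambient
space injects into the set of these subsets ([cut_code_inj]). Hamel bases of both
spaces extending that family have therefore the same cardinality. *)

Set Implicit Arguments.
Unset Strict Implicit.
Unset Printing Implicit Defensive.

Import Order.TTheory GRing.Theory Num.Theory.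
Import numFieldNormedType.Exports.
Import Normc.

(** * Primes: a Chebyshev lower bound and block parameters *)

Lemma expn2_le_central_bin n : 2 ^ n <= 'C(n.*2, n).
Proof.
elim: n => // n IH; rewrite doubleS binS expnS mul2n -addnn.
have le_bin m k : 'C(m, k) <= 'C(m.+1, k).
  by case: k => [|k]; rewrite ?bin0 // binS leq_addr.
apply: leq_add; apply: leq_trans IH _; last exact: le_bin.
by rewrite binS leq_addl.
Qed.

(** By Legendre's formula the exponent of [p] in the central binomial
coefficient is a sum over the powers [p ^ k] of terms equal to 0 or 1, and the
terms with [p ^ k > n.*2] vanish. *)
Lemma expn_logn_central_bin n p : 0 < n -> prime p ->
  p ^ logn p 'C(n.*2, n) <= n.*2.
Proof.
move=> n0 pp; have p1 := prime_gt1 pp.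
have dn0 : 0 < n.*2 by rewrite double_gt0.
have le_n : n <= n.*2 by rewrite -addnn leq_addr.
have E := bin_fact le_n; rewrite -{2}addnn addnK in E.
have := congr1 (logn p) E.
rewrite !lognM ?muln_gt0 ?fact_gt0 ?bin_gt0 // !logn_fact //.
have -> : \sum_(1 <= k < n.+1) n %/ p ^ k = \sum_(1 <= k < n.*2.+1) n %/ p ^ k.
  rewrite [RHS](big_cat_nat _ (n := n.+1)) ?ltnS //=.
  rewrite [X in _ = _ + X]big1_seq ?addn0 // => k /andP[_].
  rewrite mem_index_iota => /andP[nk _].
  by rewrite divn_small // (leq_trans nk) // ltnW // ltn_expl.
move=> H; have {E} E : logn p 'C(n.*2, n) =
    \sum_(1 <= k < n.*2.+1) (n.*2 %/ p ^ k - (n %/ p ^ k + n %/ p ^ k)).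
  rewrite sumnB ?big_split /=; first by lia.
  move=> k _; rewrite leq_divRL ?expn_gt0 ?prime_gt0 // mulnDl -addnn.
  by rewrite leq_add // leq_trunc_div.
apply: leq_trans (_ : p ^ trunc_log p n.*2 <= _); last exact: trunc_logP.
rewrite leq_exp2l // E.
have tle : trunc_log p n.*2 <= n.*2.
  by rewrite ltnW // -(ltn_exp2l _ _ p1) (leq_ltn_trans (trunc_logP p1 dn0)) //
    ltn_expl.
rewrite (big_cat_nat _ (n := (trunc_log p n.*2).+1)) //=.
rewrite [X in _ + X]big1_seq ?addn0; last first.
  move=> k /andP[_]; rewrite mem_index_iota => /andP[tk _]; rewrite divn_small ?sub0n //.
  by rewrite (leq_trans (trunc_log_ltn _ p1)) // leq_exp2l.
apply: (@leq_trans (\sum_(1 <= k < (trunc_log p n.*2).+1) 1)); last first.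
  by rewrite sum_nat_const_nat muln1 subn1.
apply: leq_sum => k _.
by rewrite -addnn; have := leq_divDl (p ^ k) n n; lia.
Qed.

Definition prime_count n := \sum_(0 <= p < n.+1 | prime p) 1.

(** [2 ^ n <= 'C(2 n, n)], and that coefficient is a product over the primes up
to [2 n] of powers which are each at most [2 n]; here [2 n = 2 ^ y]. *)
Lemma prime_count_lb y : 0 < y -> 2 ^ y.-1 <= y * prime_count (2 ^ y).
Proof.
case: y => // y _ /=; rewrite -(@leq_exp2l 2) //.
set n := 2 ^ y; have n0 : 0 < n by rewrite expn_gt0.
have nE : 2 ^ y.+1 = n.*2 by rewrite expnS mul2n.
apply: leq_trans (expn2_le_central_bin n) _.
have b0 : 0 < 'C(n.*2, n) by rewrite bin_gt0 -addnn leq_addr.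
set b := 'C(_, _) in b0 *.
rewrite -(partn_pi b0) (widen_partn _ (leq_addr n.*2 b)) nE.
rewrite (eq_bigl (fun p => (p \in primes b))); last by move=> p; rewrite inE.
rewrite (big_cat_nat _ (n := n.*2.+1)) ?leq_addl //=; last by rewrite ltnS leq_addl.
rewrite [X in _ * X <= _]big1_seq ?muln1; last first.
  move=> p /andP[]; rewrite mem_primes => /and3P[pp _ pb].
  rewrite mem_index_iota => /andP[np _].
  have : p ^ 1 <= n.*2.
    apply: leq_trans (expn_logn_central_bin n0 pp).
    by rewrite leq_exp2l ?prime_gt1 // logn_gt0 mem_primes pp b0.
  by rewrite expn1 leqNgt np.
rewrite expnM nE.
apply: (@leq_trans (\prod_(0 <= p < n.*2.+1 | prime p) n.*2)); last first.
  by rewrite expn_sum.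
rewrite big_mkcond [leqRHS]big_mkcond; apply: leq_prod => p _.
rewrite mem_primes; case: ifP => [/and3P[pp _ _]|_]; rewrite ?pp.
  exact: expn_logn_central_bin.
by case: ifP => // _; rewrite double_gt0.
Qed.

Lemma next_prime_ex n : exists p, (n < p) && prime p.
Proof. by have [p np pp] := prime_above n; exists p; rewrite np. Qed.

Fixpoint nth_prime k :=
  if k is k'.+1 then ex_minn (next_prime_ex (nth_prime k')) else 2.

Lemma prime_nth_prime k : prime (nth_prime k).
Proof. by case: k => //= k; case: ex_minnP => p /andP[]. Qed.

Lemma nth_primeS k : nth_prime k < nth_prime k.+1.
Proof. by move=> /=; case: ex_minnP => p /andP[]. Qed.

Lemma ltn_nth_prime : {mono nth_prime : i j / i < j}.
Proof.
by apply: leqW_mono; apply: leq_mono; apply: homo_ltn nth_primeS; exact: ltn_trans.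
Qed.

Lemma nth_prime_inj : injective nth_prime.
Proof. exact: incn_inj (leq_mono (homo_ltn ltn_trans nth_primeS)). Qed.

Lemma nth_prime_gt k : k.+1 < nth_prime k.
Proof.
by elim: k => // k IH; apply: leq_ltn_trans (nth_primeS k).
Qed.

Lemma nth_prime_onto k p : prime p -> p < nth_prime k ->
  p \in map nth_prime (iota 0 k).
Proof.
move=> pp; elim: k => [|k IH]; first by case: p pp => [|[|]].
rewrite [nth_prime _.+1]/=; case: ex_minnP => q /andP[kq _] minq pq.
rewrite -[k.+1]addn1 iotaD map_cat mem_cat.
have := ltngtP p (nth_prime k) => -[/IH -> //|kp|->]; last by rewrite add0n /= mem_seq1 eqxx orbT.
by have := minq p; rewrite kp pp leqNgt pq => /(_ isT).
Qed.

Lemma nth_prime_le k N : k < prime_count N -> nth_prime k <= N.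
Proof.
apply: contraTT; rewrite -ltnNge -leqNgt => Nk.
rewrite /prime_count -big_filter sum1_size.
rewrite -[leqRHS](size_iota 0) -[leqRHS](size_map nth_prime).
apply: uniq_leq_size; first by rewrite filter_uniq // iota_uniq.
move=> p; rewrite mem_filter mem_index_iota ltnS => /andP[pp /= pN].
by apply: nth_prime_onto => //; exact: leq_ltn_trans Nk.
Qed.

Lemma expn2_ge_linear c L : exists2 t, L <= t & c * t.+1 <= 2 ^ t.
Proof.
pose d := 2 * c + L; exists (d + d); first by rewrite /d; lia.
rewrite expnD; apply: (@leq_trans (d.+1 * d.+1)); first by rewrite /d; nia.
by rewrite leq_mul // ltn_expl.
Qed.

(** Here [2 ^ l] will be the number of letters available in each of [r.+2.*2]
slots and [2 ^ y] the bound on the primes that encode them. By the Chebyshev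
bound [y] need exceed [l] only by some [t] of the order of [log l]. The last
inequality then leaves enough room for a multilinear form divided by its
supremum to keep an absolute sum of at least 1 at abscissa [1 / 2 - 1 / (r + 2)],
even after losing a power of [y] in every slot. Only primes of odd index are
used, and indices start at [L]. *)
Lemma block_parameters r L : exists l y, [/\ 0 < y,
  forall k, k < (r.+2).*2 * 2 ^ l -> nth_prime (L + k).*2.+1 <= 2 ^ y
  & (2 ^ 10 * y ^ 4) ^ r.+2 * 2 ^ (y * r) <= (2 ^ l) ^ r.+1].
Proof.
have [t Lt ct] := expn2_ge_linear (8 * (r + 3) * (14 * (r + 3))) L.+1.
(* With [y ^ 4 <= 2 ^ (4 * t)] this value turns the last condition into an
equality of exponents. *)
pose l := (10 + 4 * t) * r.+2 + t * r.
have tl : t <= l by rewrite /l; nia.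
have yt : l + t <= 14 * (r + 3) * t.+1 by rewrite /l; nia.
have y2 : l + t <= 2 ^ t by nia.
exists l, (l + t); split; first by lia.
  move=> k; set n := 2 ^ l => kn; apply: nth_prime_le.
  have Ln : L <= n by rewrite (leq_trans _ (ltnW (ltn_expl l (isT : 1 < 2)))) //; lia.
  have y0 : 0 < l + t by lia.
  rewrite -(ltn_pmul2l y0); apply: leq_trans (prime_count_lb y0).
  have -> : (l + t).-1 = l + t.-1 by lia.
  rewrite expnD -/n.
  have E : 2 ^ t = 2 * 2 ^ t.-1 by rewrite -expnS prednK; lia.
  have : (l + t) * (4 * (r + 3)) <= 2 ^ t.-1.
    rewrite -(@leq_pmul2l 2) // -E (leq_trans _ ct) //.
    by rewrite mulnCA [2 * _]mulnC; nia.
  have n0 : 0 < n by rewrite expn_gt0.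
  move=> h; apply: (@leq_trans (n * ((l + t) * (4 * (r + 3))))); last first.
    by rewrite leq_mul2l h orbT.
  have : (L + k).*2.+2 <= n * (4 * (r + 3)) by nia.
  by nia.
have -> : (2 ^ l) ^ r.+1 = (2 ^ (10 + 4 * t)) ^ r.+2 * 2 ^ ((l + t) * r).
  by rewrite -!expnM -expnD; congr (2 ^ _); rewrite /l; nia.
rewrite leq_mul // leq_exp2r // expnD leq_mul // mulnC expnM leq_exp2r //.
Qed.

Local Open Scope classical_set_scope.
Local Open Scope ring_scope.
Local Open Scope complex_scope.

(** * Complex modulus, absolutely convergent series, exponential *)

Section ComplexModulus.
Context {R : realType}.
Local Notation C := R[i].
Implicit Types (x y z : C) (u v : nat -> C) (M : nat -> R).

Lemma normcDC x y : normc (x + y) <= normc x + normc y.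
Proof. exact: le_normcD. Qed.

Lemma normcNC x : normc (- x) = normc x.
Proof. exact: normcN. Qed.

Lemma normcBC x y : normc (x - y) <= normc x + normc y.
Proof. by rewrite -(normcNC y); exact: normcDC. Qed.

Lemma normc_distC x y : normc (x - y) = normc (y - x).
Proof. by rewrite -normcNC opprB. Qed.

Lemma normc_sum (I : Type) (r : seq I) (P : pred I) (F : I -> C) :
  normc (\sum_(i <- r | P i) F i) <= \sum_(i <- r | P i) normc (F i).
Proof.
elim/big_ind2 : _ => [|x a y b xa yb|//]; first by rewrite normc0.
by apply: le_trans (normcDC _ _) _; exact: lerD.
Qed.

Lemma normc_real (a : R) : normc a%:C = `|a|.
Proof. by rewrite /= expr0n addr0 sqrtr_sqr. Qed.

Lemma normcX x n : normc (x ^+ n) = normc x ^+ n.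
Proof. by elim: n => [|n IH]; rewrite ?normc1 // !exprS normcM IH. Qed.

Lemma normc_prod (I : Type) (r : seq I) (P : pred I) (F : I -> C) :
  normc (\prod_(i <- r | P i) F i) = \prod_(i <- r | P i) normc (F i).
Proof. by apply: (big_morph _ (@normcM R)); rewrite normc1. Qed.

Lemma sqr_normcE x : normc x ^+ 2 = complex.Re x ^+ 2 + complex.Im x ^+ 2.
Proof. by case: x => a b /=; rewrite sqr_sqrtr // addr_ge0 ?sqr_ge0. Qed.

Lemma normRe_le x : `|complex.Re x| <= normc x.
Proof.
rewrite -(@ler_pXn2r _ 2) ?nnegrE ?normc_ge0 // sqr_normcE real_normK ?num_real//.
by rewrite lerDl sqr_ge0.
Qed.

Lemma normIm_le x : `|complex.Im x| <= normc x.
Proof.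
rewrite -(@ler_pXn2r _ 2) ?nnegrE ?normc_ge0 // sqr_normcE real_normK ?num_real//.
by rewrite lerDr sqr_ge0.
Qed.

Lemma normc_le_ReIm x : normc x <= `|complex.Re x| + `|complex.Im x|.
Proof.
rewrite -(@ler_pXn2r _ 2) ?nnegrE ?normc_ge0 ?addr_ge0 // sqr_normcE.
rewrite sqrrD !real_normK ?num_real// addrAC lerDl.
by rewrite mulrn_wge0 // mulr_ge0.
Qed.

Lemma ReD x y : complex.Re (x + y) = complex.Re x + complex.Re y.
Proof. by case: x y => [? ?] [? ?]. Qed.

Lemma ReN x : complex.Re (- x) = - complex.Re x.
Proof. by case: x. Qed.

Lemma ImN x : complex.Im (- x) = - complex.Im x.
Proof. by case: x. Qed.

Lemma ImD x y : complex.Im (x + y) = complex.Im x + complex.Im y.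
Proof. by case: x y => [? ?] [? ?]. Qed.

Lemma Re_sum (I : Type) (r : seq I) (P : pred I) (F : I -> C) :
  complex.Re (\sum_(i <- r | P i) F i) = \sum_(i <- r | P i) complex.Re (F i).
Proof. by apply: (big_morph _ ReD). Qed.

Lemma Im_sum (I : Type) (r : seq I) (P : pred I) (F : I -> C) :
  complex.Im (\sum_(i <- r | P i) F i) = \sum_(i <- r | P i) complex.Im (F i).
Proof. by apply: (big_morph _ ImD). Qed.

Lemma cvg_normcP u x : u @ \oo --> x <->
  forall e : R, 0 < e -> \forall n \near \oo, normc (x - u n) < e.
Proof.
split=> [/cvgrPdist_lt H e e0|H].
  have := H e%:C; rewrite ltcR => /(_ e0); apply: filterS => n.
  by rewrite normr_normc ltcR.
apply/cvgrPdist_lt => e e0.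
have eRe : e = (complex.Re e)%:C by rewrite (RRe_real (gtr0_real e0)).
move: e0; rewrite eRe ltcR => /H; apply: filterS => n.
by rewrite normr_normc ltcR.
Qed.

Lemma abs_summable_le u M : (forall n, normc (u n) <= M n) ->
  cvgn (series M) -> abs_summable u.
Proof.
move=> uM; apply: series_le_cvg => // n; first exact: normc_ge0.
by apply: le_trans (uM n); exact: normc_ge0.
Qed.

Lemma abs_summable_bounded u K :
  (forall n, \sum_(i < n) normc (u i) <= K) -> abs_summable u.
Proof.
move=> uK; apply: nondecreasing_is_cvgn.
  by apply: nondecreasing_series => i _ _; exact: normc_ge0.
by exists K => _ [n _ <-]; rewrite /series /= big_mkord.
Qed.

(** Summing real and imaginary parts separately gives a total sum operator
without appeal to completeness of the complex numbers. *)
Definition csum u : C :=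
  limn (series (fun n => complex.Re (u n))) +i*
  limn (series (fun n => complex.Im (u n))).

Lemma csum_cvg u : abs_summable u -> series u @ \oo --> csum u.
Proof.
move=> su.
have cR : cvgn (series (fun n => complex.Re (u n))).
  apply: normed_cvg; apply: series_le_cvg su => n /=; [exact: normr_ge0|exact: normc_ge0|exact: normRe_le].
have cI : cvgn (series (fun n => complex.Im (u n))).
  apply: normed_cvg; apply: series_le_cvg su => n /=; [exact: normr_ge0|exact: normc_ge0|exact: normIm_le].
apply/cvg_normcP => e e0; have e2 : 0 < e / 2 by rewrite divr_gt0.
move/cvgrPdist_lt : cR => /(_ _ e2); move/cvgrPdist_lt : cI => /(_ _ e2).
apply: filterS2 => n nI nR; apply: le_lt_trans (normc_le_ReIm _) _.
rewrite [e]splitr; apply: ltrD; rewrite /series /=.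
  by rewrite ReD ReN Re_sum.
by rewrite ImD ImN Im_sum.
Qed.

Lemma cvg_csumE u x : abs_summable u -> series u @ \oo --> x -> csum u = x.
Proof. by move=> /csum_cvg; apply: cvg_unique. Qed.

Lemma normc_lim_le u x (K : R) : u @ \oo --> x ->
  (\forall n \near \oo, normc (u n) <= K) -> normc x <= K.
Proof.
move=> /cvg_normcP ux uK; apply/ler_addgt0Pr => e e0.
have [n [xn nK]] := filter_ex (filterI (ux e e0) uK).
rewrite -[x](subrK (u n)) addrC; apply: le_trans (normcDC _ _) _.
by rewrite lerD // ltW.
Qed.

Lemma limn_series_ge M n : (forall k, 0 <= M k) -> cvgn (series M) ->
  series M n <= limn (series M).
Proof.
move=> M0 cM; apply: nondecreasing_cvgn_le => //.
by apply: nondecreasing_series.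
Qed.

Lemma sum_le_limn M n : (forall k, 0 <= M k) -> cvgn (series M) ->
  \sum_(k < n) M k <= limn (series M).
Proof.
by move=> M0 cM; have := limn_series_ge n M0 cM; rewrite /series /= big_mkord.
Qed.

Lemma normc_csum_tail u M n : (forall k, normc (u k) <= M k) ->
  cvgn (series M) ->
  normc (csum u - series u n) <= limn (series M) - series M n.
Proof.
move=> uM cM; have su := abs_summable_le uM cM.
have M0 k : 0 <= M k by apply: le_trans (uM k); exact: normc_ge0.
apply: (@normc_lim_le (fun m => series u m - series u n)).
  by apply: cvgB; [exact: csum_cvg|exact: cvg_cst].
near=> m; have nm : (n <= m)%N by near: m; exact: nbhs_infty_ge.
apply: le_trans (_ : series M m - series M n <= _); last first.
  by rewrite lerD2r; exact: limn_series_ge.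
rewrite !sub_series_geq //; apply: le_trans (normc_sum _ _ _) _.
exact: ler_sum.
Unshelve. all: by end_near. Qed.

Lemma normc_csum_le u M : (forall k, normc (u k) <= M k) ->
  cvgn (series M) -> normc (csum u) <= limn (series M).
Proof.
move=> uM cM; have := normc_csum_tail 0%N uM cM.
by rewrite /series /= !big_geq // !subr0.
Qed.

Lemma csumD u v : abs_summable u -> abs_summable v ->
  csum (u + v) = csum u + csum v.
Proof.
move=> su sv; apply: cvg_csumE.
  apply: (@abs_summable_le _ (fun n => normc (u n) + normc (v n))) => [n|].
    exact: normcDC.
  exact: is_cvg_seriesD.
have -> : series (u + v) = (fun n => series u n + series v n).
  by apply/funext => n; rewrite /series /= -big_split.
by apply: cvgD; exact: csum_cvg.
Qed.

Lemma csumZ x u : abs_summable u -> csum (fun n => x * u n) = x * csum u.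
Proof.
move=> su; apply: cvg_csumE.
  apply: (@abs_summable_le _ (fun n => normc x * normc (u n))) => [n|].
    by rewrite normcM.
  exact: is_cvg_seriesZ.
have -> : series (fun n => x * u n) = (fun n => x *: series u n).
  by apply/funext => n; rewrite /series /= scaler_sumr.
by apply: cvgZl_tmp; exact: csum_cvg.
Qed.

End ComplexModulus.

Section ComplexExponential.
Context {R : realType}.
Local Notation C := R[i].
Implicit Types (z s h : C) (x y : R).

Lemma cexpD (z1 z2 : C) : cexp (z1 + z2) = cexp z1 * cexp z2.
Proof.
rewrite /cexp ReD ImD expRD cosD sinD; case: z1 z2 => [a b] [c d] /=.
by simpc; congr (_ +i* _); ring.
Qed.

Lemma cexp0 : cexp (0 : C) = 1.
Proof. by rewrite /cexp expR0 cos0 sin0 mul1r. Qed.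

Lemma normc_cexp z : normc (cexp z) = expR (complex.Re z).
Proof.
rewrite /cexp normcM normc_real /= cos2Dsin2 sqrtr1 mulr1.
by rewrite ger0_norm // expR_ge0.
Qed.

Lemma ge0_of_derive (f df : R -> R) (x : R) :
  (forall t : R, is_derive t 1 f (df t)) -> (forall t, 0 <= t -> 0 <= df t) ->
  f 0 = 0 -> 0 <= x -> 0 <= f x.
Proof.
move=> fd df0 f0 x0; rewrite -f0.
apply: (@ger0_derive1_ndecry R f 0) => //.
- by move=> t; rewrite in_itv /= andbT => t0; rewrite derive1E derive_val df0 // ltW.
- apply: continuous_subspaceT => t.
  by apply: differentiable_continuous; apply/derivable1_diffP.
Qed.

Lemma sin_le x : 0 <= x -> sin x <= x.
Proof.
move=> x0; rewrite -subr_ge0.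
apply: (@ge0_of_derive (fun t => t - sin t) (fun t => 1 - cos t)) => [t _||//].
  by rewrite subr_ge0 cos_le1.
by rewrite sin0 subr0.
Qed.

Lemma abs_sin_le x : `|sin x| <= `|x|.
Proof.
wlog x0 : x / 0 <= x.
  move=> H; have [/H//|/ltW x0] := leP 0 x.
  by rewrite -normrN -sinN -(normrN x) H // oppr_ge0.
rewrite (ger0_norm x0) ler_norml sin_le // andbT -subr_ge0 opprK.
apply: (@ge0_of_derive (fun t => sin t + t) (fun t => cos t + 1)) => [t _||//].
  by rewrite -lerBlDr sub0r cos_geN1.
by rewrite sin0 addr0.
Qed.

Lemma cos_ge1B x : 0 <= x -> 1 - x <= cos x.
Proof.
move=> x0; rewrite -subr_ge0.
apply: (@ge0_of_derive (fun t => cos t - (1 - t)) (fun t => - sin t + 1))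
  => [t|t _||//].
- by apply: is_derive_eq; ring.
- by rewrite addrC subr_ge0 sin_le1.
- by rewrite cos0 subr0 subrr.
Qed.

Lemma cos_ge x : 1 - x ^+ 2 <= cos x.
Proof.
wlog x0 : x / 0 <= x.
  move=> H; have [/H//|/ltW x0] := leP 0 x.
  by rewrite -cosN -(sqrrN x) H // oppr_ge0.
rewrite -subr_ge0.
apply: (@ge0_of_derive (fun t => cos t - (1 - t ^+ 2))
  (fun t => - sin t + 2 * t)) => [t|t t0||//].
- apply: is_derive_eq; rewrite /GRing.scale /=; ring.
- by have := sin_le t0; lra.
- by rewrite cos0 expr0n subr0 subrr.
Qed.

Lemma abs_sin_sub_le x : `|sin x - x| <= x ^+ 2.
Proof.
wlog x0 : x / 0 <= x.
  move=> H; have [/H//|/ltW x0] := leP 0 x.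
  by have := H (- x); rewrite oppr_ge0 sinN sqrrN -opprD normrN => /(_ x0).
rewrite ler0_norm ?subr_le0 ?sin_le // opprB -subr_ge0.
apply: (@ge0_of_derive (fun t => t ^+ 2 - (t - sin t))
  (fun t => 2 * t - (1 - cos t))) => [t|t t0||//].
- apply: is_derive_eq; rewrite /GRing.scale /=; ring.
- by have := cos_ge1B t0; lra.
- by rewrite sin0 expr0n !subr0.
Qed.

Lemma expR_le_quadratic x : x <= 0 -> expR x <= 1 + x + x ^+ 2.
Proof.
move=> x0; rewrite -subr_ge0 -[x]opprK.
apply: (@ge0_of_derive (fun t => 1 + - t + (- t) ^+ 2 - expR (- t))
  (fun t => -1 + 2 * t + expR (- t))) => [t|t t0||].
- apply: is_derive_eq; rewrite /GRing.scale /=; ring.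
- by have := expR_ge1Dx (- t); lra.
- by rewrite oppr0 expR0 expr0n /= !addr0 subrr.
- by rewrite oppr_ge0.
Qed.

Lemma expRB1_le x : x <= 0 -> `|expR x - 1| <= `|x|.
Proof.
move=> x0; rewrite !ler0_norm ?subr_le0 ?expR_le1 // opprB.
by have := expR_ge1Dx x; lra.
Qed.

Lemma Re_cexp z : complex.Re (cexp z) = expR (complex.Re z) * cos (complex.Im z).
Proof. by rewrite /cexp /= mul0r subr0. Qed.

Lemma Im_cexp z : complex.Im (cexp z) = expR (complex.Re z) * sin (complex.Im z).
Proof. by rewrite /cexp /= mul0r addr0. Qed.

End ComplexExponential.

(** * Bounds for powers with complex exponent *)

Section ComplexExponentialBounds.
Context {R : realType}.
Local Notation C := R[i].
Implicit Types (z s h : C) (x y : R).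

Lemma abs_expRB1_mul_le x y : x <= 0 -> `|(expR x - 1) * y| <= x ^+ 2 + y ^+ 2.
Proof.
move=> x0; rewrite normrM.
apply: (@le_trans _ _ (`|x| * `|y|)); first by rewrite ler_wpM2r // expRB1_le.
rewrite -(real_normK (num_real x)) -(real_normK (num_real y)).
by have := sqr_ge0 (`|x| - `|y|); have := sqr_ge0 (`|x| + `|y|); nra.
Qed.

Lemma normc_cexpB1B_le z : complex.Re z <= 0 ->
  normc (cexp z - 1 - z) <= 4 * normc z ^+ 2.
Proof.
move=> x0; apply: le_trans (normc_le_ReIm _) _; rewrite sqr_normcE.
rewrite !ReD !ImD !ReN !ImN Re_cexp Im_cexp /=.
move: (complex.Re z) (complex.Im z) x0 => x y x0 {z}.
have e0 := expR_gt0 x; have e1 : expR x <= 1 by rewrite expR_le1.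
have := expR_ge1Dx x; have := expR_le_quadratic x0.
have := cos_ge y; have := cos_le1 y; have := abs_sin_sub_le y.
rewrite oppr0 addr0 ler_norml => /andP[s1 s2] c1 c2 q1 q2.
set e := expR x in e0 e1 q1 q2 *; set c := cos y in c1 c2 *.
set s := sin y in s1 s2 *.
have A : `|e * c - 1 - x| <= x ^+ 2 + y ^+ 2.
  have -> : e * c - 1 - x = - (e * (1 - c)) + (e - 1 - x) by ring.
  rewrite ler_norml; apply/andP; split; nra.
have B : `|e * s - y| <= x ^+ 2 + 2 * y ^+ 2.
  have -> : e * s - y = e * (s - y) + (e - 1) * y by ring.
  have h : `|e * (s - y)| <= y ^+ 2.
    rewrite normrM (ger0_norm (ltW e0)) (le_trans (ler_piMl _ e1)) //.
    by rewrite ler_norml s1.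
  apply: le_trans (ler_normD _ _) _.
  by have := abs_expRB1_mul_le y x0; rewrite -/e; lra.
by have := sqr_ge0 x; have := sqr_ge0 y; lra.
Qed.

Lemma normc_cexpB1_le z : complex.Re z <= 0 ->
  normc (cexp z - 1) <= 3 * normc z.
Proof.
move=> x0; apply: le_trans (normc_le_ReIm _) _.
have := normRe_le z; have := normIm_le z; move: (normc z) => m.
rewrite !ReD !ImD !ReN !ImN Re_cexp Im_cexp /= oppr0 addr0.
move: (complex.Re z) (complex.Im z) x0 => x y x0 {z} ym xm.
have e0 := expR_gt0 x; have e1 : expR x <= 1 by rewrite expR_le1.
have h1 := expRB1_le x0; have h2 := abs_sin_le y.
have h3 : `|cos y - 1| <= `|y|.
  rewrite ler0_norm ?subr_le0 ?cos_le1 // opprB.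
  have := cos_ge1B (normr_ge0 y); have -> : cos `|y| = cos y.
    by have [_|_] := ger0P y; rewrite ?cosN.
  by lra.
have -> : expR x * cos y - 1 = expR x * (cos y - 1) + (expR x - 1) by ring.
have h4 : `|expR x * sin y| <= `|y|.
  by rewrite normrM (ger0_norm (ltW e0)) (le_trans (ler_piMl _ e1)).
have h5 : `|expR x * (cos y - 1)| <= `|y|.
  by rewrite normrM (ger0_norm (ltW e0)) (le_trans (ler_piMl _ e1)).
by have := ler_normD (expR x * (cos y - 1)) (expR x - 1); lra.
Qed.

(** The real power [n ^ - x], signed as in Dirichlet series. *)
Definition rpow (n : nat) x : R := expR (- (x * ln n%:R)).

Lemma rpow_gt0 n x : 0 < rpow n x.
Proof. exact: expR_gt0. Qed.

Lemma rpowM n m x : (0 < n)%N -> (0 < m)%N ->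
  rpow (n * m) x = rpow n x * rpow m x.
Proof.
move=> n0 m0; rewrite /rpow natrM lnM ?posrE ?ltr0n // -expRD.
by congr expR; ring.
Qed.

Lemma lnn_ge0 n : 0 <= ln (n%:R : R).
Proof. by case: n => [|n]; [rewrite ln0|rewrite ln_ge0 // ler1n]. Qed.

Lemma rpow_le1 n x : 0 <= x -> rpow n x <= 1.
Proof. by move=> x0; rewrite expR_le1 oppr_le0 mulr_ge0 // lnn_ge0. Qed.

Lemma ler_rpow n x y : x <= y -> rpow n y <= rpow n x.
Proof. by move=> xy; rewrite ler_expR lerN2 ler_wpM2r // lnn_ge0. Qed.

Lemma ler_rpown n m x : 0 <= x -> (0 < n)%N -> (n <= m)%N ->
  rpow m x <= rpow n x.
Proof.
move=> x0 n0 nm; rewrite ler_expR lerN2 ler_wpM2l // ler_ln ?posrE ?ltr0n ?ler_nat//.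
exact: leq_trans nm.
Qed.

Lemma normc_dpow n s : normc (dpow n s) = rpow n (complex.Re s).
Proof.
rewrite normc_cexp /rpow; congr expR; case: s => a b /=.
by rewrite mulr0 subr0.
Qed.

Lemma dpow1 s : dpow 1 s = 1.
Proof. by rewrite /dpow ln1 mulr0 oppr0 cexp0. Qed.

Lemma dpowM n m s : (0 < n)%N -> (0 < m)%N ->
  dpow (n * m) s = dpow n s * dpow m s.
Proof.
move=> n0 m0; rewrite /dpow natrM lnM ?posrE ?ltr0n // -cexpD -opprD -mulrDr.
by rewrite -rmorphD.
Qed.

Lemma dpowX n k s : (0 < n)%N -> dpow (n ^ k) s = dpow n s ^+ k.
Proof.
move=> n0; elim: k => [|k IH]; first by rewrite expn0 dpow1.
by rewrite expnS exprS dpowM ?expn_gt0 ?n0 // IH.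
Qed.

Lemma dpowD n s1 s2 : dpow n (s1 + s2) = dpow n s1 * dpow n s2.
Proof. by rewrite /dpow -cexpD mulrDl opprD. Qed.

Lemma normc_dpow_le1 n s : 0 <= complex.Re s -> normc (dpow n s) <= 1.
Proof. by move=> s0; rewrite normc_dpow rpow_le1. Qed.

(** The factor extracted is the exponential at whichever of the two points lies
further to the left, so that what remains decays. *)
Lemma normc_dpowB_le n s h : 0 <= complex.Re s -> 0 <= complex.Re (s + h) ->
  normc (dpow n (s + h) - dpow n s) <= 3 * ln n%:R * normc h.
Proof.
move=> s0 sh0; have l0 := lnn_ge0 n.
have key (u v : C) : 0 <= complex.Re u -> 0 <= complex.Re v ->
    normc (dpow n (u + v) - dpow n u) <= 3 * ln n%:R * normc v.
  move=> u0 v0; rewrite dpowD -[X in _ - X]mulr1 -mulrBr normcM.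
  apply: (@le_trans _ _ (normc (dpow n v - 1))).
    by rewrite ler_piMl ?normc_ge0 ?normc_dpow_le1.
  apply: le_trans (normc_cexpB1_le _) _.
    by case: v v0 => a b /= a0; rewrite mulr0 subr0 oppr_le0 mulr_ge0.
  by rewrite normcNC normcM normc_real ger0_norm // mulrAC mulrA.
have [h0|/ltW h0] := leP 0 (complex.Re h); first exact: key.
rewrite normc_distC -{1}(addrK h s) -(normcNC h); apply: key => //.
by rewrite ReN oppr_ge0.
Qed.

(** The bound holds up to the boundary and for increments of any size, because
it has to be uniform over frequencies [ln n] that are not small compared with
the inverse of [h]. *)
Lemma normc_dpow_jet_le n s h : 0 <= complex.Re s -> 0 <= complex.Re (s + h) ->
  normc (dpow n (s + h) - dpow n s + h * ((ln n%:R)%:C * dpow n s))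
  <= 7 * ln n%:R ^+ 2 * normc h ^+ 2.
Proof.
move=> s0 sh0; have l0 := lnn_ge0 n; set l : R := ln _ in l0 *.
have N (v : C) : normc (v * l%:C) = l * normc v.
  by rewrite normcM normc_real ger0_norm // mulrC.
have Rl (v : C) : complex.Re (v * l%:C) = complex.Re v * l.
  by case: v => a b /=; rewrite mulr0 subr0.
have [h0|/ltW h0] := leP 0 (complex.Re h).
  have -> : dpow n (s + h) - dpow n s + h * (l%:C * dpow n s) =
      dpow n s * (cexp (- (h * l%:C)) - 1 - - (h * l%:C)).
    by rewrite dpowD /dpow -/l; ring.
  rewrite normcM; apply: le_trans (_ : 4 * normc (- (h * l%:C)) ^+ 2 <= _).
    apply: (le_trans (ler_piMl (normc_ge0 _) (normc_dpow_le1 _ s0))).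
    apply: normc_cexpB1B_le.
    by rewrite ReN Rl oppr_le0 mulr_ge0.
  rewrite normcNC N exprMn mulrA.
  by rewrite ler_wpM2r ?sqr_ge0 // ler_wpM2r ?sqr_ge0 // ler_nat.
have -> : dpow n (s + h) - dpow n s + h * (l%:C * dpow n s) =
    dpow n (s + h) * (- (cexp (h * l%:C) - 1 - h * l%:C)
                      + (h * l%:C) * (cexp (h * l%:C) - 1)).
  have -> : dpow n s = dpow n (s + h) * cexp (h * l%:C).
    by rewrite dpowD -mulrA /dpow -cexpD -/l addNr cexp0 mulr1.
  by ring.
rewrite normcM; apply: (le_trans (ler_piMl (normc_ge0 _) (normc_dpow_le1 _ sh0))).
have hl0 : complex.Re (h * l%:C) <= 0 by rewrite Rl mulr_le0_ge0.
apply: le_trans (normcDC _ _) _; rewrite normcNC normcM.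
have := normc_cexpB1B_le hl0; have := normc_cexpB1_le hl0.
rewrite !N; have := normc_ge0 h; move: (normc h) (normc _) (normc _).
by move=> a b c a0 h1 h2; have := mulr_ge0 l0 a0; nra.
Qed.

End ComplexExponentialBounds.

(** * Differentiability with quadratic remainder *)

Section ComplexDifferentiability.
Context {R : realType}.
Local Notation C := R[i].
Implicit Types (s h : C) (f g : C -> C).

(** Differentiability with a quadratic remainder: holomorphic functions satisfy
it, and unlike mere differentiability it passes to normally convergent
series. *)
Definition cdiff f s := exists d (rho K : R), 0 < rho /\
  forall h, normc h < rho ->
    normc (f (s + h) - f s - h * d) <= K * normc h ^+ 2.

Lemma cdiff_derivable f s : cdiff f s -> derivable f s 1.
Proof.
move=> [d [rho [K [rho0 fd]]]]; apply/cvg_ex; exists d.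
apply/cvgrPdist_lt => e e0.
have eRe : e = (complex.Re e)%:C by rewrite (RRe_real (gtr0_real e0)).
move: e0; rewrite eRe ltcR; move: (complex.Re e) => {eRe}e e0.
pose K' := `|K| + 1; have K'0 : 0 < K' by rewrite ltr_wpDl.
pose r := Num.min rho (e / K').
have r0 : 0 < r by rewrite lt_min rho0 divr_gt0.
apply/nbhs_ballP; exists r%:C; first by rewrite /= ltcR.
move=> h; rewrite /ball /= sub0r normrN normr_normc ltcR lt_min => /andP[h1 h2] hn0.
have h0 : 0 < normc h.
  by rewrite lt_neqAle normc_ge0 eq_sym andbT; apply: contra_neq hn0 => /eq0_normc.
rewrite normr_normc ltcR [h *: 1]mulr1 (addrC h).
have -> : d - h^-1 *: (f (s + h) - f s) = - (h^-1 * (f (s + h) - f s - h * d)).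
  rewrite [_ *: _]/(_ * _) [in RHS]mulrBr mulrA mulVf // mul1r opprB //.
rewrite normcNC normcM normcV mulrC ltr_pdivrMr //.
apply: le_lt_trans (fd _ h1) _; rewrite expr2 mulrA ltr_pM2r //.
apply: (@le_lt_trans _ _ (K' * normc h)).
  by rewrite ler_wpM2r ?normc_ge0 // (le_trans (ler_norm K)) // lerDl.
by rewrite mulrC -ltr_pdivlMr.
Qed.

Lemma cdiff_eq f g s (rho : R) : 0 < rho ->
  (forall h, normc h < rho -> f (s + h) = g (s + h)) -> cdiff f s -> cdiff g s.
Proof.
move=> rho0 fg [d [r [K [r0 fd]]]]; exists d, (Num.min rho r), K.
split=> [|h]; first by rewrite lt_min rho0.
rewrite lt_min => /andP[h1 h2]; rewrite -fg // -[g s](congr1 g (addr0 s)) -fg.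
  by rewrite addr0; exact: fd.
by rewrite normc0.
Qed.

Lemma cdiff_cst (c : C) s : cdiff (fun=> c) s.
Proof.
exists 0, 1, 0; split=> // h _.
by rewrite mulr0 subrr subr0 normc0 mul0r.
Qed.

Lemma cdiffD f g s : cdiff f s -> cdiff g s -> cdiff (fun z => f z + g z) s.
Proof.
move=> [d [r [K [r0 fd]]]] [d' [r' [K' [r'0 gd]]]].
exists (d + d'), (Num.min r r'), (K + K'); split=> [|h]; first by rewrite lt_min r0.
rewrite lt_min => /andP[h1 h2].
have -> : f (s + h) + g (s + h) - (f s + g s) - h * (d + d') =
  (f (s + h) - f s - h * d) + (g (s + h) - g s - h * d') by ring.
by apply: le_trans (normcDC _ _) _; rewrite mulrDl lerD ?fd ?gd.
Qed.

Lemma cdiffM f g s : cdiff f s -> cdiff g s -> cdiff (fun z => f z * g z) s.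
Proof.
move=> [d [r [K [r0 fd]]]] [d' [r' [K' [r'0 gd]]]].
pose F := normc (f s); pose G := normc (g s); pose D := normc d; pose D' := normc d'.
have [F0 G0 D0 D'0] : [/\ 0 <= F, 0 <= G, 0 <= D & 0 <= D'] by rewrite !normc_ge0.
exists (f s * d' + g s * d), (Num.min 1 (Num.min r r')),
  (F * `|K'| + (D + `|K|) * (D' + `|K'|) + `|K| * G).
split=> [|h]; first by rewrite !lt_min r0 r'0 ltr01.
rewrite !lt_min => /and3P[h1 /fd fh /gd gh].
set a := f (s + h) - f s - h * d in fh; set b := g (s + h) - g s - h * d' in gh.
have -> : f (s + h) * g (s + h) - f s * g s - h * (f s * d' + g s * d) =
  f s * b + (h * d + a) * (h * d' + b) + a * g s by rewrite /a /b; ring.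
have h0 := normc_ge0 h; set t := normc h in h0 h1 fh gh *.
have t2 : 0 <= t ^+ 2 by rewrite sqr_ge0.
have t2t : t ^+ 2 <= t by rewrite expr2 ler_piMl // ltW.
have aK : normc a <= `|K| * t ^+ 2.
  by apply: le_trans fh _; rewrite ler_wpM2r // ler_norm.
have bK : normc b <= `|K'| * t ^+ 2.
  by apply: le_trans gh _; rewrite ler_wpM2r // ler_norm.
have lin (c e : C) (L : R) : normc c <= `|L| * t ^+ 2 ->
    normc (h * e + c) <= (normc e + `|L|) * t.
  move=> cL; apply: le_trans (normcDC _ _) _; rewrite normcM mulrDl [t * _]mulrC.
  by rewrite lerD2l (le_trans cL) // ler_wpM2l.
apply: le_trans (normcDC _ _) _; rewrite [leRHS]mulrDl; apply: lerD.
  apply: le_trans (normcDC _ _) _; rewrite [leRHS]mulrDl; apply: lerD.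
    by rewrite normcM -mulrA ler_wpM2l.
  rewrite normcM expr2 mulrACA.
  by apply: ler_pM; rewrite ?normc_ge0 //; exact: lin.
by rewrite normcM mulrAC; rewrite ler_wpM2r.
Qed.

Lemma Re_add_gt0 s h : 0 < complex.Re s -> normc h < complex.Re s ->
  0 < complex.Re (s + h).
Proof.
move=> s0 hs; rewrite ReD; have := normRe_le h.
by rewrite ler_norml => /andP[? _]; lra.
Qed.

Lemma cdiff_dpow n s : 0 < complex.Re s -> cdiff (dpow n) s.
Proof.
move=> s0; exists (- ((ln n%:R)%:C * dpow n s)), (complex.Re s),
  (7 * ln n%:R ^+ 2); split=> // h hs.
rewrite mulrN opprK; apply: normc_dpow_jet_le; first exact: ltW.
exact/ltW/Re_add_gt0.
Qed.

Lemma csumB (u v : nat -> C) : abs_summable u -> abs_summable v ->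
  csum (fun n => u n - v n) = csum u - csum v.
Proof.
move=> su sv; have sv' : abs_summable (fun n => -1 * v n).
  apply: abs_summable_le sv => n; by rewrite normcM normcNC normc1 mul1r.
have -> : (fun n => u n - v n) = u + (fun n => -1 * v n).
  by apply/funext => n; rewrite -[RHS]/(u n + -1 * v n) mulN1r.
by rewrite csumD // csumZ // mulN1r.
Qed.

Lemma cdiff_csum (f : nat -> C -> C) (d : nat -> C) (K : nat -> R) (rho : R) s :
  0 < rho -> cvgn (series K) -> (forall k, normc (d k) <= K k) ->
  (forall k h, normc h < rho -> normc (f k (s + h)) <= K k /\
     normc (f k (s + h) - f k s - h * d k) <= K k * normc h ^+ 2) ->
  cdiff (fun z => csum (fun k => f k z)) s.
Proof.
move=> rho0 cK dK fK; exists (csum d), rho, (limn (series K)); split=> // h hr.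
have fs k : normc (f k s) <= K k.
  by have := fK k 0; rewrite normc0 addr0 => /(_ rho0)[].
have sh : abs_summable (fun k => f k (s + h)).
  by apply: abs_summable_le cK => k; have [] := fK k h hr.
have ss : abs_summable (fun k => f k s) by exact: abs_summable_le cK.
have sd : abs_summable d by exact: abs_summable_le cK.
have sD : abs_summable (fun k => f k (s + h) - f k s).
  apply: (@abs_summable_le _ _ (fun k => 2 * K k)) => [k|]; last exact: is_cvg_seriesZ.
  apply: le_trans (normcBC _ _) _; have [] := fK k h hr; have := fs k; lra.
have shd : abs_summable (fun k => h * d k).
  apply: (@abs_summable_le _ _ (fun k => normc h * K k)) => [k|].
    by rewrite normcM ler_wpM2l ?normc_ge0.
  exact: is_cvg_seriesZ.
rewrite -csumB // -csumZ // -csumB // mulrC.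
have <- : limn (series (fun k => normc h ^+ 2 * K k)) = normc h ^+ 2 * limn (series K).
  exact: (lim_seriesZ (normc h ^+ 2) cK).
apply: normc_csum_le => [k|].
  by rewrite [leRHS]mulrC; have [_] := fK k h hr.
exact: is_cvg_seriesZ.
Qed.

End ComplexDifferentiability.

(** * Hadamard matrices acting on complex vectors *)

Section HadamardChain.
Context {R : realType}.
Local Notation C := R[i].

Fixpoint hdim l := if l is l'.+1 then (hdim l' + hdim l')%N else 1%N.

Lemma hdimE l : hdim l = (2 ^ l)%N.
Proof. by elim: l => //= l ->; rewrite expnS mul2n addnn. Qed.

(** Sylvester's matrices, with dimensions doubled by addition so that the
recursive blocks typecheck without casts. *)
Fixpoint hadamard l : 'M[R]_(hdim l) :=
  if l is l'.+1 then
    block_mx (hadamard l') (hadamard l') (hadamard l') (- hadamard l')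
  else 1%:M.

Lemma hadamard_abs l i j : `|hadamard l i j| = 1.
Proof.
elim: l i j => [|l IH] /= i j; first by rewrite !ord1 mxE eqxx normr1.
have := splitK i; have := splitK j.
case: (fintype.split i) => i'; case: (fintype.split j) => j' /= <- <-.
- by rewrite block_mxEul.
- by rewrite block_mxEur.
- by rewrite block_mxEdl.
- by rewrite block_mxEdr mxE normrN.
Qed.

(** Squared Euclidean norms suffice: multiplicative losses in the triangle
inequality are harmless below. *)
Definition energy n (v : 'I_n -> C) : R := \sum_i normc (v i) ^+ 2.

Definition hact l (v : 'I_(hdim l) -> C) (j : 'I_(hdim l)) : C :=
  \sum_i v i * (hadamard l i j)%:C.

Lemma energy_ge0 n (v : 'I_n -> C) : 0 <= energy v.
Proof. by apply: sumr_ge0 => i _; exact: sqr_ge0. Qed.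

Lemma energy_split n (v : 'I_(n + n) -> C) :
  energy v = energy (fun i => v (lshift n i)) + energy (fun i => v (rshift n i)).
Proof. exact: big_split_ord. Qed.

Lemma sqr_normc_parallelogram (x y : C) :
  normc (x + y) ^+ 2 + normc (x - y) ^+ 2 = 2 * (normc x ^+ 2 + normc y ^+ 2).
Proof. by rewrite !sqr_normcE !ReD !ImD !ReN !ImN; ring. Qed.

(** Orthogonality of the rows, obtained from the recursive block structure by
the parallelogram identity. *)
Lemma energy_hact l (v : 'I_(hdim l) -> C) :
  energy (hact v) = (hdim l)%:R * energy v.
Proof.
elim: l v => [|l IH] v.
  rewrite /energy /hact !big_ord_recl !big_ord0 /= !ord1 mxE eqxx.
  by rewrite !addr0 mul1r mulr1.
set a := fun i => v (lshift _ i); set b := fun i => v (rshift _ i).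
have E1 j : hact v (lshift (hdim l) j) = hact a j + hact b j.
  rewrite /hact [LHS]big_split_ord /=; congr (_ + _); apply: eq_bigr => i _.
    by rewrite block_mxEul.
  by rewrite block_mxEdl.
have E2 j : hact v (rshift (hdim l) j) = hact a j - hact b j.
  rewrite /hact [LHS]big_split_ord /= -sumrN; congr (_ + _); apply: eq_bigr => i _.
    by rewrite block_mxEur.
  by rewrite block_mxEdr mxE rmorphN mulrN.
rewrite energy_split.
have -> : energy (fun i => hact v (lshift (hdim l) i)) +
    energy (fun i => hact v (rshift (hdim l) i)) =
    2 * (energy (hact a) + energy (hact b)).
  rewrite /energy -!big_split mulr_sumr /=; apply: eq_bigr => j _.
  by rewrite E1 E2 sqr_normc_parallelogram.
rewrite !IH [energy v]energy_split -/a -/b natrD; ring.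
Qed.

Lemma sqr_normc_sum_le n (v : 'I_n -> C) :
  normc (\sum_i v i) ^+ 2 <= n%:R * energy v.
Proof.
apply: (@le_trans _ _ ((\sum_i normc (v i)) ^+ 2)).
  by rewrite ler_pXn2r ?nnegrE ?normc_ge0 ?sumr_ge0 ?normc_sum // => i _; exact: normc_ge0.
rewrite expr2 mulr_suml.
under eq_bigr do rewrite mulr_sumr.
apply: (@le_trans _ _ (\sum_(i < n) \sum_(j < n)
    (normc (v i) ^+ 2 + normc (v j) ^+ 2) / 2)).
  apply: ler_sum => i _; apply: ler_sum => j _.
  by have := sqr_ge0 (normc (v i) - normc (v j)); nra.
under eq_bigr do rewrite -mulr_suml big_split /= sumr_const card_ord.
rewrite -mulr_suml big_split /= sumrMnl sumr_const card_ord -mulr_natl -/(energy v).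
rewrite -[X in X + _]mulr_natl; lra.
Qed.

Lemma hactD l (u v : 'I_(hdim l) -> C) j :
  hact (fun i => u i + v i) j = hact u j + hact v j.
Proof. by rewrite /hact -big_split; apply: eq_bigr => i _; rewrite mulrDl. Qed.

Lemma hactZ l (c : C) (v : 'I_(hdim l) -> C) j :
  hact (fun i => c * v i) j = c * hact v j.
Proof. by rewrite /hact mulr_sumr; apply: eq_bigr => i _; rewrite mulrA. Qed.

Lemma energy_le n (a : R) (u v : 'I_n -> C) : 0 <= a ->
  (forall i, normc (u i) <= a * normc (v i)) -> energy u <= a ^+ 2 * energy v.
Proof.
move=> a0 uv; rewrite /energy mulr_sumr; apply: ler_sum => i _.
rewrite -exprMn ler_pXn2r ?nnegrE ?normc_ge0 //.
by rewrite mulr_ge0 ?normc_ge0.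
Qed.

Lemma energyD3 n (u v w : 'I_n -> C) :
  energy (fun i => u i + v i + w i) <= 3 * (energy u + energy v + energy w).
Proof.
rewrite /energy -!big_split mulr_sumr; apply: ler_sum => i _ /=.
have : normc (u i + v i + w i) <= normc (u i) + normc (v i) + normc (w i).
  by apply: le_trans (normcDC _ _) _; rewrite lerD2r normcDC.
have := normc_ge0 (u i + v i + w i); have := sqr_ge0 (normc (u i) - normc (v i)).
have := sqr_ge0 (normc (u i) - normc (w i)).
have := sqr_ge0 (normc (v i) - normc (w i)).
have := normc_ge0 (u i); have := normc_ge0 (v i); have := normc_ge0 (w i).
move: (normc (u i)) (normc (v i)) (normc (w i)) (normc _) => a b c d.
by move=> *; nra.
Qed.

End HadamardChain.

(** * Multilinear forms built on Hadamard matrices *)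

Section Chain.
Context {R : realType} (l : nat) (P : nat -> 'I_(hdim l) -> nat).
Local Notation C := R[i].
Local Notation n := (hdim l).

(** The multilinear form, computed one slot at a time: each step applies the
Hadamard matrix and then the diagonal matrix of the next slot. *)
Fixpoint chain m (s : C) : 'I_n -> C :=
  match m with
  | 0 => fun i => dpow (P 0 i) s
  | m'.+1 => fun i => hact (chain m' s) i * dpow (P m i) s
  end.

(** The letters of all slots but the last one, which stays a separate argument
since the next step of the chain acts on it. *)
Fixpoint word m : finType :=
  if m is m'.+1 then (word m' * 'I_n)%type else unit.

Fixpoint word_sign m : word m -> 'I_n -> R :=
  match m return word m -> 'I_n -> R with
  | 0 => fun _ _ => 1
  | m'.+1 => fun w j => word_sign w.1 w.2 * hadamard l w.2 j
  end.

Fixpoint word_num m : word m -> 'I_n -> nat :=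
  match m return word m -> 'I_n -> nat with
  | 0 => fun _ i => P 0 i
  | m'.+1 => fun w j => (word_num w.1 w.2 * P m j)%N
  end.

Lemma word_sign_abs m (w : word m) i : `|word_sign w i| = 1.
Proof.
elim: m w i => [|m IH] w i /=; first by rewrite normr1.
by rewrite normrM IH hadamard_abs mulr1.
Qed.

Lemma card_word m : #|word m| = (n ^ m)%N.
Proof.
by elim: m => [|m IH]; rewrite ?card_unit // /= card_prod IH card_ord expnSr.
Qed.

Hypothesis P_gt0 : forall j i, (0 < P j i)%N.

Lemma word_num_gt0 m (w : word m) i : (0 < word_num w i)%N.
Proof. by elim: m w i => [|m IH] w i //=; rewrite muln_gt0 IH P_gt0. Qed.

Lemma chainE m s i :
  chain m s i = \sum_(w : word m) (word_sign w i)%:C * dpow (word_num w i) s.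
Proof.
elim: m i => [|m IH] i /=.
  by rewrite (big_pred1 tt) ?mul1r // => -[].
rewrite /hact mulr_suml.
under [LHS]eq_bigr => i0 _ do rewrite IH mulr_suml mulr_suml.
rewrite exchange_big /= pair_bigA /=; apply: eq_bigr => -[w j] _ /=.
by rewrite dpowM ?word_num_gt0 // rmorphM; ring.
Qed.

Lemma word_num_le B m (w : word m) i :
  (forall j i, (j <= m)%N -> (P j i <= B)%N) -> (word_num w i <= B ^ m.+1)%N.
Proof.
elim: m w i => [|m IH] w i PB /=; first by rewrite expn1 PB.
by rewrite expnSr leq_mul // ?PB // IH // => j i' jm; rewrite PB // leqW.
Qed.

Lemma word_num_ge m (w : word m) i : exists k, (P 0 k <= word_num w i)%N.
Proof.
elim: m w i => [|m IH] w i /=; first by exists i.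
have [k Pk] := IH w.1 w.2; exists k; rewrite (leq_trans Pk) // leq_pmulr //.
Qed.

Lemma prime_dvd_word_num m (w : word m) i q : prime q ->
  (forall j i, prime (P j i)) -> (q %| word_num w i)%N ->
  exists2 j, (j <= m)%N & exists k, q = P j k.
Proof.
move=> qq Pp; elim: m w i => [|m IH] w i /=.
  by rewrite dvdn_prime2 // => /eqP->; exists 0%N => //; exists i.
rewrite Euclid_dvdM // => /orP[/IH[j jm [k ->]]|].
  by exists j; [exact: leqW|exists k].
by rewrite dvdn_prime2 // => /eqP->; exists m.+1 => //; exists i.
Qed.

Hypothesis P_prime : forall j i, prime (P j i).
Hypothesis P_inj : forall j i j' i', P j i = P j' i' -> j = j' /\ i = i'.

(** Unique factorization: distinct slots use disjoint sets of primes, so the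
prime factors of the product spell the word. *)
Lemma word_num_inj m (w w' : word m) i i' :
  word_num w i = word_num w' i' -> w = w' /\ i = i'.
Proof.
elim: m w w' i i' => [|m IH] w w' i i' /=.
  by case: w w' => [] [] /P_inj[].
move=> E; have ii : i = i'.
  have : (P m.+1 i %| word_num w'.1 w'.2 * P m.+1 i')%N by rewrite -E dvdn_mull.
  rewrite Euclid_dvdM // => /orP[/prime_dvd_word_num|].
    by case=> // j jm [k /P_inj[mj _]]; move: jm; rewrite -mj ltnn.
  by rewrite dvdn_prime2 // => /eqP/P_inj[].
move/eqP: E; rewrite ii eqn_pmul2r // => /eqP/IH[].
by case: w w' => [w j] [w' j'] /= -> ->.
Qed.

Variable Lam : R.
Hypothesis Lam1 : 1 <= Lam.

(** The product rule for first-order expansions with quadratic remainder, in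
Euclidean norm. The constant absorbs [3 * (1 + 9 + 49)], from three summands
with factors 1, 3 and 7 in their bounds. *)
Lemma mul_jet_energy (z : 'I_n -> nat) (x x' : C -> 'I_n -> C) (K : R) :
  (forall i, ln (z i)%:R <= Lam) ->
  (forall s, 0 <= complex.Re s -> energy (x s) <= K /\ energy (x' s) <= K) ->
  (forall s h, 0 <= complex.Re s -> 0 <= complex.Re (s + h) ->
    energy (fun i => x (s + h) i - x s i - h * x' s i) <= K * normc h ^+ 4) ->
  let y s i := x s i * dpow (z i) s in
  let y' s i := x' s i * dpow (z i) s
                - x s i * ((ln (z i)%:R)%:C * dpow (z i) s) in
  (forall s, 0 <= complex.Re s ->
     energy (y s) <= 256 * Lam ^+ 4 * K /\ energy (y' s) <= 256 * Lam ^+ 4 * K) /\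
  (forall s h, 0 <= complex.Re s -> 0 <= complex.Re (s + h) ->
    energy (fun i => y (s + h) i - y s i - h * y' s i)
    <= 256 * Lam ^+ 4 * K * normc h ^+ 4).
Proof.
move=> zL xK xJ y y'.
have Lam0 : 0 <= Lam by exact: le_trans Lam1.
have L2 : 1 <= Lam ^+ 2 by rewrite exprn_ege1.
have L4 : Lam ^+ 2 <= Lam ^+ 4 by rewrite -[leLHS]mulr1 (exprD _ 2 2) ler_wpM2l // exprn_ge0.
have K0 : 0 <= K.
  by apply: le_trans (energy_ge0 _) (proj1 (xK 0 _)).
have ln1 i : 0 <= ln (z i)%:R :> R by exact: lnn_ge0.
have yb s : 0 <= complex.Re s -> energy (y s) <= K.
  move=> s0; apply: le_trans (proj1 (xK s s0)); rewrite -[leRHS]mul1r -(expr1n _ 2).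
  apply: energy_le => // i; rewrite mul1r normcM.
  by rewrite ler_piMr ?normc_ge0 // normc_dpow_le1.
have D3 (u v w : 'I_n -> C) (a b c : R) : energy u <= a -> energy v <= b ->
    energy w <= c -> energy (fun i => u i + v i + w i) <= 3 * (a + b + c).
  move=> ua vb wc; apply: le_trans (energyD3 _ _ _) _.
  by rewrite ler_wpM2l // !lerD.
split=> [s s0|s h s0 sh0].
  have [xs xs'] := xK s s0; split; first by apply: le_trans (yb s s0) _; nra.
  have -> : y' s = (fun i => x' s i * dpow (z i) s
      + - (x s i * ((ln (z i)%:R)%:C * dpow (z i) s)) + 0).
    by apply/funext => i; rewrite addr0.
  apply: (@le_trans _ _ (3 * (K + Lam ^+ 2 * K + 0))); last by nra.
  apply: D3.
  - apply: le_trans xs'; rewrite -[leRHS]mul1r -(expr1n _ 2).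
    apply: energy_le => // i; rewrite mul1r normcM.
    by rewrite ler_piMr ?normc_ge0 // normc_dpow_le1.
  - apply: (@le_trans _ _ (Lam ^+ 2 * energy (x s))); last first.
      by rewrite ler_wpM2l // exprn_ge0.
    apply: energy_le => // i.
    rewrite normcNC mulrCA normcM normc_real ger0_norm // ler_pM ?normc_ge0 //.
    by rewrite normcM ler_piMr ?normc_ge0 // normc_dpow_le1.
  - by rewrite /energy big1 // => i _; rewrite normc0 expr0n.
have [xs xs'] := xK s s0.
set t := normc h; have t0 : 0 <= t by exact: normc_ge0.
pose dz i := dpow (z i) (s + h) - dpow (z i) s.
have -> : (fun i => y (s + h) i - y s i - h * y' s i) = (fun i =>
    (x (s + h) i - x s i - h * x' s i) * dpow (z i) (s + h)
    + (h * dz i) * x' s i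
    + (dz i + h * ((ln (z i)%:R)%:C * dpow (z i) s)) * x s i).
  by apply/funext => i; rewrite /y /y' /dz; ring.
apply: (@le_trans _ _ (3 * (K * t ^+ 4 + (3 * Lam * t ^+ 2) ^+ 2 * K
    + (7 * Lam ^+ 2 * t ^+ 2) ^+ 2 * K))); last first.
  have -> : (3 * Lam * t ^+ 2) ^+ 2 = 9 * Lam ^+ 2 * t ^+ 4 by ring.
  have -> : (7 * Lam ^+ 2 * t ^+ 2) ^+ 2 = 49 * Lam ^+ 4 * t ^+ 4 by ring.
  have t4 : 0 <= t ^+ 4 by rewrite exprn_ge0.
  have Kt : 0 <= K * t ^+ 4 by rewrite mulr_ge0.
  by have := ler_wpM2r Kt L2; have := ler_wpM2r Kt L4; lra.
apply: D3.
- apply: le_trans (xJ s h s0 sh0); rewrite -[leRHS]mul1r -(expr1n _ 2).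
  apply: energy_le => // i; rewrite mul1r normcM.
  by rewrite ler_piMr ?normc_ge0 // normc_dpow_le1.
- apply: (@le_trans _ _ ((3 * Lam * t ^+ 2) ^+ 2 * energy (x' s))); last first.
    by rewrite ler_wpM2l // sqr_ge0.
  apply: energy_le => [|i]; first by rewrite !mulr_ge0 // sqr_ge0.
  rewrite normcM ler_wpM2r ?normc_ge0 // normcM -/t.
  have := normc_dpowB_le (z i) s0 sh0; rewrite -/(dz i) -/t => H.
  have := ler_wpM2l t0 H; have := zL i; have := ln1 i.
  move: (ln _) => a a0 aL H2; apply: le_trans H2 _.
  by have := ler_wpM2r (sqr_ge0 t) aL; nra.
- apply: (@le_trans _ _ ((7 * Lam ^+ 2 * t ^+ 2) ^+ 2 * energy (x s))); last first.
    by rewrite ler_wpM2l // sqr_ge0.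
  apply: energy_le => [|i]; first by rewrite !mulr_ge0 // sqr_ge0.
  rewrite normcM ler_wpM2r ?normc_ge0 //.
  apply: le_trans (normc_dpow_jet_le (z i) s0 sh0) _.
  rewrite -/t ler_wpM2r ?sqr_ge0 // ler_wpM2l //.
  by rewrite ler_pXn2r ?nnegrE // ?zL.
Qed.

(** Controlling the derivative and the quadratic remainder, besides the value,
is what later makes a sum of such forms holomorphic without Cauchy's integral
formula. The price is a power of the largest logarithm [Lam] per slot. *)
Lemma chain_jet m : (forall j i, (j <= m)%N -> ln (P j i)%:R <= Lam) ->
  exists D : C -> 'I_n -> C,
  let K := (256 * Lam ^+ 4 * n%:R) ^+ m.+1 in
  (forall s, 0 <= complex.Re s -> energy (chain m s) <= K /\ energy (D s) <= K) /\
  (forall s h, 0 <= complex.Re s -> 0 <= complex.Re (s + h) ->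
    energy (fun i => chain m (s + h) i - chain m s i - h * D s i)
    <= K * normc h ^+ 4).
Proof.
elim: m => [|m IH] P_Lam; last have [|D [DK DJ]] := IH.
  have [||] := @mul_jet_energy (P 0) (fun _ _ => 1) (fun _ _ => 0) n%:R (P_Lam 0 ^~ isT).
  - move=> s _; rewrite /energy; split.
      by under eq_bigr do rewrite normc1 expr1n; rewrite sumr_const card_ord.
    by rewrite big1 // => i _; rewrite normc0 expr0n.
  - move=> s h _ _; rewrite /energy big1 ?mulr_ge0 ?exprn_ge0 ?normc_ge0 //.
    by move=> i _; rewrite subrr mulr0 subr0 normc0 expr0n.
  have E : chain 0 = fun s i => 1 * dpow (P 0 i) s.
    by apply/funext => s; apply/funext => i /=; rewrite mul1r.
  move=> H1 H2; rewrite E expr1; eexists => K; split; [exact: H1|exact: H2].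
  by move=> j i jm; rewrite P_Lam // leqW.
set K := (_ ^+ m.+1) in DK DJ.
have n0 : 0 <= n%:R :> R by [].
have [||] := @mul_jet_energy (P m.+1) (fun s => hact (chain m s))
    (fun s => hact (D s)) (n%:R * K) (P_Lam m.+1 ^~ (leqnn _)).
- by move=> s /DK[s1 s2]; rewrite !energy_hact !ler_wpM2l.
- move=> s h s0 sh0.
  have -> : (fun i => hact (chain m (s + h)) i - hact (chain m s) i - h * hact (D s) i)
      = hact (fun i => chain m (s + h) i + (-1) * chain m s i + (- h) * D s i).
    by apply/funext => i; rewrite !hactD !hactZ; ring.
  rewrite energy_hact -mulrA ler_wpM2l //.
  have -> : (fun i => chain m (s + h) i + (-1) * chain m s i + (- h) * D s i) =
     (fun i => chain m (s + h) i - chain m s i - h * D s i).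
    by apply/funext => i; ring.
  exact: DJ.
move=> H1 H2; rewrite exprS -/K -[_ * n%:R * K]mulrA.
by eexists => K'; split; [exact: H1|exact: H2].
Qed.

End Chain.

(** * One block of the core Dirichlet series *)

Section Block.
Context {R : realType}.
Local Notation C := R[i].

Lemma big_fiber_inj (T : finType) (num : T -> nat) (phi : R -> R) (f : T -> R) N :
  injective num -> phi 0 = 0 ->
  phi (\sum_(w | num w == N) f w) = \sum_(w | num w == N) phi (f w).
Proof.
move=> num_inj phi0; have [/existsP[w0 /eqP w0N]|H] := boolP [exists w, num w == N].
  have E : (fun w => num w == N) =1 pred1 w0.
    by move=> w /=; rewrite -w0N; apply/eqP/eqP => [/num_inj|->].
  by rewrite !(big_pred1 w0).
rewrite !big_pred0 ?phi0 // => w; apply/negbTE; apply: contra H => wN.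
all: by apply/existsP; exists w.
Qed.

Lemma big_fiber (V : nmodType) (T : finType) (num : T -> nat) X (f : T -> V) :
  (forall w, (num w < X)%N) ->
  \sum_(N < X) \sum_(w | num w == N) f w = \sum_w f w.
Proof.
move=> numX; rewrite (exchange_big_dep xpredT) //=; apply: eq_bigr => w _.
by rewrite (big_pred1 (Ordinal (numX w))) // => i /=; rewrite eq_sym.
Qed.

(** Each of the [2 rho] slots costs only a factor [sqrt n], by orthogonality,
although it contributes [n] letters. This square root is where the abscissa 1/2
comes from. *)
Lemma block_jet l (P : nat -> 'I_(hdim l) -> nat) (Lam : R) rho :
  1 <= Lam -> (0 < rho)%N ->
  (forall j i, (j < rho.*2)%N -> ln (P j i)%:R <= Lam) ->
  let B s := \sum_i chain P rho.*2.-1 s i in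
  let M := (256 * Lam ^+ 4) ^+ rho * (hdim l)%:R ^+ rho.+1 in
  exists D : C -> C, forall s, 0 <= complex.Re s ->
    [/\ normc (B s) <= M, normc (D s) <= M &
     forall h, 0 <= complex.Re (s + h) ->
       normc (B (s + h) - B s - h * D s) <= M * normc h ^+ 2].
Proof.
move=> L1 rho0 PL B M; set n := hdim l in B M *.
have rE : (rho.*2.-1.+1 = rho.*2)%N by rewrite prednK // double_gt0.
have [|D [DK DJ]] := @chain_jet _ l P Lam L1 rho.*2.-1.
  by move=> j i; rewrite -ltnS rE; exact: PL.
have L0 : 0 <= Lam by exact: le_trans L1.
have : 0 <= 256 * Lam ^+ 4 by apply: mulr_ge0 => //; exact: exprn_ge0.
rewrite /M {M}; move: (256 * Lam ^+ 4) DK DJ => G DK DJ G0; set M := _ * _.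
set K := (_ ^+ _) in DK DJ.
have n1 : 1 <= n%:R :> R by rewrite ler1n /n hdimE expn_gt0.
have M0 : 0 <= M by rewrite mulr_ge0 // exprn_ge0.
have nK : n%:R * K <= M ^+ 2.
  rewrite /K rE -muln2 /M !exprMn -!exprM mulrCA.
  by rewrite ler_wpM2l ?exprn_ge0 // -exprS ler_weXn2l //; lia.
have sqrtM (x : C) (t : R) : 0 <= t -> normc x ^+ 2 <= n%:R * (K * t ^+ 2) ->
    normc x <= M * t.
  move=> t0 H; rewrite -(@ler_pXn2r _ 2) ?nnegrE ?normc_ge0 ?(mulr_ge0 M0 t0) //.
  by apply: le_trans H _; rewrite mulrA exprMn ler_wpM2r // sqr_ge0.
exists (fun s : C => \sum_i D s i) => s s0; have [s1 s2] := DK s s0; split.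
- rewrite -[M]mulr1; apply: sqrtM => //; rewrite expr1n mulr1.
  by apply: le_trans (sqr_normc_sum_le _) _; rewrite ler_wpM2l.
- rewrite -[M]mulr1; apply: sqrtM => //; rewrite expr1n mulr1.
  by apply: le_trans (sqr_normc_sum_le _) _; rewrite ler_wpM2l.
- move=> h sh0; apply: sqrtM; first exact: sqr_ge0.
  rewrite /B mulr_sumr -!sumrB -exprM.
  by apply: le_trans (sqr_normc_sum_le _) _; rewrite ler_wpM2l // DJ.
Qed.

(** Normalized by the bound of [block_jet], the form is uniformly small together
with its derivative, and so is the sum of the squares of its coefficients; yet
its absolute sum at abscissa [1 / 2 - 1 / (r + 2)] is at least 1. The parameter
[L] allows blocks to be placed one after the other. *)
Lemma hadamard_block (r L : nat) : exists (A : nat -> R) (X : nat), [/\ (L < X)%N,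
  forall N, A N != 0 -> [/\ (L <= N < X)%N, (1 < N)%N &
     forall k, ~~ (nth_prime k.*2 %| N)%N],
  exists D : C -> C, forall s, 0 <= complex.Re s ->
    let B s := \sum_(N < X) (A N)%:C * dpow N s in
    [/\ normc (B s) <= 2^-1 ^+ r.+1, normc (D s) <= 2^-1 ^+ r.+1 &
     forall h, 0 <= complex.Re (s + h) ->
       normc (B (s + h) - B s - h * D s) <= 2^-1 ^+ r.+1 * normc h ^+ 2],
  \sum_(N < X) A N ^+ 2 <= 2^-1 ^+ r.+1
  & forall sigma : R, sigma <= 2^-1 - r.+2%:R^-1 ->
    1 <= \sum_(N < X) `|A N| * rpow N sigma].
Proof.
have [l [y [y0 pB par]]] := block_parameters r L.
pose n := hdim l; have nE : n = (2 ^ l)%N by exact: hdimE.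
have n0 : (0 < n)%N by rewrite nE expn_gt0.
(* Consecutive primes of odd index, [n] of them for each slot [j]. *)
pose P j (i : 'I_n) := nth_prime (L + (j * n + i)).*2.+1.
pose m := r.+2.*2.-1; have mE : (m.+1 = r.+2.*2)%N by [].
have Pp j i : prime (P j i) by exact: prime_nth_prime.
have P0 j i : (0 < P j i)%N by exact: prime_gt0.
have Pinj j i j' i' : P j i = P j' i' -> j = j' /\ i = i'.
  move=> /nth_prime_inj/succn_inj/double_inj/addnI E; split.
    have := congr1 (divn^~ n) E.
    by rewrite !divnMDl // !divn_small ?addn0 ?ltn_ord.
  apply: val_inj; have := congr1 (modn^~ n) E.
  by rewrite /= !modnMDl !modn_small ?ltn_ord.
have PB j i : (j <= m)%N -> (P j i <= 2 ^ y)%N.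
  move=> jm; apply: pB; rewrite -nE -mE mulSn addnC -addSn.
  by rewrite leq_add ?ltn_ord // leq_mul2r jm orbT.
pose W : finType := (word l m * 'I_n)%type.
pose num (w : W) := word_num P w.1 w.2.
pose sgn (w : W) : R := word_sign w.1 w.2.
have num_inj : injective num.
  by case=> [w i] [w' i'] /(word_num_inj P0 Pp Pinj)[/= -> ->].
have sgn1 w : `|sgn w| = 1 by exact: word_sign_abs.
pose T := ((2 ^ y) ^ r.+2.*2)%N.
have numT w : (num w <= T)%N by rewrite /T -mE; apply: word_num_le.
have num0 w : (0 < num w)%N by exact: word_num_gt0.
pose M : R := (256 * y%:R ^+ 4) ^+ r.+2 * n%:R ^+ r.+3.
have y1 : 1 <= y%:R :> R by rewrite ler1n.
have n1 : 1 <= n%:R :> R by rewrite ler1n.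
have G1 : 1 <= (256 * y%:R ^+ 4 : R) ^+ r.+2.
  by rewrite exprn_ege1 // mulr_ege1 ?exprn_ege1 // ler1n.
have M1 : 1 <= M by rewrite mulr_ege1 // exprn_ege1.
have M0 : 0 < M by exact: lt_le_trans M1.
pose kap : R := 2^-1 ^+ r.+1 / M.
have h0 : 0 < 2^-1 ^+ r.+1 :> R by rewrite exprn_gt0 // invr_gt0.
have kap0 : 0 < kap by rewrite divr_gt0.
pose A N := kap * \sum_(w | num w == N) sgn w.
pose X := (T + L).+1.
have numX w : (num w < X)%N by rewrite ltnS (leq_trans (numT w)) // leq_addr.
have sumA (phi : R -> R) (g : nat -> R) : phi 0 = 0 ->
    \sum_(N < X) phi (\sum_(w | num w == N) sgn w) * g N =
    \sum_w phi (sgn w) * g (num w).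
  move=> phi0; rewrite -(big_fiber _ numX); apply: eq_bigr => N _.
  rewrite big_fiber_inj // mulr_suml; apply: eq_bigr => w /eqP <- //.
have cardW : #|W| = (n ^ r.+2.*2)%N by rewrite card_prod card_word card_ord -mE expnSr.
exists A, X; split.
- by rewrite ltnS leq_addl.
- move=> N AN; have [w /eqP wN] : exists w, num w == N.
    apply/existsP; apply: contraNT AN => /existsPn H.
    by rewrite /A big_pred0 ?mulr0 // => w; apply/negbTE/H.
  have [k Pk] := word_num_ge P0 w.1 w.2.
  rewrite -wN; split; last 1 first.
  - move=> j0; apply/negP => /(prime_dvd_word_num (prime_nth_prime _) Pp)[j _ [i0]].
    by move=> /nth_prime_inj /(congr1 odd); rewrite /= !odd_double.
  - rewrite numX andbT; apply: leq_trans Pk.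
    by rewrite ltnW // (leq_ltn_trans _ (nth_prime_gt _)) // /P; lia.
  - by apply: leq_trans Pk; exact: prime_gt1.
- have [|D DP] := @block_jet l P y%:R r.+2 y1 isT.
    move=> j i jm; apply: (@le_trans _ _ (ln ((2 ^ y)%N%:R))).
      by rewrite ler_ln ?posrE ?ltr0n ?expn_gt0 // ler_nat PB.
    rewrite natrX lnXn //; apply: ler_wMn2r.
    by apply: (@le_ln1Dx R 1); lra.
  exists (fun s => kap%:C * D s) => s s0 B.
  have BE z : \sum_(N < X) (A N)%:C * dpow N z = kap%:C * \sum_i chain P m z i.
    transitivity (kap%:C * \sum_w (sgn w)%:C * dpow (num w) z).
      rewrite -(big_fiber _ numX) mulr_sumr; apply: eq_bigr => N _.
      rewrite /A rmorphM -mulrA; congr (_ * _); rewrite rmorph_sum mulr_suml.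
      by apply: eq_bigr => w /eqP <-.
    congr (_ * _); under [RHS]eq_bigr do rewrite chainE //.
    by rewrite exchange_big pair_bigA.
  have [D1 D2 D3] := DP s s0.
  have kM x : normc x <= M -> normc (kap%:C * x) <= 2^-1 ^+ r.+1.
    move=> xM; rewrite normcM normc_real gtr0_norm // /kap mulrAC.
    by rewrite ler_pdivrMr // ler_wpM2l // ltW.
  split; first by rewrite /B BE; exact: kM.
    exact: kM.
  move=> h sh0; rewrite /B !BE mulrCA -!mulrBr normcM normc_real gtr0_norm //.
  apply: le_trans (ler_wpM2l (ltW kap0) (D3 h sh0)) _.
  by rewrite mulrA /kap divfK // gt_eqF.
- rewrite /A; under eq_bigr do rewrite exprMn -[X in _ * X]mulr1.
  rewrite -mulr_sumr (sumA (fun x => x ^+ 2) (fun=> 1)) ?expr0n //.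
  under eq_bigr do rewrite -(real_normK (num_real _)) sgn1 expr1n mulr1.
  rewrite sumr_const cardW -mulr_natl mulr1 natrX /kap exprMn -mulrA.
  have h1 : 2^-1 ^+ r.+1 <= 1 :> R by rewrite exprn_ile1 //; lra.
  apply: (@le_trans _ _ ((2^-1 ^+ r.+1) ^+ 2)); last by rewrite expr2 ler_piMl // ltW.
  rewrite ler_piMr ?sqr_ge0 // exprVn mulrC ler_pdivrMr ?exprn_gt0 // mul1r.
  apply: (@le_trans _ _ ((n%:R ^+ r.+3) ^+ 2)).
    by rewrite -exprM ler_weXn2l //; lia.
  rewrite ler_pXn2r ?nnegrE ?exprn_ge0 ?(ltW M0) // /M.
  by rewrite ler_peMl ?exprn_ge0.
- move=> sigma sig; rewrite /A.
  under eq_bigr do rewrite normrM (gtr0_norm kap0) -mulrA.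
  rewrite -mulr_sumr (sumA (fun x => `|x|) (fun N => rpow N sigma)) ?normr0 //.
  under eq_bigr do rewrite sgn1 mul1r.
  have low w : (2 ^ (y * r))%N%:R^-1 <= rpow (num w) sigma.
    (* The abscissa is chosen so that [sig0] times the number of slots is [r]. *)
    pose sig0 : R := 2^-1 - r.+2%:R^-1.
    have sig0E : sig0 * r.+2.*2%:R = r%:R.
      rewrite /sig0 -mul2n natrM mulrBl mulrA mulVf // mul1r [2 * _]mulrC mulrA.
      by rewrite mulVf // mul1r -[r.+2]addn2 natrD addrK.
    have sig00 : 0 <= sig0.
      by rewrite -(@pmulr_lge0 _ r.+2.*2%:R) ?ltr0n // sig0E.
    apply: le_trans (ler_rpow _ sig).
    apply: le_trans (ler_rpown sig00 (num0 w) (numT w)).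
    rewrite /rpow /T !natrX -exprM lnXn // -[ln _ *+ _]mulr_natl.
    have -> : sig0 * ((y * r.+2.*2)%N%:R * ln 2) = (y * r)%N%:R * ln 2.
      by rewrite !natrM -sig0E; ring.
    by rewrite expRN expRM_natl lnK // posrE.
  apply: (@le_trans _ _ (kap * \sum_(w : W) (2 ^ (y * r))%N%:R^-1)); last first.
    by rewrite ler_wpM2l ?(ltW kap0) // ler_sum.
  rewrite sumr_const cardW -[X in _ * X]mulr_natl mulrA /kap.
  rewrite ler_pdivlMr ?ltr0n ?expn_gt0 // mul1r mulrAC ler_pdivlMr //.
  rewrite exprVn [leRHS]mulrC ler_pdivlMr ?exprn_gt0 //.
  have -> : M = ((256 * y ^ 4) ^ r.+2 * n ^ r.+3)%N%:R by rewrite natrM !natrX natrM natrX.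
  rewrite -natrX -!natrM ler_nat.
  have -> : (n ^ r.+2.*2 = n ^ r.+1 * n ^ r.+3)%N by rewrite -expnD; congr expn; lia.
  rewrite -nE in par; apply: leq_trans (leq_mul par (leqnn _)).
  have -> : (2 ^ 10 = 4 * 256)%N by [].
  rewrite -[(4 * 256 * _)%N]mulnA [((4 * _) ^ _)%N]expnMn.
  have h2 : (2 ^ r.+1 <= 4 ^ r.+2)%N by rewrite -[4%N]/(2 ^ 2)%N -expnM leq_exp2l //; lia.
  move: (2 ^ (y * r))%N (4 ^ r.+2)%N ((256 * _) ^ _)%N (n ^ _)%N (2 ^ _)%N h2.
  move=> a b c d e eb; have := leq_mul eb (leqnn (a * c * d)%N).
  by congr (_ <= _)%N; ring.
Qed.

End Block.

(** * The core Dirichlet series *)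

Section Assembly.
Context {R : realType}.
Local Notation C := R[i].

Definition half_pow (r : nat) : R := 2^-1 ^+ r.+1.

Lemma series_half_pow n : series half_pow n = 1 - 2^-1 ^+ n.
Proof.
elim: n => [|n IH]; first by rewrite /series /= big_geq // expr0 subrr.
rewrite seriesSr IH /half_pow exprS; lra.
Qed.

Lemma cvg_half_pow : series half_pow @ \oo --> (1 : R).
Proof.
have -> : series half_pow = (fun n => 1 - 2^-1 ^+ n).
  by apply/funext => n; exact: series_half_pow.
rewrite -[X in _ --> X]subr0; apply: cvgB; first exact: cvg_cst.
by apply: cvg_expr; rewrite ger0_norm ?invr_ge0 // invf_lt1 // ltr1n.
Qed.

Lemma big_nat_blocks (V : nmodType) (X : nat -> nat) (F : nat -> V) m :
  X 0 = 0%N -> (forall r, X r <= X r.+1)%N ->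
  \sum_(0 <= N < X m) F N = \sum_(r < m) \sum_(X r <= N < X r.+1) F N.
Proof.
move=> X0 Xm; elim: m => [|m IH]; first by rewrite X0 big_geq // big_ord0.
by rewrite big_ord_recr /= -IH (big_cat_nat _ (Xm m)).
Qed.

(** The blocks occupy consecutive intervals of integers, so that their partial
sums are partial sums of a single Dirichlet series. *)
Lemma block_sequence : exists (a : nat -> R) (X : nat -> nat), [/\
  X 0%N = 0%N, forall r, (X r < X r.+1)%N,
  forall N, a N != 0 -> (1 < N)%N /\ forall k, ~~ (nth_prime k.*2 %| N)%N &
  forall r,
  [/\ exists D : C -> C, forall s, 0 <= complex.Re s ->
    let B s := \sum_(X r <= N < X r.+1) (a N)%:C * dpow N s in
    [/\ normc (B s) <= half_pow r, normc (D s) <= half_pow r &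
     forall h, 0 <= complex.Re (s + h) ->
       normc (B (s + h) - B s - h * D s) <= half_pow r * normc h ^+ 2],
  \sum_(X r <= N < X r.+1) a N ^+ 2 <= half_pow r
  & forall sigma : R, sigma <= 2^-1 - r.+2%:R^-1 ->
    1 <= \sum_(X r <= N < X r.+1) `|a N| * rpow N sigma]].
Proof.
have [fA fAP] := choice (fun rL : nat * nat => @hadamard_block R rL.1 rL.2).
have [fX fP] := choice fAP.
pose X := fix X r := if r is r'.+1 then fX (r', X r') else 0%N.
pose A r := fA (r, X r).
have XS r : (X r < X r.+1)%N by have [] := fP (r, X r).
have AX r N : A r N != 0 -> [/\ (X r <= N < X r.+1)%N, (1 < N)%N &
     forall k, ~~ (nth_prime k.*2 %| N)%N].
  by have [_ H _ _ _] := fP (r, X r) => /H.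
have leX : {homo X : i j / (i <= j)%N}.
  by apply: homo_leq => [//|x y z|i]; [exact: leq_trans|exact: ltnW].
have geX r : (r <= X r)%N by elim: r => // r IH; exact: leq_ltn_trans (XS r).
pose a N := \sum_(r < N.+1) A r N.
have aE r N : (X r <= N < X r.+1)%N -> a N = A r N.
  move=> /andP[rN Nr]; have rN' : (r < N.+1)%N by rewrite ltnS (leq_trans (geX r)).
  rewrite /a (bigD1 (Ordinal rN')) //= big1 ?addr0 // => i /eqP ir.
  apply/eqP; apply: contra_notT ir => /AX[/andP[iN Ni] _ _].
  apply: val_inj => /=; apply/eqP; rewrite eqn_leq; apply/andP; split.
    by rewrite leqNgt; apply/negP => /leX h; have := leq_trans Nr (leq_trans h iN); rewrite ltnn.
  by rewrite leqNgt; apply/negP => /leX h; have := leq_trans Ni (leq_trans h rN); rewrite ltnn.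
have sumE (V : nmodType) r (F : R -> nat -> V) : (forall N, F 0 N = 0) ->
    \sum_(X r <= N < X r.+1) F (a N) N = \sum_(N < X r.+1) F (A r N) N.
  move=> F0; rewrite -(big_mkord xpredT (fun N => F (A r N) N)).
  rewrite [RHS](big_cat_nat _ (n := X r)) ?(ltnW (XS r)) //=.
  rewrite [X in _ = X + _]big1_seq ?add0r; last first.
    move=> N /andP[_]; rewrite mem_index_iota => /andP[_ NX].
    have [->//|/AX[/andP[XN _] _ _]] := eqVneq (A r N) 0.
    by move: (leq_trans NX XN); rewrite ltnn.
  by apply: eq_big_nat => N /aE ->.
exists a, X; split=> // [N aN|r].
  have [r /AX[_ N0 H]] : exists r, A r N != 0.
    apply/not_existsP => H; move: aN; rewrite /a big1 ?eqxx // => i _.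
    by apply/eqP; apply: contra_notT (H i).
  by split.
have [_ _ [D DP] sq low] := fP (r, X r); split.
- exists D => s s0 B; have BE z : B z = \sum_(N < X r.+1) (A r N)%:C * dpow N z.
    by rewrite -(sumE _ r (fun x N => x%:C * dpow N z)) // => N; rewrite mul0r.
  have [D1 D2 D3] := DP s s0; split=> //; first by rewrite BE.
  by move=> h sh0; rewrite !BE; exact: D3.
- by rewrite (sumE _ r (fun x N => x ^+ 2)) // => N; rewrite expr0n.
- move=> sigma /low; rewrite (sumE _ r (fun x N => `|x| * rpow N sigma)) //.
  by move=> N; rewrite normr0 mul0r.
Qed.

(** Normal convergence of the blocks, together with their derivatives and
quadratic remainders, yields a holomorphic function on the whole half-plane of positive real part, although the Dirichlet series converges
absolutely only to the right of 1/2: there the square summability of the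
coefficients suffices, while each block contributes at least 1 to the left. *)
Lemma core_function : exists (a : nat -> R) (w : C -> C) (X : nat -> nat), [/\
  forall N, a N != 0 -> (1 < N)%N /\ forall k, ~~ (nth_prime k.*2 %| N)%N,
  forall m, \sum_(N < m) a N ^+ 2 <= 1,
  forall sigma : R, sigma < 2^-1 ->
    forall K, exists m, K <= \sum_(N < m) `|a N| * rpow N sigma,
  forall s, 0 < complex.Re s -> normc (w s) <= 1 /\ cdiff w s &
  (forall m, m <= X m)%N /\ forall m s, 0 < complex.Re s ->
    normc (w s - \sum_(N < X m) (a N)%:C * dpow N s) <= 2^-1 ^+ m].
Proof.
have [a [X [X0 XS supp blocks]]] := block_sequence.
have geX r : (r <= X r)%N by elim: r => // r IH; exact: leq_ltn_trans (XS r).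
have XS' r : (X r <= X r.+1)%N by exact: ltnW.
pose B r s := \sum_(X r <= N < X r.+1) (a N)%:C * dpow N s : C.
have ch : cvgn (series half_pow) by apply/cvg_ex; exists 1; exact: cvg_half_pow.
have lh : limn (series half_pow) = 1 by apply/cvg_lim => //; exact: cvg_half_pow.
have BH r s : 0 <= complex.Re s -> normc (B r s) <= half_pow r.
  by move=> s0; have [[D DP] _ _] := blocks r; have [] := DP s s0.
exists a, (fun s => csum (fun r => B r s)), X; split=> //.
- move=> m; apply: (@le_trans _ _ (\sum_(N < X m) a N ^+ 2)).
    rewrite -!(big_mkord xpredT (fun N => a N ^+ 2)) [leRHS](big_cat_nat _ (geX m)) //=.
    by rewrite lerDl sumr_ge0 // => i _; exact: sqr_ge0.
  rewrite -(big_mkord xpredT (fun N => a N ^+ 2)) big_nat_blocks //.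
  apply: (@le_trans _ _ (\sum_(r < m) half_pow r)).
    by apply: ler_sum => r _; have [] := blocks r.
  have -> : \sum_(r < m) half_pow r = 1 - 2^-1 ^+ m.
    by rewrite -series_half_pow /series /= big_mkord.
  by rewrite lerBlDr lerDl exprn_ge0.
- move=> sigma sig K.
  have [r0 r0P] : exists r0 : nat, (2^-1 - sigma)^-1 <= r0%:R.
    by exists (Num.truncn (2^-1 - sigma)^-1).+1; apply/ltW/truncnS_gt.
  have low r : (r0 <= r)%N -> sigma <= 2^-1 - r.+2%:R^-1.
    move=> rr; rewrite lerBrDl -lerBrDr -[leRHS]invrK lef_pV2 ?posrE ?ltr0n ?invr_gt0 ?subr_gt0 //.
    by rewrite (le_trans r0P) // ler_nat; lia.
  pose k := (Num.truncn K).+1; exists (X (r0 + k)).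
  pose F N := `|a N| * rpow N sigma.
  have F0 N : 0 <= F N by rewrite mulr_ge0 // ltW // rpow_gt0.
  rewrite -(big_mkord xpredT F) big_nat_blocks // big_split_ord /=.
  apply: (@le_trans _ _ (\sum_(r < k) 1)).
    by rewrite sumr_const card_ord; apply/ltW/truncnS_gt.
  rewrite ler_wpDl //; first by rewrite sumr_ge0 // => r _; exact: sumr_ge0.
  apply: ler_sum => r _; have [_ _ H] := blocks (r0 + r)%N.
  by apply: H; apply: low; exact: leq_addr.
- move=> s s0; split.
    by rewrite -lh; apply: normc_csum_le => // r; exact/BH/ltW.
  have /choice[D DP] : forall r, exists D : C, normc D <= half_pow r /\
      forall h, 0 <= complex.Re (s + h) ->
      normc (B r (s + h) - B r s - h * D) <= half_pow r * normc h ^+ 2.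
    move=> r; have [[D DP] _ _] := blocks r; have [_ ? ?] := DP s (ltW s0).
    by exists (D s).
  apply: (@cdiff_csum _ B D half_pow (complex.Re s)) => //.
    by move=> k; have [] := DP k.
  move=> k h hs; have sh0 := ltW (Re_add_gt0 s0 hs).
  by split; [exact: BH|have [_] := DP k; exact].
- split=> // m s s0; rewrite -(big_mkord xpredT (fun N => (a N)%:C * dpow N s)).
  rewrite big_nat_blocks //.
  have -> : \sum_(r < m) B r s = series (fun r => B r s) m.
    by rewrite /series /= big_mkord.
  apply: le_trans (normc_csum_tail m _ ch) _; first by move=> k; exact/BH/ltW.
  by rewrite lh series_half_pow opprB addrC subrK.
Qed.

End Assembly.

(** * Dirichlet convolution of absolutely convergent series *)

Section MultiplicativeConvolution.

Definition mconv (V : pzRingType) (a b : nat -> V) (N : nat) : V :=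
  \sum_(d < N.+1) \sum_(e < N.+1) if (d * e == N)%N then a d * b e else 0.

Lemma big_ord_widen0 (V : nmodType) (F : nat -> V) n m : (n <= m)%N ->
  (forall i, (n <= i)%N -> F i = 0) -> \sum_(i < n) F i = \sum_(i < m) F i.
Proof.
move=> nm F0; rewrite -!(big_mkord xpredT F) [RHS](big_cat_nat _ nm) //=.
rewrite [X in _ = _ + X]big1_seq ?addr0 // => i /andP[_].
by rewrite mem_index_iota => /andP[/F0].
Qed.

Context {V : pzRingType} (a b : nat -> V).
Hypotheses (a0 : a 0%N = 0) (b0 : b 0%N = 0).

Lemma mconv_widen N m : (N < m)%N ->
  mconv a b N = \sum_(d < m) \sum_(e < m) if (d * e == N)%N then a d * b e else 0.
Proof.
move=> Nm; rewrite /mconv.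
rewrite (@big_ord_widen0 _ (fun d => \sum_(e < N.+1)
    if (d * e == N)%N then a d * b e else 0) _ _ Nm).
  apply: eq_bigr => d _.
  apply: (@big_ord_widen0 _ (fun e => if (d * e == N)%N then a d * b e else 0)) => //.
  move=> e Ne; case: eqP => // E; have [->|d0] := posnP d; first by rewrite a0 mul0r.
  by have := leq_pmull e d0; rewrite E leqNgt Ne.
move=> d Nd; apply: big1 => e _; case: eqP => // E.
have [->|e0] := posnP (e : nat); first by rewrite b0 mulr0.
by have := leq_pmulr d e0; rewrite E leqNgt Nd.
Qed.

Lemma sum_mconv m : \sum_(N < m) mconv a b N =
  \sum_(d < m) \sum_(e < m) if (d * e < m)%N then a d * b e else 0.
Proof.
under eq_bigr => N _ do rewrite (mconv_widen (ltn_ord N)).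
rewrite exchange_big; apply: eq_bigr => d _.
rewrite exchange_big; apply: eq_bigr => e _ /=.
rewrite -big_mkcond /=; case: ifP => [de|de].
  by rewrite (big_pred1 (Ordinal de)) // => i /=; rewrite eq_sym.
by rewrite big_pred0 // => i; apply/eqP => E; move: (ltn_ord i); rewrite -E de.
Qed.

End MultiplicativeConvolution.

Section ConvolutionSummation.
Context {R : realType}.
Local Notation C := R[i].
Variables (a b : nat -> C).
Hypotheses (a0 : a 0%N = 0) (b0 : b 0%N = 0).
Hypotheses (sa : abs_summable a) (sb : abs_summable b).

Let na n := normc (a n).
Let nb n := normc (b n).

Lemma mul_sum_if (V : pzRingType) (f g : nat -> V) m (P : nat -> nat -> bool) :
  \sum_(d < m) \sum_(e < m) (if P d e then f d * g e else 0) =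
  (\sum_(d < m) f d) * (\sum_(e < m) g e) -
  \sum_(d < m) \sum_(e < m) (if P d e then 0 else f d * g e).
Proof.
rewrite mulr_suml -sumrB; apply: eq_bigr => d _.
rewrite mulr_sumr -sumrB; apply: eq_bigr => e _.
by case: ifP; rewrite ?subr0 ?subrr.
Qed.

Lemma mconv_abs_summable : abs_summable (mconv a b).
Proof.
apply: (@abs_summable_bounded _ _ (limn (series na) * limn (series nb))) => m.
apply: (@le_trans _ _ (\sum_(N < m) mconv na nb N)).
  apply: ler_sum => N _; apply: le_trans (normc_sum _ _ _) _.
  apply: ler_sum => d _; apply: le_trans (normc_sum _ _ _) _.
  by apply: ler_sum => e _; case: ifP; rewrite ?normcM ?normc0.
rewrite sum_mconv; [|by rewrite /na a0 normc0|by rewrite /nb b0 normc0].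
rewrite (@mul_sum_if _ na nb m (fun d e => d * e < m)%N).
rewrite lerBlDr -[leLHS]addr0; apply: lerD.
  by apply: ler_pM; rewrite ?sumr_ge0 ?sum_le_limn // => k; rewrite normc_ge0.
apply: sumr_ge0 => d _; apply: sumr_ge0 => e _.
by case: ifP => // _; rewrite mulr_ge0 ?normc_ge0.
Qed.

(** A pair [(d, e)] with [K ^ 2 <= d * e] has an entry outside the square of
side [K], so the terms by which partial sums and products of partial sums
differ are controlled by the product of the absolute sums. *)
Lemma csum_mconv : csum (mconv a b) = csum a * csum b.
Proof.
apply: cvg_csumE; first exact: mconv_abs_summable.
have cvgS (c : nat -> C) : abs_summable c -> (fun m => \sum_(d < m) c d) @ \oo --> csum c.
  move=> sc; have -> : (fun m => \sum_(d < m) c d) = series c.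
    by apply/funext => m; rewrite /series /= big_mkord.
  exact: csum_cvg.
have -> : series (mconv a b) = fun m => (\sum_(d < m) a d) * (\sum_(e < m) b e) -
    \sum_(d < m) \sum_(e < m) if (d * e < m)%N then 0 else a d * b e.
  apply/funext => m; rewrite /series /= big_mkord sum_mconv //.
  by rewrite (@mul_sum_if _ a b m (fun d e => d * e < m)%N).
rewrite -[X in _ --> X]subr0; apply: cvgB.
  by apply: cvgM; exact: cvgS.
apply/cvg_normcP => eps eps0.
pose A := limn (series na); pose B := limn (series nb).
have na0 k : 0 <= na k by exact: normc_ge0.
have nb0 k : 0 <= nb k by exact: normc_ge0.
pose p m := (\sum_(d < m) na d) * (\sum_(e < m) nb e).
have cp : p @ \oo --> A * B.
  apply: cvgM.
    have -> : (fun m => \sum_(d < m) na d) = series na.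
      by apply/funext => m; rewrite /series /= big_mkord.
    exact: sa.
  have -> : (fun m => \sum_(d < m) nb d) = series nb.
    by apply/funext => m; rewrite /series /= big_mkord.
  exact: sb.
move/cvgrPdist_lt : cp => /(_ _ eps0) [K _ KP].
near=> m; rewrite sub0r normcNC.
have Km : (K * K <= m)%N by near: m; exact: nbhs_infty_ge.
have Km' : (K <= m)%N by rewrite (leq_trans _ Km) //; case: (K) => // k; rewrite leq_pmulr.
have {KP} := KP K (leqnn K); rewrite /= => /(le_lt_trans (ler_norm _)).
apply: le_lt_trans; apply: (@le_trans _ _ (p m - p K)); last first.
  rewrite lerD2r; apply: ler_pM; rewrite ?sumr_ge0 //; exact: sum_le_limn.
apply: le_trans (normc_sum _ _ _) _.
have -> : p K = \sum_(d < m) \sum_(e < m)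
    if (d < K)%N && (e < K)%N then na d * nb e else 0.
  rewrite /p (big_ord_widen m na Km') (big_ord_widen m nb Km').
  rewrite big_mkcond mulr_suml; apply: eq_bigr => d _.
  rewrite mulr_sumr big_mkcond; apply: eq_bigr => e _.
  by case: (d < K)%N; case: (e < K)%N; rewrite ?mul0r ?mulr0.
rewrite /p mulr_suml -sumrB; apply: ler_sum => d _.
apply: le_trans (normc_sum _ _ _) _.
rewrite mulr_sumr -sumrB; apply: ler_sum => e _.
have H0 : 0 <= na d * nb e by rewrite mulr_ge0.
case: ifP => [_|de]; first by rewrite normc0; case: ifP; rewrite ?subrr ?subr0.
case: ifP => [/andP[dK eK]|_]; last by rewrite subr0 normcM.
suff : (d * e < m)%N by rewrite de.
by apply: leq_trans Km; case: (K) dK eK => // k dk ek; rewrite ltn_mul.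
Unshelve. all: by end_near. Qed.

End ConvolutionSummation.

(** * Simultaneous alignment of the phases of primes *)

Section Boxes.
Variables (p : nat -> nat) (q : nat).
Hypotheses (p_prime : forall j, prime (p j)) (p_inj : injective p).

(** The integers [\prod_(j < J) p j ^ a_j] with all exponents at most [q]. *)
Fixpoint box J : seq nat :=
  if J is J'.+1 then [seq (p J' ^ a * n)%N | a <- iota 0 q.+1, n <- box J']
  else [:: 1%N].

#[local] Arguments box : simpl never.

Lemma boxS J :
  box J.+1 = [seq (p J ^ a * n)%N | a <- iota 0 q.+1, n <- box J].
Proof. by []. Qed.

Lemma logn_p i j : logn (p i) (p j) = (i == j).
Proof. by rewrite logn_prime // (inj_eq p_inj). Qed.

Lemma logn_box J n : n \in box J ->
  (0 < n)%N /\ forall i, (J <= i)%N -> logn (p i) n = 0%N.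
Proof.
elim: J n => [|J IH] n; first by rewrite inE => /eqP->; split=> // i _; rewrite logn1.
rewrite boxS.
move=> /allpairsP[[a m] /= [_ /IH[m0 mJ] ->]]; have pa : (0 < p J ^ a)%N by rewrite expn_gt0 prime_gt0.
split=> [|i Ji]; first by rewrite muln_gt0 pa.
rewrite lognM // lognX logn_p mJ ?(ltnW Ji) // addn0.
by rewrite (_ : (i == J) = false) ?muln0 //; apply/eqP => iJ; rewrite iJ ltnn in Ji.
Qed.

Lemma box_uniq J : uniq (box J).
Proof.
elim: J => [//|J IH]; rewrite boxS; apply: allpairs_uniq => //; first exact: iota_uniq.
move=> [a m] [b n] /allpairsP[[a' m'] [_ mJ [-> ->]]].
move=> /allpairsP[[b' n'] [_ nJ [-> ->]]]; move: mJ nJ; rewrite /= => mJ nJ E.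
have [m0 mJ'] := logn_box mJ; have [n0 nJ'] := logn_box nJ.
have pa c : (0 < p J ^ c)%N by rewrite expn_gt0 prime_gt0.
have ab : a' = b'.
  have := congr1 (logn (p J)) E.
  by rewrite !lognM // !lognX !logn_p eqxx mJ' // nJ' // !muln1 !addn0.
by move/eqP: E; rewrite ab eqn_pmul2l // => /eqP->.
Qed.

Lemma size_box J : size (box J) = (q.+1 ^ J)%N.
Proof. by elim: J => [//|J IH]; rewrite boxS size_allpairs size_iota IH expnS. Qed.

(** Multiplication by [p j] leaves the box only from its face [a_j = q]. *)
Lemma box_boundary J j : (j < J)%N ->
  (q.+1 * \sum_(n <- box J) (p j * n \notin box J) <= size (box J))%N.
Proof.
elim: J => // J IH; rewrite ltnS leq_eqVlt => /orP[/eqP ->|jJ].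
  rewrite size_box expnS -size_box leq_mul2l; apply/orP; right.
  rewrite [X in (\sum_(_ <- X) _)%N]boxS big_allpairs_dep.
  have -> : iota 0 q.+1 = rcons (iota 0 q) q by rewrite -cats1 -[q.+1]addn1 iotaD.
  rewrite -cats1 big_cat big_seq1 /=.
  rewrite [X in (X + _)%N]big1_seq ?add0n; last first.
    move=> a /andP[_]; rewrite mem_iota /= add0n => aq; apply: big1_seq => n /andP[_ nJ].
    apply/eqP; rewrite eqb0 negbK mulnA -expnS.
    rewrite boxS; apply/allpairsP; exists (a.+1, n); rewrite nJ mem_iota.
    by split.
  rewrite -sum1_size; apply: leq_sum => n _; exact: leq_b1.
rewrite [size _]size_box expnS -size_box.
rewrite [X in (\sum_(_ <- X) _)%N]boxS big_allpairs_dep big_distrr.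
rewrite -[X in (_ <= X * _)%N](size_iota 0) -sum1_size big_distrl /=.
rewrite big_seq [leqRHS]big_seq; apply: leq_sum => a aq; rewrite mul1n; apply: leq_trans (IH jJ).
rewrite leq_mul2l; apply/orP; right; apply: leq_sum => n _.
have [/idP H|//] := boolP (p j * n \in box J)%N; last by rewrite leq_b1.
rewrite leqn0 eqb0 negbK mulnCA boxS; apply/allpairsP; exists (a, (p j * n)%N).
by rewrite /= H aq.
Qed.

End Boxes.

Section Kronecker.
Context {R : realType}.
Local Notation C := R[i].

Lemma mulc_conj (x : C) : x * x^*%C = (normc x ^+ 2)%:C.
Proof. by rewrite -sqr_normc normr_normc rmorphXn. Qed.

Lemma conjc_scale (a : R) (x : C) : (a%:C * x)^*%C = a%:C * x^*%C.
Proof. by case: x => b c; apply/eqP; rewrite eq_complex /= !mul0r !subr0 !addr0 mulrN !eqxx. Qed.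

Lemma conjcM (x y : C) : (x * y)^*%C = x^*%C * y^*%C.
Proof. exact: rmorphM. Qed.

Lemma sum_indicator (V : pzRingType) (F : seq nat) (g : nat -> V) x : uniq F ->
  \sum_(m <- F) g m * (x == m)%:R = if x \in F then g x else 0.
Proof.
move=> uF; have [xF|xF] := boolP (x \in F).
  rewrite (bigD1_seq x) //= eqxx mulr1 big1 ?addr0 // => m /negbTE.
  by rewrite eq_sym => ->; rewrite mulr0.
rewrite big1_seq // => m /andP[_ mF]; case: eqVneq => [xm|]; last by rewrite mulr0.
by rewrite xm mF in xF.
Qed.

Lemma normc_conj (x : C) : normc x^*%C = normc x.
Proof. by case: x => a b /=; rewrite sqrrN. Qed.

Definition freq n (t : R) : C := dpow n (0 +i* t).

Lemma normc_freq n t : normc (freq n t) = 1.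
Proof. by rewrite normc_dpow /rpow mul0r oppr0 expR0. Qed.

Lemma freqM n m t : (0 < n)%N -> (0 < m)%N -> freq (n * m) t = freq n t * freq m t.
Proof. exact: dpowM. Qed.

(** Sampling a monomial along an arithmetic progression of times gives a
geometric sequence. *)
Lemma freq_muln n (k : nat) t : freq n (k%:R * t) = freq n t ^+ k.
Proof.
elim: k => [|k IH].
  by rewrite mul0r expr0 /freq /dpow -[0 +i* 0]/(0 : C) mul0r oppr0 cexp0.
rewrite exprS -IH /freq -dpowD; congr dpow.
by apply/eqP; rewrite eq_complex /= addr0 eqxx -natr1 mulrDl mul1r addrC eqxx.
Qed.

Definition mean (f : nat -> C) (T : nat) : C := T%:R^-1 * \sum_(k < T) f k.

Lemma cvg_mean_geometric (z : C) : normc z = 1 -> z != 1 ->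
  mean (fun k => z ^+ k) @ \oo --> (0 : C).
Proof.
move=> z1 zn1; have z10 : z - 1 != 0 by rewrite subr_eq0.
have nz : 0 < normc (z - 1).
  by rewrite lt_neqAle normc_ge0 eq_sym andbT; apply: contra_neq z10 => /eq0_normc.
apply/cvg_normcP => e e0; near=> T.
have T0 : 0 < T%:R :> R by rewrite ltr0n; near: T; exact: nbhs_infty_gt.
have TT : 2 / normc (z - 1) / e < T%:R :> R.
  near: T; exact: nbhs_infty_gtr.
rewrite sub0r normcNC /mean normcM normcV.
have -> : (T%:R : C) = T%:R%:C by rewrite rmorph_nat.
rewrite normc_real gtr0_norm // mulrC ltr_pdivrMr //.
have -> : \sum_(k < T) z ^+ k = (z ^+ T - 1) / (z - 1).
  by rewrite subrX1 mulrC mulKf.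
rewrite normcM normcV; apply: le_lt_trans (_ : 2 / normc (z - 1) < _).
  rewrite ler_wpM2r ?invr_ge0 ?normc_ge0 //.
  by apply: le_trans (normcBC _ _) _; rewrite normcX z1 expr1n normc1.
by rewrite [ltRHS]mulrC -ltr_pdivrMr.
Unshelve. all: by end_near. Qed.

(** A sampling step so short that distinct frequencies below [B] stay distinct
when sampled. *)
Lemma freq_separated B : exists delta : R, forall n m, (0 < n <= B)%N ->
  (0 < m <= B)%N -> n != m -> freq n delta * (freq m delta)^*%C != 1.
Proof.
have lB0 := @lnn_ge0 R B; exists (ln B%:R + 1)^-1 => n m.
set delta := _^-1; have d0 : 0 < delta by rewrite invr_gt0; lra.
move=> /andP[n0 nB] /andP[m0 mB] nm.
pose y := delta * (ln m%:R - ln n%:R).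
have -> : freq n delta * (freq m delta)^*%C = cexp (0 +i* y).
  have fE k : freq k delta = cexp (0 +i* (- (delta * ln k%:R))).
    by rewrite /freq /dpow; congr cexp; apply/eqP; rewrite eq_complex /= !mul0r mulr0 !(subr0, addr0, add0r) oppr0 !eqxx.
  have conjE (a : R) : (cexp (0 +i* a))^*%C = cexp (0 +i* (- a)).
    by rewrite /cexp /= expR0 cosN sinN; apply/eqP; rewrite eq_complex /= !mul1r !mul0r !subr0 !addr0 !eqxx.
  rewrite !fE conjE -cexpD; congr cexp; apply/eqP; rewrite eq_complex /= addr0 eqxx /=.
  by apply/eqP; rewrite /y; ring.
have lnb k : (0 < k)%N -> (k <= B)%N -> 0 <= ln (k%:R : R) <= ln B%:R.
  move=> k0 kB; rewrite lnn_ge0 ler_ln ?posrE ?ltr0n ?ler_nat //.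
  exact: leq_trans kB.
have [/andP[n1 n2] /andP[m1 m2]] := (lnb n n0 nB, lnb m m0 mB).
have y1 : `|y| < 1.
  rewrite normrM gtr0_norm // mulrC ltr_pdivrMr ?invr_gt0 //; last lra.
  by rewrite mul1r ltr_norml; apply/andP; split; lra.
have y0 : y != 0.
  rewrite /y mulf_eq0 gt_eqF //= subr_eq0; apply: contra_neq nm.
  by move=> /ln_inj; rewrite !posrE !ltr0n => /(_ m0 n0) /eqP; rewrite eqr_nat => /eqP.
apply/eqP => E.
have c1 : cos y = 1.
  by have := congr1 (@complex.Re R) E; rewrite Re_cexp /= expR0 mul1r.
have s0 : sin y = 0.
  by have := congr1 (@complex.Im R) E; rewrite Im_cexp /= expR0 mul1r.
have := abs_sin_sub_le y; rewrite s0 sub0r normrN -(real_normK (num_real y)) expr2.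
have ny0 : 0 < `|y| by rewrite normr_gt0.
by rewrite -[leLHS]mul1r ler_pM2r // leNgt y1.
Qed.

Definition has_mean (f : nat -> C) (l : C) := mean f @ \oo --> l.
Implicit Types (f g h : nat -> C) (a b : C).

Lemma has_meanD f g a b : has_mean f a -> has_mean g b ->
  has_mean (fun k => f k + g k) (a + b).
Proof.
move=> fa gb; rewrite /has_mean.
have -> : mean (fun k => f k + g k) = (fun T => mean f T + mean g T).
  by apply/funext => T; rewrite /mean big_split /= mulrDr.
exact: (cvgD fa gb).
Qed.

Lemma has_meanZ (c : C) f a : has_mean f a -> has_mean (fun k => c * f k) (c * a).
Proof.
move=> fa; rewrite /has_mean.
have -> : mean (fun k => c * f k) = (fun T => c * mean f T).
  by apply/funext => T; rewrite /mean -mulr_sumr mulrCA.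
by apply: cvgM fa; exact: cvg_cst.
Qed.

Lemma has_mean_cst (c : C) : has_mean (fun=> c) c.
Proof.
apply/cvg_normcP => e e0; near=> T.
have T0 : (T%:R : C) != 0 by rewrite pnatr_eq0 -lt0n; near: T; exact: nbhs_infty_gt.
by rewrite /mean sumr_const card_ord -[c *+ T]mulr_natl mulKf // subrr normc0.
Unshelve. all: by end_near. Qed.

Lemma has_mean_sum (I : eqType) (r : seq I) (f : I -> nat -> C) (l : I -> C) :
  (forall i, i \in r -> has_mean (f i) (l i)) ->
  has_mean (fun k => \sum_(i <- r) f i k) (\sum_(i <- r) l i).
Proof.
elim: r => [_|i r IH fl].
  rewrite big_nil (_ : (fun _ => _) = fun=> 0); first exact: has_mean_cst.
  by apply/funext => k; rewrite big_nil.
rewrite big_cons (_ : (fun _ => _) = fun k => f i k + \sum_(j <- r) f j k).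
  apply: has_meanD; first by apply: fl; rewrite mem_head.
  by apply: IH => j jr; apply: fl; rewrite inE jr orbT.
by apply/funext => k; rewrite big_cons.
Qed.

Lemma eq_has_mean f g a : f =1 g -> has_mean f a -> has_mean g a.
Proof. by move=> /funext ->. Qed.

Lemma has_mean_le (f : nat -> C) (g : nat -> R) (a b K : R) : 0 <= K ->
  (forall k, normc (f k) <= K * g k) ->
  has_mean f a%:C -> has_mean (fun k => (g k)%:C) b%:C -> a <= K * b.
Proof.
move=> K0 fg fa gb; apply/ler_addgt0Pr => e e0.
have K1 : 0 < K + 1 by rewrite ltr_wpDl.
have d0 : 0 < e / 2 / (K + 1) by rewrite !divr_gt0.
have e2 : 0 < e / 2 by rewrite divr_gt0.
move/cvg_normcP : fa => /(_ _ e2) fa; move/cvg_normcP : gb => /(_ _ d0) gb.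
have [T [aT bT]] := filter_ex (filterI fa gb).
have mE (h : nat -> C) : mean h T = (T%:R^-1 : R)%:C * \sum_(k < T) h k.
  by rewrite /mean fmorphV rmorph_nat.
have le1 : normc (mean f T) <= K * complex.Re (mean (fun k => (g k)%:C) T).
  rewrite !mE -rmorph_sum -rmorphM /= normcM normc_real ger0_norm ?invr_ge0 //.
  rewrite mulrCA ler_wpM2l ?invr_ge0 // mulr_sumr.
  by apply: le_trans (normc_sum _ _ _) _; exact: ler_sum.
have h1 : a <= normc (mean f T) + e / 2.
  rewrite (le_trans (ler_norm a)) // -normc_real -(subrK (mean f T) a%:C) addrC.
  by rewrite (le_trans (normcDC _ _)) // lerD2l ltW.
have h2 : complex.Re (mean (fun k => (g k)%:C) T) <= b + e / 2 / (K + 1).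
  have := le_lt_trans (normRe_le _) bT; rewrite ReD ReN /= ltr_norml => /andP[h _].
  by lra.
have h3 := ler_wpM2l K0 h2.
have h4 : K * (e / 2 / (K + 1)) <= e / 2.
  by rewrite mulrA ler_pdivrMr // mulrC ler_wpM2l ?(ltW e2) // lerDl.
lra.
Qed.

(** Averaging against the positive kernel [|Q|^2], where [Q] is the sum of the
monomials of a large box with phases matched to the coefficients, aligns all
terms at once: by unique factorization the correlation of each term with the
kernel is the proportion of the box that multiplication by its prime leaves
inside. *)
Lemma prime_phases_align (p : nat -> nat) (c0 : R) (c : nat -> C) J (eps : R) :
  (forall j, prime (p j)) -> injective p -> 0 <= c0 -> 0 < eps ->
  exists t : R, c0 + \sum_(j < J) normc (c j) - eps <=
    normc (c0%:C + \sum_(j < J) c j * freq (p j) t).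
Proof.
move=> p_prime p_inj c00 eps0; set S := \sum_(j < J) normc (c j).
pose G t := c0%:C + \sum_(j < J) c j * freq (p j) t.
have S0 : 0 <= S by apply: sumr_ge0 => j _; exact: normc_ge0.
apply: contrapT => /forallNP H.
have {H} GL t : normc (G t) <= c0 + S - eps by apply/ltW; rewrite ltNge; apply/negP/H.
set L := c0 + S - eps in GL.
have L0 : 0 <= L by apply: le_trans (normc_ge0 _) (GL 0).
pose q := Num.truncn (S / eps); have qS : S < eps * q.+1%:R.
  by rewrite mulrC -ltr_pdivrMr //; exact: truncnS_gt.
pose F := box p q J.
have p0 j : (0 < p j)%N by exact: prime_gt0.
have F0 n : n \in F -> (0 < n)%N by case/(logn_box p_prime p_inj).
pose B := (\sum_(n <- F) n * (\sum_(j < J) p j).+1)%N.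
have FB n : n \in F -> (n * (\sum_(j < J) p j).+1 <= B)%N.
  by move=> nF; rewrite /B (big_rem n) //= leq_addr.
have [delta dP] := @freq_separated B.
pose E n m (k : nat) := freq n (k%:R * delta) * (freq m (k%:R * delta))^*%C.
have EM n m : (0 < n <= B)%N -> (0 < m <= B)%N -> has_mean (E n m) (n == m)%:R.
  move=> nB mB; have [<-|nm] := eqVneq n m.
    apply: (@eq_has_mean (fun=> 1)); last exact: has_mean_cst.
    by move=> k; rewrite /E mulc_conj normc_freq expr1n.
  apply: (@eq_has_mean (fun k => (freq n delta * (freq m delta)^*%C) ^+ k)).
    by move=> k; rewrite /E !freq_muln exprMn -rmorphXn.
  by apply: cvg_mean_geometric (dP _ _ nB mB nm); rewrite normcM normc_conj !normc_freq mulr1.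
have nB n : n \in F -> (0 < n <= B)%N.
  by move=> nF; rewrite F0 //= (leq_trans _ (FB _ nF)) // leq_pmulr.
have pnB (j : 'I_J) n : n \in F -> (0 < p j * n <= B)%N.
  move=> nF; rewrite muln_gt0 p0 F0 //= (leq_trans _ (FB _ nF)) // mulnC leq_mul2l.
  by apply/orP; right; rewrite (bigD1 j) //= leqW // leq_addr.
pose th j := if c j == 0 then 1 else ((normc (c j))^-1)%:C * c j.
have nc j : c j != 0 -> normc (c j) != 0 by apply: contra_neq => /eq0_normc.
have th1 j : normc (th j) = 1.
  rewrite /th; case: eqVneq => [_|/nc cj]; first exact: normc1.
  by rewrite normcM normc_real ger0_norm ?invr_ge0 ?normc_ge0 // mulVf.
have cth j : c j * (th j)^*%C = (normc (c j))%:C.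
  rewrite /th; case: eqVneq => [->|/nc cj]; first by rewrite mul0r normc0.
  rewrite conjc_scale mulrCA mulc_conj -rmorphM /= expr2 mulKf //.
(* By complete multiplicativity [u] picks up exactly the phase [th j] when its
argument is multiplied by [p j]. *)
pose u n := \prod_(j < J) th j ^+ logn (p j) n.
have u1 n : normc (u n) = 1.
  by rewrite normc_prod big1 // => j _; rewrite normcX th1 expr1n.
have up (j : 'I_J) n : (0 < n)%N -> u (p j * n)%N = th j * u n.
  move=> n0; rewrite /u; under eq_bigr do rewrite lognM // exprD.
  rewrite big_split /=; congr (_ * _).
  rewrite (bigD1 j) //= logn_p // eqxx big1 ?mulr1 // => i ij.
  by rewrite logn_p // (inj_eq val_inj) (negbTE ij).
pose Q t := \sum_(n <- F) u n * freq n t.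
have QQ t : (normc (Q t) ^+ 2)%:C = \sum_(n <- F) \sum_(m <- F)
    (u n * (u m)^*%C) * (freq n t * (freq m t)^*%C).
  rewrite -mulc_conj {2}/Q rmorph_sum /= mulr_suml; apply: eq_bigr => n _.
  rewrite mulr_sumr; apply: eq_bigr => m _.
  by rewrite (conjcM (u m) (freq m t)) mulrACA.
have GQ t : G t * (normc (Q t) ^+ 2)%:C = \sum_(n <- F) \sum_(m <- F)
    (u n * (u m)^*%C) * (c0%:C * (freq n t * (freq m t)^*%C) +
      \sum_(j < J) c j * (freq (p j * n) t * (freq m t)^*%C)).
  rewrite QQ mulr_sumr big_seq [RHS]big_seq; apply: eq_bigr => n nF.
  rewrite mulr_sumr; apply: eq_bigr => m _.
  rewrite /G mulrDl mulrDr mulrCA; congr (_ + _).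
  rewrite mulr_suml mulr_sumr; apply: eq_bigr => j _.
  rewrite (freqM _ (p0 j) (F0 n nF)).
  move: (freq (p j) t) (freq n t) (freq m t)^*%C (u m)^*%C (u n) (c j) => *.
  by ring.
have MQ : has_mean (fun k => (normc (Q (k%:R * delta)) ^+ 2)%:C) ((size F)%:R)%:C.
  apply: (eq_has_mean (fun k => esym (QQ (k%:R * delta)))).
  have -> : ((size F)%:R : R)%:C = \sum_(n <- F) \sum_(m <- F)
      (u n * (u m)^*%C) * (n == m)%:R.
    rewrite rmorph_nat -sum1_size natr_sum big_seq [RHS]big_seq; apply: eq_bigr => n nF.
    rewrite (bigD1_seq n) ?box_uniq //= eqxx mulr1 mulc_conj u1 expr1n.
    by rewrite big1 ?addr0 // => m /negbTE; rewrite eq_sym => ->; rewrite mulr0.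
  apply: has_mean_sum => n nF; apply: has_mean_sum => m mF.
  by apply/has_meanZ/EM; exact: nB.
pose bad (j : nat) := (\sum_(n <- F) (p j * n \notin F))%N.
pose A : R := c0 * (size F)%:R + \sum_(j < J) normc (c j) * ((size F)%:R - (bad j)%:R).
have MG : has_mean (fun k => G (k%:R * delta) * (normc (Q (k%:R * delta)) ^+ 2)%:C) A%:C.
  apply: (eq_has_mean (fun k => esym (GQ (k%:R * delta)))).
  have -> : A%:C = \sum_(n <- F) \sum_(m <- F) (u n * (u m)^*%C) *
      (c0%:C * (n == m)%:R + \sum_(j < J) c j * (p j * n == m)%N%:R).
    transitivity (\sum_(n <- F) (c0 + \sum_(j < J) normc (c j) *
        (p j * n \in F)%N%:R)%:C).
      rewrite -rmorph_sum; congr (_%:C); rewrite /A big_split /= exchange_big /=.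
      congr (_ + _); first by rewrite big_const_seq count_predT iter_addr_0 mulr_natr.
      apply: eq_bigr => j _; rewrite -mulr_sumr; congr (_ * _).
      rewrite /bad -natr_sum -sum1_size natr_sum natr_sum -sumrB natr_sum.
      by apply: eq_bigr => n _; case: (_ \in F); rewrite ?subr0 ?subrr.
    symmetry; rewrite big_seq [RHS]big_seq; apply: eq_bigr => n nF.
    under [LHS]eq_bigr do rewrite mulrDr mulr_sumr mulrA.
    rewrite big_split /= sum_indicator ?box_uniq // nF exchange_big rmorphD.
    rewrite mulc_conj u1 expr1n mul1r; congr (_ + _).
    rewrite rmorph_sum; apply: eq_bigr => j _ /=.
    under [LHS]eq_bigr do rewrite mulrA.
    rewrite sum_indicator ?box_uniq //; case: ifP => jF; last by rewrite mulr0.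
    rewrite up ?F0 // (conjcM (th j)) mulr1 -cth.
    by rewrite [u n * (_ * _)]mulrCA mulc_conj u1 expr1n mulr1 mulrC.
  apply: has_mean_sum => n nF; apply: has_mean_sum => m mF.
  apply/has_meanZ/has_meanD; first by apply/has_meanZ/EM; exact: nB.
  apply: has_mean_sum => j _; apply/has_meanZ/EM; [exact: pnB|exact: nB].
have : A <= L * (size F)%:R.
  apply: has_mean_le MG MQ => // k.
  by rewrite normcM normc_real ger0_norm ?sqr_ge0 // ler_wpM2r ?sqr_ge0.
rewrite leNgt => /negP; apply.
have sF : 0 < (size F)%:R :> R by rewrite ltr0n size_box expn_gt0.
rewrite /L /A.
have q0 : 0 < q.+1%:R :> R by rewrite ltr0n.
apply: (@lt_le_trans _ _ (c0 * (size F)%:R + \sum_(j < J) normc (c j) *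
    ((size F)%:R - (size F)%:R / q.+1%:R))); last first.
  rewrite lerD2l; apply: ler_sum => j _; rewrite ler_wpM2l ?normc_ge0 // lerD2l lerN2.
  rewrite ler_pdivlMr // mulrC -natrM ler_nat.
  exact: box_boundary.
rewrite -mulr_suml -/S -addrA mulrDl ltrD2l mulrBl mulrBr ltrD2l ltrN2.
by rewrite mulrA mulrAC ltr_pM2r // ltr_pdivrMr.
Qed.

End Kronecker.

(** * Dirichlet series indexed by positive integers *)

Section DirichletSeriesTools.
Context {R : realType}.
Local Notation C := R[i].
Implicit Types (a b c : nat -> C) (s : C) (P Q : C -> C).

(** Terms indexed by the integer itself rather than by its predecessor, so that
multiplicative structure is visible; the term of index 0 is spurious. *)
Definition nterm c s : nat -> C := fun n => c n * dpow n s.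

Lemma dterm_shift c s : dterm (fun n => c n.+1) s = fun n => nterm c s n.+1.
Proof. by []. Qed.

Lemma sum_shift (V : nmodType) (u : nat -> V) m : u 0%N = 0 ->
  \sum_(n < m) u n.+1 = \sum_(n < m.+1) u n.
Proof. by move=> u0; rewrite big_ord_recl u0 add0r. Qed.

Lemma nterm0 c s : c 0%N = 0 -> nterm c s 0 = 0.
Proof. by rewrite /nterm => ->; rewrite mul0r. Qed.

Lemma abs_summable_shift c s : c 0%N = 0 ->
  abs_summable (nterm c s) -> abs_summable (dterm (fun n => c n.+1) s).
Proof.
move=> c0 sc; rewrite dterm_shift.
apply: (@abs_summable_bounded _ _ (limn (series (fun n => normc (nterm c s n))))) => m.
rewrite (sum_shift (u := fun n => normc (nterm c s n))) ?nterm0 ?normc0 //.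
by apply: sum_le_limn => // k; exact: normc_ge0.
Qed.

Lemma cvg_shift c s : c 0%N = 0 -> abs_summable (nterm c s) ->
  series (dterm (fun n => c n.+1) s) @ \oo --> csum (nterm c s).
Proof.
move=> c0 sc; have -> : series (dterm (fun n => c n.+1) s) =
    (fun m => series (nterm c s) (m + 1)%N).
  apply/funext => m; rewrite dterm_shift /series /= addn1 !big_mkord.
  by rewrite (sum_shift (u := nterm c s)) ?nterm0.
by rewrite (cvg_shiftn 1 (series (nterm c s))); exact: csum_cvg.
Qed.

Lemma csum_subseq (u : nat -> C) (f : nat -> nat) (l : C) : abs_summable u ->
  (forall m, (m <= f m)%N) -> (fun m => \sum_(n < f m) u n) @ \oo --> l ->
  csum u = l.
Proof.
move=> su ff ul; apply: cvg_unique ul => //.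
apply/cvg_normcP => e e0.
have /cvg_normcP/(_ e e0)[K _ KP] := csum_cvg su.
exists K => // m /= Km; have /= := KP (f m) (leq_trans Km (ff m)).
by rewrite /series /= big_mkord.
Qed.

Lemma finite_summable (u : nat -> C) m : (forall n, (m <= n)%N -> u n = 0) ->
  abs_summable u /\ csum u = \sum_(n < m) u n.
Proof.
move=> um; have sE (V : nmodType) (f : C -> V) k : f 0 = 0 ->
    \sum_(n < (m + k)%N) f (u n) = \sum_(n < m) f (u n).
  move=> f0; rewrite big_split_ord /= [X in _ + X]big1 ?addr0 // => i _.
  by rewrite um ?leq_addr.
have su : abs_summable u.
  apply: (@abs_summable_bounded _ _ (\sum_(n < m) normc (u n))) => k.
  rewrite -(sE _ (@normc R) k) ?normc0 // addnC big_split_ord /= lerDl.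
  by apply: sumr_ge0 => i _; exact: normc_ge0.
split=> //; apply: (@csum_subseq _ (fun k => m + k)%N) => // [k|].
  exact: leq_addl.
rewrite (_ : (fun _ => _) = fun=> \sum_(n < m) u n); first exact: cvg_cst.
by apply/funext => k; exact: (sE _ id).
Qed.

Lemma nterm_mconv a b s : a 0%N = 0 -> b 0%N = 0 ->
  nterm (mconv a b) s = mconv (nterm a s) (nterm b s).
Proof.
move=> a0 b0; apply/funext => N; rewrite /nterm /mconv mulr_suml.
apply: eq_bigr => d _; rewrite mulr_suml; apply: eq_bigr => e _.
case: eqP => [E|_]; last by rewrite mul0r.
have -> : dpow N s = dpow (d * e) s by rewrite E.
have [->|d0] := posnP d; first by rewrite a0 !mul0r.
have [->|e0] := posnP e; first by rewrite b0 mulr0 !mul0r mulr0.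
by rewrite dpowM // mulrACA.
Qed.

Lemma mconv0 a b : a 0%N = 0 -> mconv a b 0 = 0.
Proof.
by move=> a0; rewrite /mconv big_ord_recl big_ord0 big_ord_recl big_ord0 /= a0 mul0r !addr0.
Qed.

Lemma nterm_mconv_sum a b s : a 0%N = 0 -> b 0%N = 0 ->
  abs_summable (nterm a s) -> abs_summable (nterm b s) ->
  abs_summable (nterm (mconv a b) s) /\
  csum (nterm (mconv a b) s) = csum (nterm a s) * csum (nterm b s).
Proof.
move=> a0 b0 sa sb; rewrite nterm_mconv //.
by split; [apply: mconv_abs_summable|apply: csum_mconv]; rewrite ?nterm0.
Qed.

Lemma mconv_single a b d0 e0 : (0 < d0)%N -> (0 < e0)%N ->
  (forall d e, (d * e = d0 * e0)%N -> a d != 0 -> d = d0) ->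
  mconv a b (d0 * e0) = a d0 * b e0.
Proof.
move=> d00 e00 H; set N := (d0 * e0)%N.
have dN : (d0 < N.+1)%N by rewrite ltnS leq_pmulr.
have eN : (e0 < N.+1)%N by rewrite ltnS leq_pmull.
rewrite /mconv (bigD1 (Ordinal dN)) //= [X in _ + X]big1 ?addr0 => [|d /eqP dd].
  rewrite (bigD1 (Ordinal eN)) //= eqxx big1 ?addr0 // => e /eqP ee.
  case: eqP => // /eqP; rewrite eqn_pmul2l // => /eqP E.
  by case: ee; apply: val_inj.
apply: big1 => e _; case: eqP => // E; have [->|ad] := eqVneq (a d) 0.
  by rewrite mul0r.
by case: dd; apply: val_inj; exact: (H _ _ E ad).
Qed.

Lemma dpoly_cst_dpow (c : C) n : (0 < n)%N ->
  dirichlet_polynomial (fun s => c * dpow n s).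
Proof.
case: n => // n _; exists (fun m => if m == n then c else 0), n.+1 => s.
rewrite big_ord_recr /= /dterm eqxx big1 ?add0r // => i _.
by rewrite ltn_eqF ?ltn_ord // mul0r.
Qed.

Lemma dpoly_add P Q : dirichlet_polynomial P -> dirichlet_polynomial Q ->
  dirichlet_polynomial (fun s => P s + Q s).
Proof.
move=> dP dQ; have := dirichlet_polynomial_lin 1 dP dQ.
by rewrite scale1r.
Qed.

Lemma dpoly_sum (I : Type) (r : seq I) (F : I -> C -> C) :
  (forall i, dirichlet_polynomial (F i)) ->
  dirichlet_polynomial (fun s => \sum_(i <- r) F i s).
Proof.
move=> dF; elim: r => [|i r IH].
  by exists (fun=> 0), 0%N => s; rewrite big_nil big_ord0.
rewrite (_ : (fun _ => _) = fun s => F i s + \sum_(j <- r) F j s).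
  exact: dpoly_add.
by apply/funext => s; rewrite big_cons.
Qed.

Lemma dpoly_mul P Q : dirichlet_polynomial P -> dirichlet_polynomial Q ->
  dirichlet_polynomial (fun s => P s * Q s).
Proof.
move=> [a [n aP]] [b [m bQ]].
rewrite (_ : (fun _ => _) = fun s => \sum_(i <- enum 'I_n) \sum_(j <- enum 'I_m)
    (a i * b j) * dpow (i.+1 * j.+1) s).
  by apply: dpoly_sum => i; apply: dpoly_sum => j; exact: dpoly_cst_dpow.
apply/funext => s; rewrite aP bQ mulr_suml big_enum; apply: eq_bigr => i _ /=.
rewrite mulr_sumr big_enum; apply: eq_bigr => j _ /=.
by rewrite dpowM // /dterm mulrACA.
Qed.

Lemma dpoly_cst (c : C) : dirichlet_polynomial (fun=> c).
Proof.
rewrite (_ : (fun=> c) = fun s => c * dpow 1 s); first exact: dpoly_cst_dpow.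
by apply/funext => s; rewrite dpow1 mulr1.
Qed.

(** With [y = x - 1], the terms [n ^ - x] are dominated by the telescoping
differences of [n ^ - y / y]. *)
Lemma rpow_series_bounded (x : R) : 1 < x ->
  exists K, forall m, \sum_(n < m) rpow n.+1 x <= K.
Proof.
move=> x1; pose y := x - 1; have y0 : 0 < y by rewrite subr_gt0.
have rpow1 z : rpow 1 z = 1 :> R by rewrite /rpow ln1 mulr0 oppr0 expR0.
have step n : rpow n.+2 x <= y^-1 * (rpow n.+1 y - rpow n.+2 y).
  have N0 : 0 < n.+2%:R :> R by rewrite ltr0n.
  have lnS : ln n.+1%:R <= ln n.+2%:R - n.+2%:R^-1 :> R.
    rewrite -lerBlDl -ln_div ?posrE ?ltr0n //.
    have -> : n.+1%:R / n.+2%:R = 1 + - n.+2%:R^-1 :> R.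
      by rewrite -[n.+1%:R](addrK 1) natr1 mulrBl divff ?gt_eqF // mul1r.
    by apply: le_ln1Dx; rewrite ltrN2 invf_lt1 // ltr1n.
  have -> : rpow n.+2 x = rpow n.+2 y / n.+2%:R.
    have -> : n.+2%:R^-1 = expR (- ln n.+2%:R) :> R by rewrite expRN lnK ?posrE.
    by rewrite /rpow -expRD; congr expR; rewrite /y; ring.
  rewrite ler_pdivlMl // lerBrDr.
  apply: (@le_trans _ _ (rpow n.+2 y * expR (y / n.+2%:R))).
    have := ler_wpM2l (ltW (rpow_gt0 n.+2 y)) (expR_ge1Dx (y / n.+2%:R)).
    by rewrite mulrDr mulr1 addrC mulrCA.
  rewrite /rpow -expRD ler_expR; have := ler_wpM2l (ltW y0) lnS.
  by rewrite mulrBr; move: (y * _) (y * _) (y / _) => *; lra.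
exists (1 + y^-1) => m; apply: (@le_trans _ _ (\sum_(n < m.+1) rpow n.+1 x)).
  by rewrite big_ord_recr /= lerDl ltW // rpow_gt0.
apply: (@le_trans _ _ (1 + y^-1 * (1 - rpow m.+1 y))).
  elim: m => [|m IH]; first by rewrite big_ord_recl big_ord0 /= !rpow1 subrr mulr0.
  rewrite big_ord_recr /=; apply: le_trans (lerD IH (step m)) _.
  by rewrite -addrA -mulrDr; lra.
by rewrite lerD2l ler_piMr ?invr_ge0 ?(ltW y0) // lerBlDr lerDl ltW // rpow_gt0.
Qed.

End DirichletSeriesTools.

(** * The series over the reserved primes *)

Section LinearPart.
Context {R : realType}.
Local Notation C := R[i].
Implicit Types (x y : ell1 R) (s h : C).

(** The primes of positive even index. The blocks use odd indices only, and the
prime 2, of index 0, serves to build a peak function. *)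
Definition reserved k := nth_prime k.+1.*2.

Lemma reserved_prime k : prime (reserved k).
Proof. exact: prime_nth_prime. Qed.

Lemma reserved_inj : injective reserved.
Proof. by move=> i j /nth_prime_inj /double_inj []. Qed.

Lemma reserved_mono i j : (i < j)%N -> (reserved i < reserved j)%N.
Proof. by move=> ij; rewrite ltn_nth_prime ltn_double ltnS. Qed.

Lemma reserved_gt k : (k < reserved k)%N.
Proof. by apply: leq_trans (ltnW (nth_prime_gt _)); rewrite ltnS; lia. Qed.

Definition phi (x : nat -> C) s : C := csum (fun k => x k * dpow (reserved k) s).

Let ell1S x : abs_summable x := @ell1_summable R x.

Definition ell1_sum x : R := limn (series (fun k => normc (x k))).

Lemma phi_term_le x k s : 0 <= complex.Re s ->
  normc (x k * dpow (reserved k) s) <= normc (x k).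
Proof. by move=> s0; rewrite normcM ler_piMr ?normc_ge0 // normc_dpow_le1. Qed.

Lemma phi_summable x s : 0 <= complex.Re s ->
  abs_summable (fun k => x k * dpow (reserved k) s).
Proof.
move=> s0; apply: (abs_summable_le (fun k => phi_term_le x k s0)).
exact: (@ell1S x).
Qed.

Lemma normc_phi_le x s : 0 <= complex.Re s -> normc (phi x s) <= ell1_sum x.
Proof.
by move=> s0; apply: normc_csum_le => [k|]; [exact: phi_term_le|exact: (@ell1S x)].
Qed.

Lemma phi_tail x m s : 0 <= complex.Re s ->
  normc (phi x s - \sum_(k < m) x k * dpow (reserved k) s)
  <= ell1_sum x - \sum_(k < m) normc (x k).
Proof.
move=> s0; have := normc_csum_tail m (fun k => phi_term_le x k s0) (@ell1S x).
by rewrite /series /= !big_mkord.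
Qed.

Lemma ell1_sum_cvg x e : 0 < e -> exists m0, forall m, (m0 <= m)%N ->
  ell1_sum x - \sum_(k < m) normc (x k) < e.
Proof.
move=> e0; have /cvgrPdist_lt/(_ e e0)[m0 _ H] := @ell1S x.
exists m0 => m /H /=; rewrite /series /= big_mkord.
exact: le_lt_trans (ler_norm _).
Qed.

Lemma phi_lin (k : C) x y s : 0 <= complex.Re s ->
  phi (k *: x + y) s = k * phi x s + phi y s.
Proof.
move=> s0; rewrite /phi -csumZ; last exact: phi_summable.
rewrite -csumD; last exact: phi_summable.
  congr csum; apply/funext => n.
  by rewrite -[RHS]/(k * (x n * _) + y n * _) mulrA -mulrDl.
apply: (@abs_summable_le _ _ (fun n => normc k * normc (x n))) => [n|].
  by rewrite normcM ler_wpM2l ?normc_ge0 // phi_term_le.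
by apply: is_cvg_seriesZ; exact: (@ell1S x).
Qed.

Lemma mul_expRN_le (l d : R) : 0 <= l -> 0 < d -> l * expR (- (d * l)) <= d^-1.
Proof.
move=> l0 d0; rewrite expRN ler_pdivrMr ?expR_gt0 // mulrC ler_pdivlMr // mulrC.
by apply: le_trans (expR_ge1Dx _); rewrite lerDr.
Qed.

Lemma sqr_mul_expRN_le (l d : R) : 0 <= l -> 0 < d ->
  l ^+ 2 * expR (- (d * l)) <= 2 / d ^+ 2.
Proof.
move=> l0 d0; have dl0 : 0 <= d * l by rewrite mulr_ge0 // ltW.
rewrite expRN ler_pdivrMr ?expR_gt0 // mulrAC ler_pdivlMr ?exprn_gt0 //.
have := expR_ge1Dxn 1 dl0; rewrite (_ : 2`! = 2%N) // exprMn.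
by move: (_ ^+ 2) (_ ^+ 2) (expR _) => u v t; lra.
Qed.

(** Differentiating brings out logarithms of unbounded frequencies; half of the
real part of [s] is spent on the decay that compensates them. *)
Lemma cdiff_phi x s : 0 < complex.Re s -> cdiff (phi x) s.
Proof.
move=> s0; pose d := complex.Re s; pose e := d / 2.
have e0 : 0 < e by rewrite divr_gt0.
pose K := 1 + d^-1 + 14 / e ^+ 2.
have K1 : 1 <= K by rewrite /K -addrA lerDl addr_ge0 ?invr_ge0 ?divr_ge0 ?exprn_ge0 ?ltW.
have Kd : d^-1 <= K.
  by rewrite /K addrAC lerDr addr_ge0 // divr_ge0 // exprn_ge0 // ltW.
have Ke : 14 / e ^+ 2 <= K by rewrite /K lerDr addr_ge0 // invr_ge0 ltW.
pose l k : R := ln (reserved k)%:R; have l0 k : 0 <= l k by exact: lnn_ge0.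
apply: (@cdiff_csum _ (fun k s => x k * dpow (reserved k) s)
  (fun k => - (x k * ((l k)%:C * dpow (reserved k) s)))
  (fun k => K * normc (x k)) e).
- exact: e0.
- by apply: is_cvg_seriesZ; exact: (@ell1S x).
- move=> k; rewrite normcNC (normcM (x k)) (normcM (l k)%:C) normc_real ger0_norm // mulrC normc_dpow.
  rewrite ler_wpM2r ?normc_ge0 //; apply: le_trans Kd.
  exact: mul_expRN_le.
- move=> k h he; have nx := normc_ge0 (x k); split.
    apply: le_trans (phi_term_le _ _ _) _; last by rewrite ler_peMl.
    by apply/ltW/Re_add_gt0 => //; apply: lt_trans he _; rewrite /e /d; lra.
  pose s' : C := s - e%:C.
  have Res' : complex.Re s' = e by rewrite /s' ReD ReN /= /e /d; lra.
  have s'0 : 0 <= complex.Re s' by rewrite Res' ltW.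
  have s'h : 0 <= complex.Re (s' + h) by apply/ltW/Re_add_gt0; rewrite Res'.
  have -> : x k * dpow (reserved k) (s + h) - x k * dpow (reserved k) s -
      h * - (x k * ((l k)%:C * dpow (reserved k) s)) =
      x k * (dpow (reserved k) e%:C * (dpow (reserved k) (s' + h) -
        dpow (reserved k) s' + h * ((l k)%:C * dpow (reserved k) s'))).
    have -> : s = e%:C + s' by rewrite /s' addrC subrK.
    by rewrite -addrA !dpowD; ring.
  rewrite (normcM (x k)) (normcM (dpow _ _)) [K * _]mulrC -mulrA ler_wpM2l //.
  apply: (@le_trans _ _ (rpow (reserved k) e * (7 * l k ^+ 2 * normc h ^+ 2))).
    rewrite normc_dpow ler_wpM2l ?(ltW (rpow_gt0 _ _)) //.
    exact: normc_dpow_jet_le.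
  have -> : rpow (reserved k) e * (7 * l k ^+ 2 * normc h ^+ 2) =
     (7 * (l k ^+ 2 * expR (- (e * l k)))) * normc h ^+ 2 by rewrite /rpow -/(l k); ring.
  rewrite ler_wpM2r ?sqr_ge0 //; apply: le_trans Ke.
  by have := sqr_mul_expRN_le (l0 k) e0; lra.
Qed.

(** Since [k < reserved k], the sum over [k < N] finds the index of [N] among
the reserved primes, if there is one. *)
Definition phi_coef (x : nat -> C) (N : nat) : C :=
  \sum_(k < N) if reserved k == N then x k else 0.

Lemma phi_coef_reserved x k : phi_coef x (reserved k) = x k.
Proof.
rewrite /phi_coef (bigD1 (Ordinal (reserved_gt k))) //= eqxx big1 ?addr0 // => i /eqP ik.
by case: eqP => // /reserved_inj E; case: ik; apply: val_inj.
Qed.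

Lemma phi_coef_eq0 x N : phi_coef x N != 0 -> exists k, N = reserved k.
Proof.
move=> H; apply/not_existsP => N1; move: H; rewrite /phi_coef big1 ?eqxx // => k _.
by case: eqP => // E; case: (N1 k).
Qed.

Lemma sum_phi_coef (V : nmodType) (F : C -> nat -> V) x m :
  (forall N, F 0 N = 0) ->
  \sum_(N < reserved m) F (phi_coef x N) N = \sum_(k < m) F (x k) (reserved k).
Proof.
move=> F0; rewrite -(big_mkord xpredT (fun N => F (phi_coef x N) N)).
elim: m => [|m IH].
  rewrite big_ord0 big1_seq // => N /andP[_]; rewrite mem_index_iota => /= N0.
  have [->//|/phi_coef_eq0[k E]] := eqVneq (phi_coef x N) 0.
  by move: N0; rewrite E ltn_nth_prime ltn_double.
have mm : (reserved m <= reserved m.+1)%N by rewrite ltnW // reserved_mono.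
rewrite (big_cat_nat _ mm) //= IH big_ord_recr /=; congr (_ + _).
rewrite big_ltn ?reserved_mono // phi_coef_reserved big1_seq ?addr0 // => N /andP[_].
rewrite mem_index_iota => /andP[mN Nm].
have [->//|/phi_coef_eq0[k E]] := eqVneq (phi_coef x N) 0.
move: mN Nm; rewrite E !ltn_nth_prime !ltn_double !ltnS => mk km.
by have := leq_trans mk km; rewrite ltnn.
Qed.

Lemma phi_coef_sum x s : 0 <= complex.Re s ->
  abs_summable (nterm (phi_coef x) s) /\ csum (nterm (phi_coef x) s) = phi x s.
Proof.
move=> s0; have su : abs_summable (nterm (phi_coef x) s).
  apply: (@abs_summable_bounded _ _ (ell1_sum x)) => m.
  apply: (@le_trans _ _ (\sum_(N < reserved m) normc (nterm (phi_coef x) s N))).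
    rewrite -!(big_mkord xpredT (fun N => normc (nterm (phi_coef x) s N))).
    rewrite [leRHS](big_cat_nat _ (ltnW (reserved_gt m))) //= lerDl.
    by apply: sumr_ge0 => i _; exact: normc_ge0.
  rewrite (@sum_phi_coef _ (fun c N => normc (c * dpow N s))); last first.
    by move=> N; rewrite mul0r normc0.
  apply: (@le_trans _ _ (\sum_(k < m) normc (x k))).
    by apply: ler_sum => k _; exact: phi_term_le.
  by apply: sum_le_limn (@ell1S x) => k; exact: normc_ge0.
split=> //; apply: (@csum_subseq _ _ reserved) => //.
  by move=> m; exact/ltnW/reserved_gt.
rewrite (_ : (fun _ => _) = series (fun k => x k * dpow (reserved k) s)).
  by apply: csum_cvg; exact: phi_summable.
apply/funext => m; rewrite (@sum_phi_coef _ (fun c N => c * dpow N s)).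
  by rewrite /series /= big_mkord.
by move=> N; rewrite mul0r.
Qed.

End LinearPart.

(** * The isometric copy of absolutely summable sequences *)

Section Embedding.
Context {R : realType}.
Local Notation C := R[i].
Variables (a : nat -> R) (w : C -> C) (X : nat -> nat).
Hypothesis a_supp : forall N, a N != 0 ->
  (1 < N)%N /\ forall k, ~~ (nth_prime k.*2 %| N)%N.
Hypothesis a_sqr : forall m, \sum_(N < m) a N ^+ 2 <= 1.
Hypothesis a_div : forall sigma : R, sigma < 2^-1 ->
  forall K, exists m, K <= \sum_(N < m) `|a N| * rpow N sigma.
Hypothesis w_core : forall s, 0 < complex.Re s -> normc (w s) <= 1 /\ cdiff w s.
Hypothesis geX : forall m, (m <= X m)%N.
Hypothesis w_approx : forall m s, 0 < complex.Re s ->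
  normc (w s - \sum_(N < X m) (a N)%:C * dpow N s) <= 2^-1 ^+ m.
Implicit Types (x y : ell1 R) (s h : C).

(** The function [(1 + z) / 2] peaks at [z = 1], and by the parallelogram
identity [1 - |1 + z| / 2] dominates [|1 - z|^2 / 8] on the unit disc. Hence a
perturbation [v] of modulus at most 1 fits under the peak when multiplied by
[(1 - z)^2 / 8]. *)
Definition multiplier (v z : C) : C := 2^-1 * (1 + z) + 8^-1 * (1 - z) ^+ 2 * v.

Definition peak s : C := multiplier (w s) (dpow 2 s).

Lemma normc_half (n : nat) : normc (n.+1%:R^-1 : C) = n.+1%:R^-1.
Proof. by rewrite normcV -(rmorph_nat (real_complex R)) normc_real ger0_norm. Qed.

Lemma multiplier_weight_le (z : C) : normc z <= 1 ->
  2^-1 * normc (1 + z) + 8^-1 * normc (1 - z) ^+ 2 <= 1.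
Proof.
move=> z1; have := sqr_normc_parallelogram 1 z; rewrite normc1.
have := normc_ge0 (1 + z); have := normc_ge0 z.
have := sqr_ge0 (normc (1 + z) - 2).
move: (normc (1 + z)) (normc (1 - z)) (normc z) z1 => A B c c1 h1 c0 A0 h2.
by nra.
Qed.

Lemma normc_multiplier_le (v z : C) : normc z <= 1 -> normc v <= 1 ->
  normc (multiplier v z) <= 1.
Proof.
move=> z1 v1; apply: le_trans (multiplier_weight_le z1).
apply: le_trans (normcDC _ _) _; rewrite (normcM 2^-1) (normcM (_ * _)) (normcM 8^-1) !normc_half normcX.
by rewrite lerD2l ler_piMr // mulr_ge0 ?invr_ge0 // sqr_ge0.
Qed.

Lemma normc_multiplier_ge (v z : C) (e : R) : normc z <= 1 -> normc v <= 1 ->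
  2 - e <= normc (1 + z) -> 1 - e <= normc (multiplier v z).
Proof.
move=> z1 v1 ez; have := multiplier_weight_le z1.
have H : 2^-1 * normc (1 + z) <= normc (multiplier v z) + 8^-1 * normc (1 - z) ^+ 2.
  have -> : 2^-1 * normc (1 + z) = normc (multiplier v z - 8^-1 * (1 - z) ^+ 2 * v).
    by rewrite /multiplier addrK normcM normc_half.
  apply: le_trans (normcBC _ _) _; rewrite lerD2l (normcM (_ * _)) (normcM 8^-1) normc_half normcX.
  by rewrite ler_piMr // mulr_ge0 ?invr_ge0 // sqr_ge0.
lra.
Qed.

Lemma normc_peak_le s : 0 < complex.Re s -> normc (peak s) <= 1.
Proof.
move=> s0; apply: normc_multiplier_le; last by have [] := w_core s0.
by rewrite normc_dpow_le1 // ltW.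
Qed.

Lemma cdiff_peak s : 0 < complex.Re s -> cdiff peak s.
Proof.
move=> s0; have cz : cdiff (dpow 2) s by exact: cdiff_dpow.
have cm : cdiff (fun t => 1 - dpow 2 t) s.
  apply: (@cdiff_eq _ (fun t => 1 + (-1) * dpow 2 t) _ _ 1) => //.
    by move=> h _; rewrite mulN1r.
  by apply: cdiffD; [exact: cdiff_cst|apply: cdiffM => //; exact: cdiff_cst].
apply: (cdiffD (f := fun t => 2^-1 * (1 + dpow 2 t))
               (g := fun t => 8^-1 * (1 - dpow 2 t) ^+ 2 * w t)).
  apply: cdiffM; first exact: cdiff_cst.
  by apply: cdiffD => //; exact: cdiff_cst.
apply: cdiffM; last by have [] := w_core s0.
apply: cdiffM; first exact: cdiff_cst.
exact: (cdiffM cm cm).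
Qed.

Definition embed_fun (x : nat -> C) s : C :=
  if 0 < complex.Re s then peak s * phi x s else 0.

Definition core_poly m s : C := \sum_(N < X m) (a N)%:C * dpow N s.

Definition embed_poly x m s : C :=
  multiplier (core_poly m s) (dpow 2 s) * \sum_(k < m) x k * dpow (reserved k) s.

Lemma core_coef0 : a 0%N = 0.
Proof. by apply/eqP; apply/negPn/negP => /a_supp[]. Qed.

Lemma embed_polyP x m : dirichlet_polynomial (embed_poly x m).
Proof.
have d2 : dirichlet_polynomial (fun s : C => 1 - dpow 2 s).
  rewrite (_ : (fun _ => _) = fun s : C => 1 + (-1) * dpow 2 s).
    by apply: dpoly_add; [exact: dpoly_cst|exact: dpoly_cst_dpow].
  by apply/funext => s; rewrite mulN1r.
apply: dpoly_mul.
  apply: (dpoly_add (P := fun s => 2^-1 * (1 + dpow 2 s))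
    (Q := fun s => 8^-1 * (1 - dpow 2 s) ^+ 2 * core_poly m s)).
    apply: dpoly_mul; first exact: dpoly_cst.
    apply: dpoly_add; first exact: dpoly_cst.
    rewrite (_ : dpow 2 = fun s : C => 1 * dpow 2 s); first exact: dpoly_cst_dpow.
    by apply/funext => s; rewrite mul1r.
  apply: dpoly_mul; first by apply: dpoly_mul; [exact: dpoly_cst|exact: (dpoly_mul d2 d2)].
  rewrite (_ : core_poly m = fun s => \sum_(N <- enum 'I_(X m)) (a N)%:C * dpow N s).
    apply: dpoly_sum => N; case: (posnP N) => [->|N0]; last exact: dpoly_cst_dpow.
    rewrite core_coef0 (_ : (fun _ => _) = fun=> 0); first exact: dpoly_cst.
    by apply/funext => s; rewrite mul0r.
  by apply/funext => s; rewrite big_enum.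
rewrite (_ : (fun _ => _) = fun s => \sum_(k <- enum 'I_m) x k * dpow (reserved k) s).
  by apply: dpoly_sum => k; apply: dpoly_cst_dpow; rewrite prime_gt0 ?reserved_prime.
by apply/funext => s; rewrite big_enum.
Qed.

Lemma embed_poly_dist x m s : 0 < complex.Re s ->
  normc (embed_fun x s - embed_poly x m s) <=
  2^-1 ^+ m * ell1_sum x + 2 * (ell1_sum x - \sum_(k < m) normc (x k)).
Proof.
move=> s0; rewrite /embed_fun s0 /embed_poly.
set z := dpow 2 s; set P : C := \sum_(k < m) x k * _.
have z1 : normc z <= 1 by rewrite normc_dpow_le1 // ltW.
have zz : normc (1 - z) ^+ 2 <= 4.
  have : normc (1 - z) <= 2 by apply: le_trans (normcBC _ _) _; rewrite normc1; lra.
  by have := normc_ge0 (1 - z); nra.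
have uW : normc (peak s - multiplier (core_poly m s) z) <= 2^-1 ^+ m.
  have -> : peak s - multiplier (core_poly m s) z =
    8^-1 * (1 - z) ^+ 2 * (w s - core_poly m s) by rewrite /peak /multiplier -/z; ring.
  rewrite (normcM (_ * _)) (normcM 8^-1) normc_half normcX.
  apply: le_trans (w_approx m s0); rewrite ler_piMl ?normc_ge0 //; lra.
have u1 := normc_peak_le s0.
have W2 : normc (multiplier (core_poly m s) z) <= 2.
  rewrite -(subrK (peak s) (multiplier _ _)); apply: le_trans (normcDC _ _) _.
  rewrite normc_distC; have : 2^-1 ^+ m <= 1 :> R by rewrite exprn_ile1 //; lra.
  by lra.
have -> : peak s * phi x s - multiplier (core_poly m s) z * P =
  (peak s - multiplier (core_poly m s) z) * phi x s
  + multiplier (core_poly m s) z * (phi x s - P) by ring.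
apply: le_trans (normcDC _ _) _; rewrite (normcM (_ - _)) (normcM (multiplier _ _)).
apply: lerD; apply: ler_pM; rewrite ?normc_ge0 //.
  by apply: normc_phi_le; exact: ltW.
by apply: phi_tail; exact: ltW.
Qed.

Lemma embed_unif x : {uniform halfplane 0, embed_poly x @ \oo --> embed_fun x}.
Proof.
apply/unif_halfplaneP => e e0.
have S0 : 0 <= ell1_sum x.
  exact: le_trans (normc_ge0 _) (normc_phi_le x (lexx (complex.Re (0 : C)))).
have e4 : 0 < e / 4 by rewrite divr_gt0.
have [m0 m0P] := ell1_sum_cvg x e4.
have /cvgrPdist_lt : (fun m => 2^-1 ^+ m : R) @ \oo --> (0 : R).
  by apply: cvg_expr; rewrite ger0_norm ?invr_ge0 // invf_lt1 // ltr1n.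
have d0 : 0 < e / 2 / (ell1_sum x + 1) by rewrite !divr_gt0 // ltr_wpDl.
move=> /(_ _ d0) => H; near=> m => s s0.
apply: le_lt_trans (embed_poly_dist x m s0) _.
have h1 : ell1_sum x - \sum_(k < m) normc (x k) < e / 4.
  by apply: m0P; near: m; exact: nbhs_infty_ge.
have h2 : 2^-1 ^+ m < e / 2 / (ell1_sum x + 1).
  have : `|0 - 2^-1 ^+ m| < e / 2 / (ell1_sum x + 1) by near: m.
  by rewrite sub0r normrN; apply: le_lt_trans; exact: ler_norm.
have h3 : 2^-1 ^+ m * ell1_sum x <= e / 2.
  apply: (@le_trans _ _ (e / 2 / (ell1_sum x + 1) * ell1_sum x)).
    by rewrite ler_wpM2r // ltW.
  rewrite mulrAC ler_pdivrMr ?ltr_wpDl // ler_wpM2l ?lerDl //.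
  by rewrite divr_ge0 // ltW.
lra.
Unshelve. all: by end_near. Qed.

Definition peak_affine (N : nat) : C :=
  if (N == 1)%N || (N == 2)%N then 2^-1 else 0.
Definition peak_square (N : nat) : C :=
  if (N == 1)%N || (N == 4)%N then 8^-1 else if N == 2%N then - 4^-1 else 0.
Definition peak_coef (N : nat) : C :=
  peak_affine N + mconv peak_square (fun M => (a M)%:C) N.
Definition embed_coef x : nat -> C := mconv (phi_coef x) peak_coef.

Let ac (M : nat) : C := (a M)%:C.
Let ac0 : ac 0 = 0. Proof. by rewrite /ac core_coef0. Qed.

Lemma core_coef_summable s : 2^-1 < complex.Re s ->
  abs_summable (nterm ac s) /\ csum (nterm ac s) = w s.
Proof.
move=> s2; have s0 : 0 < complex.Re s by apply: lt_trans s2; rewrite invr_gt0.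
have [K KP] : exists K, forall m, \sum_(n < m) rpow n.+1 (2 * complex.Re s) <= K.
  by apply: rpow_series_bounded; lra.
have su : abs_summable (nterm ac s).
  apply: (@abs_summable_bounded _ _ (1 + K)) => m.
  apply: (@le_trans _ _ (\sum_(N < m.+1) normc (nterm ac s N))).
    by rewrite [leRHS]big_ord_recr lerDl; exact: normc_ge0.
  apply: (@le_trans _ _ (\sum_(N < m.+1) a N ^+ 2 + \sum_(n < m) rpow n.+1 (2 * complex.Re s))).
    have nE N : normc (nterm ac s N) = `|a N| * rpow N (complex.Re s).
      by rewrite normcM normc_real normc_dpow.
    under eq_bigr do rewrite nE.
    rewrite !big_ord_recl core_coef0 normr0 mul0r expr0n !add0r -big_split.
    apply: ler_sum => n _; rewrite /= -(real_normK (num_real (a _))).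
    have -> : rpow n.+1 (2 * complex.Re s) = rpow n.+1 (complex.Re s) ^+ 2.
      by rewrite /rpow expr2 -expRD; congr expR; ring.
    move: (`|_|) (rpow _ _) (normr_ge0 (a n.+1)) (ltW (rpow_gt0 n.+1 (complex.Re s))) => p q p0 q0.
    by have := sqr_ge0 (p - q); nra.
  exact: lerD.
split=> //; apply: (csum_subseq su geX).
apply/cvg_normcP => e e0.
have /cvgrPdist_lt/(_ e e0) : (fun m => 2^-1 ^+ m : R) @ \oo --> (0 : R).
  by apply: cvg_expr; rewrite ger0_norm ?invr_ge0 // invf_lt1 // ltr1n.
apply: filterS => m; rewrite sub0r normrN => /(le_lt_trans (ler_norm _)).
exact/le_lt_trans/w_approx.
Qed.

Lemma finite_coef_sum (c : nat -> C) s : (forall N, (5 <= N)%N -> c N = 0) ->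
  abs_summable (nterm c s) /\ csum (nterm c s) = \sum_(N < 5) nterm c s N.
Proof. by move=> H; apply: finite_summable => n /H; rewrite /nterm => ->; rewrite mul0r. Qed.

Lemma dpow_2_4 s : dpow 4 s = dpow 2 s ^+ 2.
Proof. by rewrite -(dpowX 2). Qed.

Lemma peak_coef0 : peak_coef 0 = 0.
Proof. by rewrite /peak_coef mconv0 // addr0. Qed.

Lemma peak_coef_sum s : 2^-1 < complex.Re s ->
  abs_summable (nterm peak_coef s) /\ csum (nterm peak_coef s) = peak s.
Proof.
move=> s2; have [sw swE] := core_coef_summable s2.
have [s1 s1E] : abs_summable (nterm peak_affine s) /\
    csum (nterm peak_affine s) = 2^-1 * (1 + dpow 2 s).
  have [|su ->] := @finite_coef_sum peak_affine s; first by case=> [|[|[]]].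
  split=> //; rewrite !big_ord_recl big_ord0 /nterm /peak_affine /= dpow1 !mul0r.
  by ring.
have [s3 s3E] : abs_summable (nterm peak_square s) /\
    csum (nterm peak_square s) = 8^-1 * (1 - dpow 2 s) ^+ 2.
  have [|su ->] := @finite_coef_sum peak_square s; first by case=> [|[|[|[|[]]]]].
  split=> //; rewrite !big_ord_recl big_ord0 /nterm /peak_square /= dpow1 !mul0r.
  by rewrite dpow_2_4; field.
have [s4 s4E] := nterm_mconv_sum (erefl : peak_square 0 = 0) ac0 s3 sw.
have E : nterm peak_coef s = nterm peak_affine s + nterm (mconv peak_square ac) s.
  by apply/funext => N; rewrite /nterm /peak_coef mulrDl.
rewrite E csumD // s1E s4E s3E swE; split=> //.
apply: abs_summable_le (is_cvg_seriesD s1 s4) => n; exact: normcDC.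
Qed.

Lemma embed_coef0 x : embed_coef x 0 = 0.
Proof. by rewrite /embed_coef mconv0 // /phi_coef big_ord0. Qed.

Lemma embed_coef_sum x s : 2^-1 < complex.Re s ->
  abs_summable (nterm (embed_coef x) s) /\
  csum (nterm (embed_coef x) s) = embed_fun x s.
Proof.
move=> s2; have s0 : 0 < complex.Re s by apply: lt_trans s2; rewrite invr_gt0.
have [sp spE] := peak_coef_sum s2; have [sx sxE] := phi_coef_sum x (ltW s0).
have p0 : phi_coef x 0 = 0 by rewrite /phi_coef big_ord0.
have [s4 s4E] := nterm_mconv_sum p0 peak_coef0 sx sp.
by split=> //; rewrite s4E sxE spE /embed_fun s0 mulrC.
Qed.

Lemma embed_represented x :
  (exists2 sigma : R, sigma = 2^-1 & forall s, halfplane sigma s ->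
     series (dterm (fun n => embed_coef x n.+1) s) @ \oo --> embed_fun x s) /\
  forall s, halfplane 2^-1 s -> abs_summable (dterm (fun n => embed_coef x n.+1) s).
Proof.
split; first (exists 2^-1 => //); move=> s /embed_coef_sum -/(_ x)[su suE].
  by rewrite -suE; apply: cvg_shift => //; exact: embed_coef0.
by apply: abs_summable_shift => //; exact: embed_coef0.
Qed.

Lemma peak_coef_core M : a M != 0 -> peak_coef M = 8^-1 * (a M)%:C.
Proof.
move=> aM; have [M1 Mp] := a_supp aM; have M2 : ~~ (2 %| M)%N by exact: (Mp 0%N).
have -> : peak_coef M = mconv peak_square ac M.
  rewrite /peak_coef /peak_affine gtn_eqF //=; case: eqP => [E|]; last by rewrite add0r.
  by rewrite E in M2.
rewrite -{1}(mul1n M) mconv_single ?(ltnW M1) // => d e; rewrite mul1n => E.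
rewrite /peak_square; case: (d =P 1%N) => //= d1.
have even k : (2 %| k)%N -> d <> k.
  by move=> k2 dk; case/negP: M2; rewrite -E dk dvdn_mulr.
have [E4|_] := eqVneq d 4%N; first by case: (even 4%N isT E4).
by have [E2|_] := eqVneq d 2%N; [case: (even 2%N isT E2)|rewrite eqxx].
Qed.

(** Unique factorization: among the divisors of [reserved k * M] the only
reserved prime is [reserved k], and [M] is odd. *)
Lemma embed_coef_core x k M : a M != 0 ->
  embed_coef x (reserved k * M) = x k * (8^-1 * (a M)%:C).
Proof.
move=> aM; have [M1 Mp] := a_supp aM.
rewrite /embed_coef mconv_single ?(ltnW M1) ?prime_gt0 ?reserved_prime //.
  by rewrite phi_coef_reserved peak_coef_core.
move=> d e E /phi_coef_eq0[j dj]; rewrite dj in E *.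
have : (reserved j %| reserved k * M)%N by rewrite -E dvdn_mulr.
rewrite Euclid_dvdM ?reserved_prime // => /orP[|jM].
  by rewrite dvdn_prime2 ?reserved_prime // => /eqP.
by have := Mp j.+1; rewrite -/(reserved j) jM.
Qed.

(** The coefficients at the multiples of one reserved prime reproduce those of
the core series. *)
Lemma embed_diverges x k (sigma : R) s : x k != 0 -> sigma < 2^-1 ->
  complex.Re s = sigma -> ~ abs_summable (dterm (fun n => embed_coef x n.+1) s).
Proof.
move=> xk sig Res su; set c := fun n => normc (nterm (embed_coef x) s n).
have c0 n : 0 <= c n by exact: normc_ge0.
pose K := limn (series (fun n => normc (dterm (fun n => embed_coef x n.+1) s n))).
have cK m : \sum_(N < m) c N <= K.
  case: m => [|m].
    by rewrite big_ord0; have := sum_le_limn 0 (fun k => normc_ge0 _) su; rewrite big_ord0.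
  rewrite -(sum_shift (u := c)) /c; last by rewrite nterm0 ?embed_coef0 ?normc0.
  by apply: sum_le_limn su => j; exact: normc_ge0.
pose r := reserved k; have r0 : (0 < r)%N by rewrite prime_gt0 ?reserved_prime.
have sub m : \sum_(M < m) c (r * M)%N <= \sum_(N < r * m) c N.
  rewrite -(big_mkord xpredT c); elim: m => [|m IH].
    by rewrite big_ord0 sumr_ge0 // => i _; exact: normc_ge0.
  have mm : (r * m <= r * m.+1)%N by rewrite leq_mul2l leqnSn orbT.
  rewrite (big_cat_nat _ mm) //= big_ord_recr; apply: lerD => //.
  rewrite big_ltn; last by rewrite ltn_pmul2l.
  by rewrite lerDl sumr_ge0.
pose t := normc (x k) * 8^-1 * rpow r sigma.
have nx : 0 < normc (x k).
  by rewrite lt_neqAle normc_ge0 eq_sym andbT; apply: contra_neq xk => /eq0_normc.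
have t0 : 0 < t by rewrite !mulr_gt0 ?invr_gt0 ?rpow_gt0.
have term M : t * (`|a M| * rpow M sigma) <= c (r * M)%N.
  have [->|aM] := eqVneq (a M) 0; first by rewrite normr0 mul0r mulr0.
  have [M1 _] := a_supp aM.
  rewrite /c /nterm (normcM (embed_coef x _)) normc_dpow Res embed_coef_core //.
  rewrite (normcM (x k)) (normcM 8^-1) normc_half normc_real rpowM // ?(ltnW M1) //.
  by rewrite /t le_eqVlt; apply/orP; left; apply/eqP; ring.
have [m mP] := a_div sig ((K + 1) / t).
have : K + 1 <= K.
  apply: le_trans (cK (r * m)%N); apply: le_trans (sub m).
  move: mP; rewrite ler_pdivrMr // mulrC mulr_sumr => mP; apply: le_trans mP _.
  by apply: ler_sum => M _; exact: term.
by rewrite gerDl ler10.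
Qed.

Lemma embed_coef_represents x :
  represented_by (embed_fun x) (fun n => embed_coef x n.+1).
Proof.
exists 2^-1; first by rewrite invr_ge0.
by move=> s s2; have [[sigma -> H] _] := embed_represented x; exact: H.
Qed.

Lemma embed_in x : embed_fun x \in @AC0_pred R.
Proof.
have s0 s : halfplane 0 s -> 0 < complex.Re s by [].
apply/asboolP; split; last first.
  by exists (embed_poly x); [exact: embed_polyP|exact: embed_unif].
split.
- by move=> s /negP ns; rewrite /embed_fun (negbTE ns).
- move=> s /s0 sp; apply: cdiff_derivable.
  apply: (@cdiff_eq _ (fun t => peak t * phi x t) _ _ (complex.Re s)) => //.
    by move=> h hs; rewrite /embed_fun Re_add_gt0.
  by apply: cdiffM; [exact: cdiff_peak|exact: cdiff_phi].
- exists (ell1_sum x) => s /s0 sp; rewrite /embed_fun sp (normcM (peak s)).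
  apply: le_trans (normc_phi_le x (ltW sp)).
  by rewrite ler_piMl ?normc_ge0 // normc_peak_le.
- by exists (fun n => embed_coef x n.+1); exact: embed_coef_represents.
Qed.

Lemma embed_abscissa x : x != 0 ->
  abs_cvg_abscissa (fun n => embed_coef x n.+1) = (2^-1)%:E.
Proof.
move=> x0; have [k xk] : exists k, x k != 0.
  apply/not_existsP => H; case/negP: x0; apply/eqP/val_inj/funext => k.
  by apply/eqP; apply/negPn/negP => /H.
apply/eqP; rewrite eq_le; apply/andP; split.
  apply: ereal_inf_lbound; exists 2^-1 => // s.
  by have [_] := embed_represented x; exact.
apply: le_ereal_inf_tmp => _ [sigma sigP <-]; rewrite lee_fin leNgt; apply/negP => sig.
pose m := (sigma + 2^-1) / 2; have m1 : sigma < m by rewrite /m; lra.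
have m2 : m < 2^-1 by rewrite /m; lra.
by case: (embed_diverges (s := m%:C) xk m2 erefl); exact: sigP.
Qed.

(** The phases of 2 and of the reserved primes are aligned in
[1 + 2 ^ - s + \sum_k x_k q_k ^ - s]. The modulus then nearly attains
[2 + \sum_k |x_k|], which forces both [|1 + 2 ^ - s|] to be near 2, so that the
peak function is near its maximum, and [phi x s] to be near the norm of [x]. *)
Lemma embed_norm_almost x (e : R) : 0 < e ->
  exists2 s, 0 < complex.Re s &
    ell1_sum x - e * (4 + 2 * ell1_sum x) <= normc (embed_fun x s).
Proof.
move=> e0; have [m0 m0P] := ell1_sum_cvg x e0; pose m := m0.
set S := ell1_sum x in m0P *; pose Sm := \sum_(k < m) normc (x k).
have SmS : S - Sm < e by exact: m0P.
pose Lam := ln 2 + \sum_(k < m) normc (x k) * ln (reserved k)%:R.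
have Lam0 : 0 <= Lam.
  rewrite addr_ge0 ?(lnn_ge0 2) // sumr_ge0 // => k _.
  by rewrite mulr_ge0 ?normc_ge0 ?lnn_ge0.
have Lam1 : 0 < Lam + 1 by rewrite ltr_wpDl.
(* On the line of real part [sig] the moduli [n ^ - sig] differ from 1 by at most
[sig * ln n], a total loss of at most [e]. *)
pose sig := e / (Lam + 1); have sig0 : 0 < sig by rewrite divr_gt0.
have sigL : sig * Lam <= e.
  by rewrite /sig mulrAC ler_pdivrMr // ler_wpM2l ?(ltW e0) // lerDl.
have rpow_ge n : 1 - sig * ln n%:R <= rpow n sig.
  by have := expR_ge1Dx (- (sig * ln n%:R)).
pose p j := nth_prime j.*2; pose cf j := if j is k.+1 then x k else 1.
have p_inj : injective p by move=> i j /nth_prime_inj/double_inj.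
have [t tP] := @prime_phases_align _ p 1 (fun j => cf j * dpow (p j) sig%:C) m.+1 e
  (fun j => prime_nth_prime _) p_inj ler01 e0.
pose s : C := sig%:C + (0 +i* t).
have Res : complex.Re s = sig by rewrite /s ReD /= addr0.
have s0 : 0 < complex.Re s by rewrite Res.
exists s => //; rewrite /embed_fun s0 (normcM (peak s)).
pose z := dpow 2 s; pose ph : C := \sum_(k < m) x k * dpow (reserved k) s.
have {tP} : 2 + Sm - 2 * e <= normc (1 + z + ph).
  have -> : 1 + z + ph = 1%:C + \sum_(j < m.+1) cf j * dpow (p j) sig%:C * freq (p j) t.
    rewrite -addrA big_ord_recl /= mul1r -dpowD; congr (_ + (_ + _)).
    by apply: eq_bigr => k _; rewrite -mulrA -dpowD.
  apply: le_trans tP; rewrite big_ord_recl.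
  have -> : normc (cf (@ord0 m) * dpow (p (@ord0 m)) sig%:C) = rpow 2 sig.
    by rewrite mul1r normc_dpow.
  have H : Sm - sig * (\sum_(k < m) normc (x k) * ln (reserved k)%:R) <=
      \sum_(i < m) normc (cf (lift ord0 i) * dpow (p (lift ord0 i)) sig%:C).
    rewrite mulr_sumr -sumrB; apply: ler_sum => k _.
    rewrite (normcM (cf _)) normc_dpow /= /bump /=.
    have := ler_wpM2l (normc_ge0 (x k)) (rpow_ge (reserved k)).
    by rewrite mulrBr mulr1 mulrCA.
  have := rpow_ge 2; move: H sigL; rewrite /Lam mulrDr.
  by move: (\sum_(_ < _) _) (sig * \sum_(_ < _) _) (sig * ln _) => u1 u2 u3; lra.
have z1 : normc z <= 1 by rewrite normc_dpow_le1 // ltW.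
have phm : normc ph <= Sm.
  apply: le_trans (normc_sum _ _ _) _; apply: ler_sum => k _.
  by apply: phi_term_le; exact: ltW.
have zz : normc (1 + z) <= 2 by apply: le_trans (normcDC _ _) _; rewrite normc1; lra.
have := normcDC (1 + z) ph => h1 h2.
have h3 : 1 - 2 * e <= normc (peak s).
  by apply: normc_multiplier_ge => //; [have [] := w_core s0|lra].
have h4 : normc ph <= normc (phi x s) + e.
  rewrite -(subrK (phi x s) ph) addrC; apply: le_trans (normcDC _ _) _.
  rewrite lerD2l normc_distC; apply: le_trans (phi_tail x m (ltW s0)) _.
  exact: ltW.
have h5 : normc (phi x s) <= S by apply: normc_phi_le; exact: ltW.
have := ler_wpM2r (normc_ge0 (phi x s)) h3.
move: h1 h2 h4 h5 zz SmS; move: (normc (phi x s)) (normc ph) (normc (1 + z)) => f g h.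
move: (normc (_ + _)) => h0 h1 h2 h4 h5 h6 h7; rewrite -/S; nra.
Qed.

Lemma sup_norm_embed x : sup_norm (embed_fun x) = ell1_sum x.
Proof.
have S0 : 0 <= ell1_sum x.
  exact: le_trans (normc_ge0 _) (normc_phi_le x (lexx (complex.Re (0 : C)))).
apply/eqP; rewrite eq_le; apply/andP; split.
  apply: ge_sup_norm => s; rewrite /halfplane /= => s0.
  rewrite /embed_fun s0 (normcM (peak s)).
  apply: le_trans (normc_phi_le x (ltW s0)).
  by rewrite ler_piMl ?normc_ge0 // normc_peak_le.
apply/ler_addgt0Pr => e e0.
have K0 : 0 < 4 + 2 * ell1_sum x by lra.
have [s s0 H] := embed_norm_almost x (divr_gt0 e0 K0).
have H2 := @le_sup_norm R (MkAC0 (embed_in x)) s s0; rewrite /= in H2.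
by move: H; rewrite divfK ?gt_eqF // lerBlDr => H; apply: le_trans H _; rewrite lerD2r.
Qed.

Definition embed x : AC0 R := MkAC0 (embed_in x).

Lemma embed_is_linear : linear embed.
Proof.
move=> k x y; apply: val_inj; apply/funext => s /=.
rewrite -[RHS]/(k * embed_fun x s + embed_fun y s) /embed_fun.
case: ifP => s0; last by rewrite mulr0 addr0.
by rewrite phi_lin ?(ltW s0) // mulrDr mulrCA.
Qed.

End Embedding.

Section IsometricCopy.
Context {R : realType}.

Lemma isometric_copy_ell1 : exists T : {linear ell1 R -> AC0 R},
  (forall x, `|T x| = `|x|) /\ forall x, x != 0 -> scriptM (T x).
Proof.
have [a [w [X [a_supp a_sqr a_div w_core [geX w_approx]]]]] := @core_function R.
pose T0 := embed a_supp a_sqr w_core geX w_approx.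
have Tlin : linear T0 by exact: embed_is_linear.
pose T : {linear ell1 R -> AC0 R} := HB.pack T0 (GRing.isLinear.Build _ _ _ _ T0 Tlin).
exists T; split=> [x|x x0].
  rewrite -[LHS]/((sup_norm (embed_fun w x))%:C) -[RHS]/((ell1_sum x)%:C).
  by congr (_%:C); exact: (sup_norm_embed a_supp a_sqr w_core geX w_approx).
exists (fun n => embed_coef a x n.+1).
  exact: embed_coef_represents.
exact: (embed_abscissa a_supp a_sqr a_div geX w_approx x0).
Qed.

End IsometricCopy.

(** * Extension of independent sets to Hamel bases *)

Section HamelExtension.
Context {K : numFieldType} {E : topologicalLmodType K}.
Implicit Types (A B L V : set E).

Lemma lin_span_incl B v : B v -> lin_span B v.
Proof.
move=> Bv; exists [:: v], (fun=> 1); split; last by rewrite big_seq1 scale1r.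
by move=> x /=; rewrite inE => /eqP ->.
Qed.

Lemma lin_independent_chain L (F : set (set E)) :
  lin_independent L -> (forall A, F A -> lin_independent (L `|` A)) ->
  total_on F subset -> lin_independent (L `|` \bigcup_(A in F) A).
Proof.
move=> Li FL Ft s c us sF.
have : [set` s] `<=` L \/ exists2 A, F A & [set` s] `<=` L `|` A.
  elim: s sF {us} => [_|x s IH sF]; first by left=> x /=; rewrite in_nil.
  have : [set` s] `<=` L `|` \bigcup_(A in F) A.
    by move=> y ys; apply: sF; rewrite /= inE ys orbT.
  have cons A : A x -> [set` s] `<=` A -> [set` (x :: s)] `<=` A.
    by move=> Ax sA y /=; rewrite inE => /orP[/eqP->|/sA].
  move=> /IH; have [Lx|[B FB Bx]] : (L `|` \bigcup_(A in F) A) x.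
  - by apply: sF; rewrite /= mem_head.
  - by case=> [sL|[A FA sA]]; [left; exact: cons|right; exists A => //; apply: cons => //; left].
  - case=> [sL|[A FA sA]].
      right; exists B => //; apply: cons; first by right.
      by move=> y /sL; left.
    have [AB|BA] := Ft _ _ FA FB; right; [exists B|exists A] => //; apply: cons.
    + by right.
    + by move=> y /sA[|/AB]; [left|right].
    + by right; exact: BA.
    + exact: sA.
by case=> [sL|[A FA sA]]; [exact: Li|exact: (FL A FA)].
Qed.

Lemma lin_independent_extend B v : lin_independent B -> ~ lin_span B v ->
  lin_independent (B `|` [set v]).
Proof.
move=> Bi vB s c us sB s0.
have inB x : x \in s -> x != v -> B x.
  by move=> xs /eqP xv; have [//|] := sB x xs.
have [vs|vs] := boolP (v \in s); last first.
  by apply: (Bi s c us _ s0) => x /= xs; apply: inB => //; apply: contraNneq vs => <-.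
have urem : uniq (rem v s) by exact: rem_uniq.
have remB : [set` rem v s] `<=` B.
  by move=> x /=; rewrite mem_rem_uniq // => /andP[xv xs]; exact: inB.
move: s0; rewrite (big_rem v) //= => s0.
have cv : c v = 0.
  apply/eqP/negPn/negP => cv; apply: vB.
  exists (rem v s), (fun x => - (c v)^-1 * c x); split=> //.
  move/eqP: s0; rewrite addrC addr_eq0 => /eqP s0.
  under eq_bigr do rewrite -scalerA.
  by rewrite -scaler_sumr s0 scaleNr scalerN opprK scalerA mulVf // scale1r.
move: s0; rewrite cv scale0r add0r => s0 x xs.
have [->//|xv] := eqVneq x v.
by apply: (Bi _ _ urem remB s0); rewrite mem_rem_uniq // inE xv.
Qed.

(** Zorn's lemma is applied to the sets to be added to [L], so that the union of
the empty chain causes no trouble. *)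
Lemma hamel_basis_extend V L : L `<=` V -> lin_independent L ->
  exists2 B, hamel_basis V B & L `<=` B.
Proof.
move=> LV Li.
have [|A [[AV Ai] Amax]] :=
  @Zorn_bigcup E [set A : set E | A `<=` V /\ lin_independent (L `|` A)].
  move=> F Ft tF; split; first by move=> x [A /Ft[AV _] /AV].
  by apply: lin_independent_chain => // A /Ft[].
exists (L `|` A); last by move=> x; left.
split=> // [x [/LV|/AV]//|v Vv].
apply: contrapT => vB; apply: (Amax (A `|` [set v])).
  split; first by move=> x; left.
  by move/(_ v (or_intror erefl)) => Av; apply: vB; apply: lin_span_incl; right.
split; first by move=> x [/AV//|->].
by rewrite setUA; exact: lin_independent_extend.
Qed.

End HamelExtension.

(** * Completeness and a large independent family *)

Section Ell1Facts.
Context {R : realType}.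
Local Notation C := R[i].
Implicit Types (x y : ell1 R).

Lemma ell1_normE x : `|x| = (limn (series (fun k => normc (x k))))%:C.
Proof. by []. Qed.

Lemma ell1_partial_le x m (e : R) : `|x| <= e%:C -> \sum_(k < m) normc (x k) <= e.
Proof.
rewrite ell1_normE lecR; apply: le_trans.
by apply: sum_le_limn (@ell1_summable R x) => k; exact: normc_ge0.
Qed.

Lemma ell1_norm_le x (e : R) :
  (forall m, \sum_(k < m) normc (x k) <= e) -> `|x| <= e%:C.
Proof.
move=> H; rewrite ell1_normE lecR; apply: limr_le; first exact: (@ell1_summable R x).
by near=> n; rewrite /series /= big_mkord.
Unshelve. all: by end_near. Qed.

Lemma ell1_coord_le x k (e : R) : `|x| <= e%:C -> normc (x k) <= e.
Proof.
move=> /(ell1_partial_le k.+1); rewrite big_ord_recr; apply: le_trans.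
by rewrite lerDr sumr_ge0 // => i _; exact: normc_ge0.
Qed.

Lemma ell1_sumE (I : Type) (s : seq I) (F : I -> ell1 R) k :
  (\sum_(i <- s) F i : ell1 R) k = \sum_(i <- s) F i k.
Proof. by elim/big_ind2: _ => // x1 y1 x2 y2 <- <-. Qed.

(** Rapidly Cauchy sequences converge: coordinatewise by telescoping, in norm by
passing to the limit in finite partial sums. *)
Lemma ell1_complete (x : nat -> ell1 R) :
  (forall n m, (n <= m)%N -> `|x m - x n| <= (2^-1 ^+ n : R)%:C) ->
  exists y : ell1 R, forall n, `|y - x n| <= (2^-1 ^+ n : R)%:C.
Proof.
move=> xC.
pose z n k : C := x n.+1 k - x n k.
have zs k : abs_summable (z ^~ k).
  apply: (@abs_summable_bounded _ _ 2) => m.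
  apply: (@le_trans _ _ (\sum_(n < m) 2 * half_pow n)).
    apply: ler_sum => n _; rewrite /half_pow exprS mulrA divff // mul1r.
    have := xC n n.+1 (leqnSn n) => /(ell1_coord_le k).
    by [].
  rewrite -mulr_sumr.
  have -> : \sum_(n < m) half_pow n = 1 - 2^-1 ^+ m :> R.
    by rewrite -series_half_pow /series /= big_mkord.
  by rewrite ler_piMr // lerBlDr lerDl exprn_ge0.
pose L k := x 0%N k + csum (z ^~ k).
have xL k : (fun m => x m k) @ \oo --> L k.
  have -> : (fun m => x m k) = (fun m => x 0%N k + series (z ^~ k) m).
    apply/funext => m; rewrite /series /= telescope_sumr // addrC subrK //.
  by apply: cvgD; [exact: cvg_cst|exact: csum_cvg].
have dist K n : \sum_(k < K) normc (L k - x n k) <= 2^-1 ^+ n.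
  apply/ler_addgt0Pr => e e0.
  have H : (fun m => \sum_(k < K) normc (L k - x m k)) @ \oo --> (0 : R).
    elim: K => [|K IH].
      rewrite (_ : (fun _ => _) = fun=> 0); first exact: cvg_cst.
      by apply/funext => m; rewrite big_ord0.
    rewrite (_ : (fun _ => _) = fun m => \sum_(k < K) normc (L k - x m k) + normc (L K - x m K)).
      rewrite -[X in _ --> X]addr0; apply: cvgD => //.
      apply/cvgrPdist_lt => d d0; have /cvg_normcP/(_ d d0) := xL K.
      by apply: filterS => m; rewrite sub0r normrN ger0_norm ?normc_ge0.
    by apply/funext => m; rewrite big_ord_recr.
  move/cvgrPdist_lt : H => /(_ _ e0)[m0 _ /(_ (maxn m0 n) (leq_maxl _ _))] /=.
  rewrite sub0r normrN => /(le_lt_trans (ler_norm _)) H.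
  set m := maxn m0 n in H.
  apply: (@le_trans _ _ (\sum_(k < K) normc (x m k - x n k) +
      \sum_(k < K) normc (L k - x m k))); last first.
    by rewrite lerD ?(ltW H) //; apply: (ell1_partial_le K (xC n m (leq_maxr _ _))).
  rewrite -big_split; apply: ler_sum => k _ /=.
  rewrite -(subrK (x m k) (L k)) -addrA addrC; apply: le_trans (normcDC _ _) _.
  by rewrite addrK.
have Ls : abs_summable L.
  apply: (@abs_summable_bounded _ _ (1 + limn (series (fun k => normc (x 0%N k))))) => m.
  apply: (@le_trans _ _ (\sum_(k < m) normc (L k - x 0%N k) + \sum_(k < m) normc (x 0%N k))).
    rewrite -big_split; apply: ler_sum => k _ /=.
    by rewrite -{1}(subrK (x 0%N k) (L k)) normcDC.
  apply: lerD; first exact: dist.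
  by apply: sum_le_limn (@ell1_summable R (x 0%N)) => k; exact: normc_ge0.
have Lin : L \in @ell1_pred R by apply/asboolP.
exists (MkEll1 Lin) => n; apply: ell1_norm_le => m.
exact: (dist m n).
Qed.

(** The initial segments of two distinct sets of integers are eventually
distinct, so coding initial segments turns the subsets of the integers into an
almost disjoint family of supports. *)
Definition segment_code (A : set nat) n : nat :=
  pickle (mkseq (fun k => `[< A k >]) n).

Definition almost_disjoint_fun (A : set nat) (m : nat) : C :=
  if `[< exists n, m = segment_code A n >] then (half_pow m)%:C else 0.

Lemma almost_disjoint_in A : almost_disjoint_fun A \in @ell1_pred R.
Proof.
apply/asboolP; apply: (@abs_summable_le _ _ half_pow) => [m|].
  rewrite /almost_disjoint_fun; case: ifP => _; last by rewrite normc0 exprn_ge0.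
  by rewrite normc_real ger0_norm // exprn_ge0.
by apply/cvg_ex; exists 1; exact: cvg_half_pow.
Qed.

Definition almost_disjoint A : ell1 R := MkEll1 (almost_disjoint_in A).

Lemma segment_code_inj A B n n' k : segment_code A n = segment_code B n' ->
  (k < n)%N -> (A k <-> B k).
Proof.
move=> /(pcan_inj pickleK) E kn.
have nn : n = n' by rewrite -[LHS](size_mkseq (fun k => `[< A k >])) E size_mkseq.
have := congr1 (nth false ^~ k) E; rewrite !nth_mkseq -?nn // => H.
by split=> ?; apply/asboolP; [rewrite -H|rewrite H]; apply/asboolP.
Qed.

Lemma segments_separate (s : seq (set nat)) A : exists n, forall B, B \in s ->
  B <> A -> forall n', segment_code A n <> segment_code B n'.
Proof.
elim: s => [|B s [n IH]]; first by exists 0%N => B; rewrite in_nil.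
have [BA|AB] := pselect (B = A).
  by exists n => D; rewrite inE => /orP[/eqP->//|]; exact: IH.
have [k kAB] : exists k, ~ (A k <-> B k).
  apply/not_existsP => H; apply: AB; apply/seteqP; split=> k.
    by have /contrapT[_] := H k.
  by have /contrapT[] := H k.
exists (maxn n k.+1) => D; rewrite inE => /orP[/eqP-> _ n' E|].
  by apply: kAB; exact: (segment_code_inj E (leq_maxr _ _)).
move=> Ds DA n' E; apply: (IH D Ds DA n).
have nn' : n' = maxn n k.+1.
  have := pcan_inj pickleK E => /(congr1 size); by rewrite !size_mkseq.
have H j : (j < n)%N -> `[< A j >] = `[< D j >].
  move=> jn; apply/asboolP/asboolP => ?.
    by apply/(segment_code_inj E) => //; rewrite leq_max jn.
  by apply/(segment_code_inj E) => //; rewrite leq_max jn.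
rewrite /segment_code; congr pickle; apply: (@eq_from_nth _ false); rewrite !size_mkseq // => j jn.
by rewrite !nth_mkseq // H.
Qed.

Lemma almost_disjoint_code A n : almost_disjoint A (segment_code A n) != 0.
Proof.
rewrite /= /almost_disjoint_fun asboolT; last by exists n.
by rewrite fmorph_eq0 expf_neq0 // invr_eq0.
Qed.

Lemma almost_disjoint_inj : injective almost_disjoint.
Proof.
move=> A B E; apply: contrapT => AB.
have [n nP] := segments_separate [:: B] A.
have := almost_disjoint_code A n; rewrite E /= /almost_disjoint_fun asboolF ?eqxx //.
by move=> [n' /(nP B (mem_head _ _) (nesym AB))].
Qed.

Lemma almost_disjoint_free (s : seq (set nat)) (c : set nat -> C) : uniq s ->
  \sum_(A <- s) c A *: almost_disjoint A = 0 -> forall A, A \in s -> c A = 0.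
Proof.
move=> us s0 A As; have [n nP] := segments_separate s A.
have := congr1 (fun x : ell1 R => x (segment_code A n)) s0.
rewrite ell1_sumE (bigD1_seq A) //= big1_seq ?addr0.
  move=> /eqP; rewrite mulf_eq0 => /orP[/eqP//|].
  by rewrite (negbTE (almost_disjoint_code A n)).
move=> B /andP[/eqP BA Bs]; rewrite -[LHS]/(c B * almost_disjoint B (segment_code A n)).
rewrite /= /almost_disjoint_fun asboolF ?mulr0 // => -[n'].
exact: nP.
Qed.

End Ell1Facts.

(** * Cardinality, closedness and the theorem *)

Section Cardinality.
Context {R : realType}.
Local Notation C := R[i].
Implicit Types (f g : AC0 R) (s h : C).

(** The continuity needed to recover a function from its values at the points
with rational coordinates. *)
Lemma AC0_locally_lipschitz f s : 0 < complex.Re s -> exists (K d : R), 0 < d /\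
  forall h, normc h < d -> normc (f (s + h) - f s) <= K * normc h.
Proof.
move=> s0; have [_ /(_ s s0) /cvg_ex[D DP] _ _] := AC0_HinftyP f.
move/cvgrPdist_lt : DP => /(_ 1 ltr01) /nbhs_ballP[e /= e0 eP].
have eRe : e = (complex.Re e)%:C by rewrite (RRe_real (gtr0_real e0)).
move: e0; rewrite eRe ltcR => d0.
exists (normc D + 1), (complex.Re e); split=> // h hd.
have [->|h0] := eqVneq h 0; first by rewrite addr0 subrr normc0 mulr0.
have hn : 0 < normc h.
  by rewrite lt_neqAle normc_ge0 eq_sym andbT; apply: contra_neq h0 => /eq0_normc.
have := eP h; rewrite /ball /= sub0r normrN normr_normc eRe ltcR => /(_ hd h0).
rewrite normr_normc -[1](rmorph1 (real_complex R)) ltcR [h *: 1]mulr1 (addrC h) => H.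
set q : C := h^-1 *: (f (s + h) - f s) in H.
have -> : f (s + h) - f s = h * q by rewrite /q [_ *: _]/(_ * _) mulVKf.
rewrite (normcM h) mulrC ler_wpM2r ?(ltW hn) //.
rewrite -[q](subrK D) addrC; apply: le_trans (normcDC _ _) _.
by rewrite lerD2l normc_distC ltW.
Qed.

Lemma rational_approx s (e : R) : 0 < complex.Re s -> 0 < e -> exists (a b : rat),
  0 < (ratr a : R) /\ normc ((ratr a +i* ratr b) - s) < e.
Proof.
move=> s0 e0; have e2 : 0 < e / 2 by rewrite divr_gt0.
have [|a] := @rat_in_itvoo R (complex.Re s) (complex.Re s + e / 2); first by rewrite ltrDl.
rewrite in_itv /= => /andP[a1 a2].
have [|b] := @rat_in_itvoo R (complex.Im s) (complex.Im s + e / 2); first by rewrite ltrDl.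
rewrite in_itv /= => /andP[b1 b2].
exists a, b; split; first exact: lt_trans a1.
apply: le_lt_trans (normc_le_ReIm _) _.
rewrite ReD ImD ReN ImN /= !gtr0_norm ?subr_gt0 //; lra.
Qed.

Lemma eq_of_rational_cuts (x y : R) :
  (forall c : rat, x < ratr c <-> y < ratr c) -> x = y.
Proof.
have le (u v : R) : (forall c : rat, u < ratr c -> v < ratr c) -> v <= u.
  move=> H; rewrite leNgt; apply/negP => /rat_in_itvoo[c].
  by rewrite in_itv /= => /andP[/H vc cv]; have := lt_trans vc cv; rewrite ltxx.
by move=> H; apply/eqP; rewrite eq_le !le // => c /H.
Qed.

(** A function is determined by the Dedekind cuts of its values at the points
with rational coordinates. *)
Definition cut_code f : set nat :=
  [set n | exists a b c (re : bool), n = pickle (a, b, c, re) /\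
     (if re then complex.Re (f (ratr a +i* ratr b))
      else complex.Im (f (ratr a +i* ratr b))) < ratr c :> R].

Lemma cut_code_inj : injective cut_code.
Proof.
move=> f g E.
have rE (a b : rat) : f (ratr a +i* ratr b) = g (ratr a +i* ratr b).
  have cE c re : (if re then complex.Re (f (ratr a +i* ratr b))
      else complex.Im (f (ratr a +i* ratr b))) < ratr c :> R <->
      (if re then complex.Re (g (ratr a +i* ratr b))
      else complex.Im (g (ratr a +i* ratr b))) < ratr c :> R.
    have cut f' : cut_code f' (pickle (a, b, c, re)) <->
        (if re then complex.Re (f' (ratr a +i* ratr b))
        else complex.Im (f' (ratr a +i* ratr b))) < ratr c :> R.
      split=> [[a' [b' [c' [re' [/(pcan_inj pickleK)[-> -> -> ->]]]]]]//|H].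
      by exists a, b, c, re.
    by rewrite -!cut E.
  apply/eqP; rewrite eq_complex; apply/andP; split; apply/eqP.
    by apply: eq_of_rational_cuts => c; exact: (cE c true).
  by apply: eq_of_rational_cuts => c; exact: (cE c false).
apply: val_inj; apply/funext => s /=.
have [f0 _ _ _] := AC0_HinftyP f; have [g0 _ _ _] := AC0_HinftyP g.
have [s0|ns] := pselect (halfplane 0 s); last by rewrite f0 ?g0.
have [Kf [df [df0 Hf]]] := AC0_locally_lipschitz f s0.
have [Kg [dg [dg0 Hg]]] := AC0_locally_lipschitz g s0.
apply/eqP; rewrite -subr_eq0; apply/eqP/eq0_normc/eqP.
rewrite eq_le normc_ge0 andbT; apply/ler_addgt0Pr => e e0; rewrite add0r.
pose K := `|Kf| + `|Kg| + 1; have K0 : 0 < K by rewrite ltr_wpDl ?addr_ge0.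
pose d := Num.min (Num.min df dg) (e / K).
have d0 : 0 < d by rewrite !lt_min df0 dg0 divr_gt0.
have [a [b [a0 abs]]] := rational_approx s0 d0.
set h := _ - s in abs; have hE : ratr a +i* ratr b = s + h by rewrite /h addrC subrK.
have := rE a b; rewrite hE => fgE; move: abs; rewrite !lt_min => /andP[/andP[h1 h2] h3].
have -> : f s - g s = (g (s + h) - g s) - (f (s + h) - f s).
  by rewrite fgE; ring.
apply: le_trans (normcBC _ _) _.
apply: (@le_trans _ _ (K * normc h)); last by rewrite mulrC -ler_pdivlMr // ltW.
have := Hf h h1; have := Hg h h2; have := normc_ge0 h.
have := ler_norm Kf; have := ler_norm Kg; rewrite /K.
move: (normc h) (normc _) (normc _) (`|Kf|) (`|Kg|) => t u v kf kg.
by move=> *; nra.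
Qed.

End Cardinality.

Section Spaceability.
Context {R : realType}.
Local Notation C := R[i].
Variable T : {linear ell1 R -> AC0 R}.
Hypothesis Tiso : forall x, `|T x| = `|x|.

Lemma isometry_inj : injective T.
Proof.
move=> x y E; apply/eqP; rewrite -subr_eq0 -normr_eq0 -Tiso linearB E subrr.
by rewrite normr0.
Qed.

Lemma range_subspace : vector_subspace (range T).
Proof.
split; first by exists 0 => //; rewrite linear0.
by move=> k _ _ [x _ <-] [y _ <-]; exists (k *: x + y) => //; rewrite linearP.
Qed.

Lemma range_closed : closed (range T).
Proof.
rewrite closure_id; apply/seteqP; split; first exact: subset_closure.
move=> f cf.
have near_f n : exists x, `|f - T x| <= (2^-1 ^+ n.+1 : R)%:C.
  have e0 : 0 < (2^-1 ^+ n.+1 : R)%:C by rewrite ltcR exprn_gt0 // invr_gt0.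
  have [_ [[x _ <-]]] := cf _ (nbhsx_ballx f _ e0).
  by rewrite -ball_normE /= => /ltW H; exists x.
have [x xP] := choice near_f.
have half_ge m n : (n <= m)%N -> (2^-1 ^+ m.+1 : R) <= 2^-1 ^+ n.+1.
  by move=> nm; rewrite ler_wiXn2l ?invr_ge0 // invf_le1 // ler1n.
have [|y yP] := @ell1_complete R x.
  move=> n m nm; rewrite -Tiso linearB.
  rewrite -(subrK f (T (x m))) -addrA; apply: le_trans (ler_normD _ _) _.
  rewrite distrC; apply: le_trans (lerD (xP m) (xP n)) _.
  rewrite -rmorphD lecR [leRHS](_ : _ = 2^-1 ^+ n.+1 + 2^-1 ^+ n.+1).
    by rewrite lerD2r half_ge.
  by rewrite exprS; lra.
exists y => //; apply/eqP; rewrite -subr_eq0 -normr_eq0 eq_le normr_ge0 andbT.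
have nr : `|T y - f| = (complex.Re `|T y - f|)%:C by rewrite RRe_real // normr_real.
rewrite nr lecR; apply/ler_addgt0Pr => e e0; rewrite add0r.
have e2 : 0 < e / 2 by rewrite divr_gt0.
have /cvgrPdist_lt/(_ _ e2)[n _ /(_ n (leqnn n)) /=] :
    (fun m => 2^-1 ^+ m : R) @ \oo --> (0 : R).
  by apply: cvg_expr; rewrite ger0_norm ?invr_ge0 // invf_lt1 // ltr1n.
rewrite sub0r normrN => /(le_lt_trans (ler_norm _)) ne.
rewrite -lecR -nr -(subrK (T (x n)) (T y)) -addrA.
apply: le_trans (ler_normD _ _) _; rewrite -linearB Tiso [X in _ + X]distrC.
apply: le_trans (lerD (yP n) (xP n)) _; rewrite -rmorphD lecR.
have : 2^-1 ^+ n.+1 <= 2^-1 ^+ n :> R.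
  by rewrite exprS ler_piMl ?exprn_ge0 //; lra.
lra.
Qed.

Lemma range_independent_family : exists L : set (AC0 R),
  [/\ L `<=` range T, lin_independent L & ([set: set nat] #<= L)%card].
Proof.
pose g A := T (almost_disjoint A).
have g_inj : injective g by move=> A B /isometry_inj/almost_disjoint_inj.
exists (range g); split.
- by move=> _ [A _ <-]; exists (almost_disjoint A).
- move=> s c us sL s0.
  have /choice[A AP] : forall v, exists A, v \in s -> g A = v.
    move=> v; have [vs|vs] := boolP (v \in s); last by exists set0.
    by have [A _ <-] := sL v vs; exists A.
  have sE : map g (map A s) = s by rewrite -map_comp map_id_in // => v /AP.
  have uA : uniq (map A s) by apply: (@map_uniq _ _ g); rewrite sE.
  have := @almost_disjoint_free R (map A s) (fun D => c (g D)) uA.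
  move=> H v vs; rewrite -(AP v vs); apply: H; last exact: map_f.
  apply: isometry_inj; rewrite linear_sum linear0 -[RHS]s0 -[in RHS]sE !big_map.
  by apply: eq_bigr => D _; rewrite linearZ.
- have := @inj_card_eq _ _ [set: set nat] g (in2W g_inj).
  by rewrite card_eq_sym card_eq_le => /andP[].
Qed.

Lemma AC0_card_le : ([set: AC0 R] #<= [set: set nat])%card.
Proof.
have := @inj_card_eq _ _ [set: AC0 R] (@cut_code R) (in2W (@cut_code_inj R)).
rewrite card_eq_sym card_eq_le => /andP[H _]; apply: card_le_trans H _.
exact: subset_card_le.
Qed.

(** The independent family of size continuum pins the dimensions of both the
range and the ambient space between itself and the cardinality of the ambient
space, which are equal. *)
Lemma maximal_spaceable_of_isometry (Z : set (AC0 R)) :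
  (forall x, x != 0 -> Z (T x)) -> maximal_spaceable Z.
Proof.
move=> TZ; have [L [LT Li Lcard]] := range_independent_family.
have [B hB LB] := hamel_basis_extend (subsetT L) Li.
have [B' hB' LB'] := hamel_basis_extend LT Li.
have card_le (D D' : set (AC0 R)) : L `<=` D' -> (D #<= D')%card.
  move=> LD'; apply: card_le_trans (subset_card_le (@subsetT _ D)) _.
  by apply: card_le_trans AC0_card_le _; apply: card_le_trans Lcard (subset_card_le LD').
exists B; first by exists B => //; exact: card_eqxx.
exists (range T); split; [exact: range_subspace|exact: range_closed| |].
  by exists B' => //; rewrite card_eq_le !card_le.
move=> _ [x _ <-]; have [->|x0] := eqVneq x 0; last by left; exact: TZ.
by right; rewrite linear0.
Qed.

End Spaceability.

Theorem theorem1p1 (R : realType) :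
  maximal_spaceable (@scriptM R) /\
  exists T : {linear ell1 R -> AC0 R},
    (forall x, `|T x| = `|x|) /\ range T `<=` @scriptM R `|` [set 0].
Proof.
have [T [Tiso TM]] := @isometric_copy_ell1 R.
split; first exact: (maximal_spaceable_of_isometry Tiso).
exists T; split=> // _ [x _ <-]; have [->|x0] := eqVneq x 0.
  by right; rewrite linear0.
by left; exact: TM.
Qed.
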